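(* Let $A$ be a semicircular Klaus–Shaw potential whose phase and tail integrals are polynomials of exact degrees $2\mathcal P$ and $2\mathcal Q-1$: $\Phi(\lambda)=\sum_{p=0}^{\mathcal P}\Phi_p\lambda^{2p}$, $\Xi(\lambda)=\mathrm i\sum_{q=1}^{\mathcal Q}\Xi_q\lambda^{2q-1}$; let $M:=\max\{2\mathcal P,2\mathcal Q-1\}$, set $\Phi_p:=0$ for $p>\mathcal P$, $\Xi_q:=0$ for $q>\mathcal Q$, $x^\circ:=-\tfrac12\Xi_1$, and $\nu:=\frac1{2\pi}\int_0^{A_{\max}}\Phi(\mathrm is)\,ds$. For real constants $a_2,\dots,a_M$ write $\widetilde\psi(x,t):=\widetilde\psi(x,(a_2t,\dots,a_Mt))$. (1) If $\Xi(\lambda)$ is a linear monomial (so $M=2\mathcal P$), let $\alpha\ne0$ be real and $a_{2p}:=-\tfrac12\alpha\Phi_p$, $a_{2p+1}:=0$. Then for every integer $K$, with $t^\circ:=(2K+1)/\alpha$, $$\widetilde\psi\Big(x^\circ+\tfrac{\epsilon^2}{\nu}X,\ t^\circ+\tfrac{\epsilon^{M+1}}{a_M\nu^M}T_M\Big)=\mathrm i(-1)^{K+N}\frac{\nu}{\epsilon}\Psi(X,0,\dots,0,T_M)+O(1)$$ as $\epsilon=\epsilon_N\to0$, uniformly for bounded $(X,T_M)\in\mathbb R^2$ (so focusing events recur periodically in $t$ with period $2/|\alpha|$). (2) Otherwise, for each integer $K$ and real $\alpha\ne0$, let $a_{2p}:=-\tfrac12\alpha(2K+1)\Phi_p$ for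 $2\le2p\le M$ and $a_{2q-1}:=-\tfrac12\alpha\Xi_q$ for $3\le 2q-1\le M$; then with $t^\circ:=1/\alpha$ the same asymptotic formula as in (1) holds as $\epsilon=\epsilon_N\to0$, uniformly for bounded $(X,T_M)\in\mathbb R^2$.
   Context: Let $X_-<X_+$. A semicircular Klaus–Shaw potential is $A:\mathbb R\to[0,\infty)$ with support $[X_-,X_+]$, $A(x)=u(x)\sqrt{(X_+-x)(x-X_-)}$ there with $u\ge c>0$ on $[X_-,X_+]$ and $u$ analytic on a complex neighborhood of $[X_-,X_+]$, $A\in L^1\cap C^2(\mathbb R)$ with unique maximizer $x_0$, and $A''(x_0)<0$; $A_{\max}:=A(x_0)$; $x_-(s)<x_+(s)$ solve $A(x)=s$, $0<s<A_{\max}$. $\Phi(\mathrm is):=\int_{x_-(s)}^{x_+(s)}\sqrt{A^2-s^2}\,dx$, $\Xi(\mathrm is):=(x_++x_-)s+\int_{-\infty}^{x_-}(\sqrt{s^2-A^2}-s)dx-\int_{x_+}^\infty(\sqrt{s^2-A^2}-s)dx$, as functions of $\lambda=\mathrm is$, analytically continued. Semiclassical soliton ensemble: $\epsilon=\epsilon_N:=\frac1{N\pi}\int A$; $\Phi(\mathrm i\tilde s_n)=(n+\tfrac12)\epsilon\pi$, $n=0,\dots,N-1$; $\tilde\tau_n:=(-1)^{n+1}e^{\Xi(\mathrm i\tilde s_n)/\epsilon}$; $\mathbf t=(t_2,\dots,t_M)$, $Q(\lambda;x,\mathbf t):=\lambda x+\sum_{m=2}^M\lambda^mt_m$; $c_n(x,\mathbf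 t):=\tilde\tau_n\frac{\prod_{j=0}^{N-1}(\mathrm i\tilde s_n+\mathrm i\tilde s_j)}{\prod_{j\neq n}(\mathrm i\tilde s_n-\mathrm i\tilde s_j)}e^{2\mathrm iQ(\mathrm i\tilde s_n;x,\mathbf t)/\epsilon}$; $\widetilde{\mathbf M}$ is the unique $2\times2$ matrix meromorphic in $\lambda$, simple poles only at $\pm\mathrm i\tilde s_n$, $\operatorname{Res}_{\mathrm i\tilde s_n}\widetilde{\mathbf M}=\lim\widetilde{\mathbf M}\begin{pmatrix}0&0\\c_n&0\end{pmatrix}$, $\operatorname{Res}_{-\mathrm i\tilde s_n}\widetilde{\mathbf M}=\lim\widetilde{\mathbf M}\begin{pmatrix}0&-c_n^*\\0&0\end{pmatrix}$, $\widetilde{\mathbf M}\to\mathbb I$ at $\infty$; $\widetilde\psi(x,\mathbf t):=2\mathrm i\lim_{\lambda\to\infty}\lambda\widetilde M_{12}$. $\Psi(X,T_2,\dots,T_M):=2\mathrm i\lim_{\Lambda\to\infty}\Lambda R_{12}(\Lambda)$, where $\mathbf R$ is the unique $2\times2$ matrix analytic in $|\Lambda|<1$ and $|\Lambda|>1$ with $\mathbf R_+=\mathbf R_-e^{-\mathrm i\theta\sigma_3}\mathbf Q^{-1}e^{\mathrm i\theta\sigma_3}$ on $|\Lambda|=1$ ($\mathbf R_-$ interior, $\mathbf R_+$ exterior boundary value), $\theta:=\Lambda X+\sum_{m=2}^M\Lambda^mT_m+2\Lambda^{-1}$, $\mathbf Q:=\frac1{\sqrt2}\begin{pmatrix}1&-1\\1&1\end{pmatrix}$,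 and $\mathbf R\to\mathbb I$ at $\infty$.
   Formalization: Twice continuous differentiability of A is required only on the open interval (X_-,X_+), since a semicircular potential has vertical tangents at X_± and cannot be C² on all of ℝ; the parenthetical on periodic recurrence is left as immediate from the formula for all K. *)

(* Defs.v *)
From Stdlib Require Import Reals List.
From Coquelicot Require Import Coquelicot.
Set Implicit Arguments.
Open Scope R_scope.

Definition Cexp (z : C) : C :=
  (RtoC (exp (fst z)) * (cos (snd z), sin (snd z)))%C.

Record M2 := mkM2 { m11 : C; m12 : C; m21 : C; m22 : C }.
Definition M2I : M2 := mkM2 1%C 0%C 0%C 1%C.
Definition M2mul (A B : M2) : M2 :=
  mkM2 (m11 A * m11 B + m12 A * m21 B)%C (m11 A * m12 B + m12 A * m22 B)%C
       (m21 A * m11 B + m22 A * m21 B)%C (m21 A * m12 B + m22 A * m22 B)%C.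
Definition M2scal (c : C) (A : M2) : M2 :=
  mkM2 (c * m11 A)%C (c * m12 A)%C (c * m21 A)%C (c * m22 A)%C.

Definition M2lim (f : C -> M2) (F : (C -> Prop) -> Prop) (L : M2) : Prop :=
  filterlim (fun z => m11 (f z)) F (locally (m11 L)) /\
  filterlim (fun z => m12 (f z)) F (locally (m12 L)) /\
  filterlim (fun z => m21 (f z)) F (locally (m21 L)) /\
  filterlim (fun z => m22 (f z)) F (locally (m22 L)).

Definition M2holo (f : C -> M2) (z : C) : Prop :=
  ex_derive (fun w => m11 (f w)) z /\ ex_derive (fun w => m12 (f w)) z /\
  ex_derive (fun w => m21 (f w)) z /\ ex_derive (fun w => m22 (f w)) z.

Definition Cpunct (p : C) : (C -> Prop) -> Prop :=
  fun P => exists e : R, 0 < e /\ forall z, Cmod (z - p) < e -> z <> p -> P z.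
Definition Cinfty : (C -> Prop) -> Prop :=
  fun P => exists B : R, forall z, B < Cmod z -> P z.
Definition Cfrom_in (zeta : C) : (C -> Prop) -> Prop :=
  fun P => exists e : R, 0 < e /\ forall z, Cmod (z - zeta) < e -> Cmod z < 1 -> P z.
Definition Cfrom_out (zeta : C) : (C -> Prop) -> Prop :=
  fun P => exists e : R, 0 < e /\ forall z, Cmod (z - zeta) < e -> 1 < Cmod z -> P z.

Definition semicircular_KS (A : R -> R) (Xm Xp x0 : R) (xm xp : R -> R) : Prop :=
  Xm < Xp /\
  (forall x, 0 <= A x) /\
  (forall x, (x < Xm \/ Xp < x) -> A x = 0) /\
  (exists (u : R -> R) (c : R), 0 < c /\
     (forall x, Xm <= x <= Xp -> c <= u x /\ A x = u x * sqrt ((Xp - x) * (x - Xm))) /\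
     (exists (U : C -> Prop) (g : C -> C),
        (forall z, U z -> exists e, 0 < e /\ forall w, Cmod (w - z) < e -> U w) /\
        (forall x, Xm <= x <= Xp -> U (RtoC x)) /\
        (forall z, U z -> ex_derive g z) /\
        (forall x, Xm <= x <= Xp -> g (RtoC x) = RtoC (u x)))) /\
  ex_RInt_gen A (Rbar_locally m_infty) (Rbar_locally p_infty) /\
  (forall x, Xm < x < Xp -> ex_derive_n A 1 x /\ ex_derive_n A 2 x /\
                            continuous (Derive_n A 2) x) /\
  (forall x, A x <= A x0) /\ (forall x, A x = A x0 -> x = x0) /\
  Derive_n A 2 x0 < 0 /\
  (forall s, 0 < s < A x0 ->
     xm s < xp s /\ A (xm s) = s /\ A (xp s) = s /\
     forall x, A x = s -> x = xm s \/ x = xp s).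

Definition Phi_is (A : R -> R) (xm xp : R -> R) (s : R) : R :=
  RInt (fun x => sqrt (A x ^ 2 - s ^ 2)) (xm s) (xp s).

Definition Xi_is (A : R -> R) (xm xp : R -> R) (s : R) : R :=
  (xp s + xm s) * s
  + RInt_gen (fun x => sqrt (s ^ 2 - A x ^ 2) - s)
      (Rbar_locally m_infty) (at_point (xm s))
  - RInt_gen (fun x => sqrt (s ^ 2 - A x ^ 2) - s)
      (at_point (xp s)) (Rbar_locally p_infty).

Definition epsN (A : R -> R) (N : nat) : R :=
  / (INR N * PI) * RInt_gen A (Rbar_locally m_infty) (Rbar_locally p_infty).

(* The soliton-ensemble Riemann-Hilbert problem.
   st n = \tilde s_n (n < N), eps = epsilon_N, Mdeg = M,
   a m = a_m (times t), so that t_m = a m * t.                          *)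
Definition Qphase (Mdeg : nat) (a : nat -> R) (t x : R) (lam : C) : C :=
  (lam * RtoC x + sum_n_m (fun m => Cpow lam m * RtoC (a m * t)) 2 Mdeg)%C.

Definition cn (A : R -> R) (xm xp : R -> R) (N : nat) (st : nat -> R)
  (Mdeg : nat) (a : nat -> R) (x t : R) (n : nat) : C :=
  let eps := epsN A N in
  let tau := (-1) ^ (n + 1) * exp (Xi_is A xm xp (st n) / eps) in
  (RtoC tau
   * (fold_right Cmult 1%C
        (map (fun j => Ci * RtoC (st n) + Ci * RtoC (st j)) (seq 0 N))
      / fold_right Cmult 1%C
        (map (fun j => Ci * RtoC (st n) - Ci * RtoC (st j))
           (filter (fun j => negb (Nat.eqb j n)) (seq 0 N))))
   * Cexp (2 * Ci * Qphase Mdeg a t x (Ci * RtoC (st n)) / RtoC eps))%C.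

Definition is_pole (N : nat) (st : nat -> R) (z : C) : Prop :=
  exists n, (n < N)%nat /\ (z = (Ci * RtoC (st n))%C \/ z = (- (Ci * RtoC (st n)))%C).

Definition soliton_RHP (N : nat) (st : nat -> R) (c : nat -> C) (Mf : C -> M2) : Prop :=
  (forall z, ~ is_pole N st z -> M2holo Mf z) /\
  (forall n, (n < N)%nat ->
     exists Res : M2,
       M2lim (fun z => M2scal (z - Ci * RtoC (st n))%C (Mf z))
             (Cpunct (Ci * RtoC (st n))%C) Res /\
       M2lim (fun z => M2mul (Mf z) (mkM2 0%C 0%C (c n) 0%C))
             (Cpunct (Ci * RtoC (st n))%C) Res) /\
  (forall n, (n < N)%nat ->
     exists Res : M2,
       M2lim (fun z => M2scal (z + Ci * RtoC (st n))%C (Mf z))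
             (Cpunct (- (Ci * RtoC (st n)))%C) Res /\
       M2lim (fun z => M2mul (Mf z) (mkM2 0%C (- Cconj (c n))%C 0%C 0%C))
             (Cpunct (- (Ci * RtoC (st n)))%C) Res) /\
  M2lim Mf Cinfty M2I.

Definition is_psi_tilde (A : R -> R) (xm xp : R -> R) (N : nat) (st : nat -> R)
  (Mdeg : nat) (a : nat -> R) (x t : R) (psi : C) : Prop :=
  exists Mf : C -> M2,
    soliton_RHP N st (cn A xm xp N st Mdeg a x t) Mf /\
    exists w : C, filterlim (fun z => (z * m12 (Mf z))%C) Cinfty (locally w) /\
                  psi = (2 * Ci * w)%C.

Definition theta (Mdeg : nat) (X T : R) (L : C) : C :=
  (L * RtoC X + Cpow L Mdeg * RtoC T + 2 / L)%C.
Definition Qmat : M2 :=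
  M2scal (RtoC (/ sqrt 2)) (mkM2 1%C (-1)%C 1%C 1%C).
Definition Qinv : M2 :=
  M2scal (RtoC (/ sqrt 2)) (mkM2 1%C 1%C (-1)%C 1%C).
Definition expsig3 (c : C) : M2 := mkM2 (Cexp c) 0%C 0%C (Cexp (- c)%C).
Definition jumpPsi (Mdeg : nat) (X T : R) (L : C) : M2 :=
  M2mul (M2mul (expsig3 (- Ci * theta Mdeg X T L)%C) Qinv)
        (expsig3 (Ci * theta Mdeg X T L)%C).

Definition is_Psi (Mdeg : nat) (X T : R) (Psi : C) : Prop :=
  exists Rf : C -> M2,
    (forall z, Cmod z <> 1 -> M2holo Rf z) /\
    (exists Rminus Rplus : C -> M2,
       forall zeta, Cmod zeta = 1 ->
         M2lim Rf (Cfrom_in zeta) (Rminus zeta) /\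
         M2lim Rf (Cfrom_out zeta) (Rplus zeta) /\
         Rplus zeta = M2mul (Rminus zeta) (jumpPsi Mdeg X T zeta)) /\
    M2lim Rf Cinfty M2I /\
    exists w : C, filterlim (fun z => (z * m12 (Rf z))%C) Cinfty (locally w) /\
                  Psi = (2 * Ci * w)%C.

Definition focusing_asymptotics (psiT : nat -> R -> R -> C) (Psi : R -> R -> C)
  (eps : nat -> R) (x0 t0 nu aM : R) (Mdeg : nat) (K : Z) : Prop :=
  forall B : R, 0 < B ->
  exists (Cst : R) (N0 : nat), forall N : nat, (N0 <= N)%nat ->
  forall X T : R, Rabs X <= B -> Rabs T <= B ->
    Cmod (psiT N (x0 + eps N ^ 2 / nu * X)%R
                 (t0 + eps N ^ (Mdeg + 1) / (aM * nu ^ Mdeg) * T)%R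
          - Ci * RtoC (powerRZ (-1) (K + Z.of_nat N) * (nu / eps N))%R * Psi X T)%C
    <= Cst.

(* Main.v *)
Require Import Defs.
From Stdlib Require Import Reals List.
From Coquelicot Require Import Coquelicot.
From Stdlib Require Import Lra Lia ClassicalEpsilon FunctionalExtensionality.
Open Scope R_scope.

(* Put g = e^{2 i phi} prod_j (lambda + i s_j)/(lambda - i s_j), where phi is the
   phase perturbation away from the focusing point.  At the focusing times the
   quantization condition gives c_n = kappa Res g with the constant
   kappa = i (-1)^(K+N), so on a disc containing the poles an explicit factor
   removes them.  After rescaling lambda = (nu/eps) Lambda and conjugating by
   diag(kappa, 1), the soliton problem has the jump 2^{-1/2} ((1, 1/g), (-g, 1))
   on the unit circle, and Psi has this jump with g replaced by e^{2 i theta}.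
   A monotone Riemann sum gives sum_j s_j = 2 nu/eps + O(1), and since
   (1+b)/(1-b) = e^{2b} + O(b^2), the two jump functions differ by O(eps).

   Stability of the Riemann-Hilbert problem is an L2 statement: if V is analytic
   outside the unit disc with V(infinity) = 0 and U is analytic inside, then
   |V - U|^2 = |U|^2 + |V|^2 in L2 of the circle.  Applied to the quotient by a
   fixed solution at (X0, T0), this bounds solutions near (X0, T0) and makes them
   Lipschitz in the jump; a compactness argument gives uniformity in (X, T). *)

(** * Limits and complex differentiability *)

(** The usual small-norm argument needs bounded Cauchy projections on L2. Here both solutions exist
    by hypothesis, so an a priori comparison is enough, and orthogonality of the Hardy spaces
    provides it. Its constants depend on the sup norm of the reference solution, whose growth in (X,
    T) is not controlled; this forces estimates that are local in (X, T). Undoing the scaling costs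
    a factor nu/eps, so the jumps must agree to order eps: there are of order 1/eps factors in the
    product, each with an error O(eps^2).

    Origin of kappa: at the focus 2 i Q = -Xi - i (2K+1) (Phi - Phi_0). The tail Xi cancels the
    exponential in the norming constant, and Phi_0 = Phi(0) = N eps pi by the definition of eps, so
    at the n-th pole the remaining phase is (2K+1) (N - n - 1/2) pi. As 2K+1 is odd, its sign
    alternates in n like that of the norming constant, and the product is independent of n. The
    relations kappa^2 = -1 and conj kappa = -kappa let one factor remove the conjugate poles as
    well. *)

Definition Clim {T : Type} (F : (T -> Prop) -> Prop) (f : T -> C) (l : C) : Prop :=
  forall e : R, 0 < e -> F (fun z => Cmod (f z - l) < e).

Definition Cnear (p : C) : (C -> Prop) -> Prop :=
  fun P => exists e : R, 0 < e /\ forall z, Cmod (z - p) < e -> P z.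

Definition Ccont (f : C -> C) (z : C) : Prop := Clim (Cnear z) f (f z).

(* Caratheodory's form of complex differentiability: the difference quotient
   extends continuously, which turns the differentiation rules into algebra. *)
Definition CD (f : C -> C) (z : C) : Prop :=
  exists q : C -> C, Ccont q z /\ Cnear z (fun w => (f w - f z = q w * (w - z))%C).

Lemma Cmod_pos (z : C) : z <> 0 -> 0 < Cmod z.
Proof. apply Cmod_gt_0. Qed.

Lemma Cneq_of_Cmod (z : C) : 0 < Cmod z -> z <> 0.
Proof. apply Cmod_gt_0. Qed.

Lemma Csub_neq (w z : C) : w <> z -> (w - z)%C <> 0.
Proof. intros n E. apply n. replace w with ((w - z) + z)%C by ring. rewrite E. ring. Qed.

(** The filters [Cpunct], [Cfrom_in] and [Cfrom_out] all have this form up to conversion and differ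
    only in [D]. *)
Lemma within_filter (D : C -> Prop) (p : C) :
  Filter (fun P => exists e : R, 0 < e /\ forall z, Cmod (z - p) < e -> D z -> P z).
Proof.
  constructor.
  - exists 1; split; [lra | auto].
  - intros P Q (e & He & HP) (d & Hd & HQ). exists (Rmin e d).
    split; [apply Rmin_pos; auto|]. intros z Hz Hn.
    pose proof (Rmin_l e d). pose proof (Rmin_r e d).
    split; [apply HP | apply HQ]; auto; lra.
  - intros P Q H (e & He & HP). exists e; split; auto.
Qed.

#[local] Instance Cpunct_filter p : Filter (Cpunct p) := within_filter (fun z => z <> p) p.
#[local] Instance Cfrom_in_filter p : Filter (Cfrom_in p) := within_filter (fun z => Cmod z < 1) p.
#[local] Instance Cfrom_out_filter p : Filter (Cfrom_out p) := within_filter (fun z => 1 < Cmod z) p.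

#[local] Instance Cnear_filter p : Filter (Cnear p).
Proof.
  constructor.
  - exists 1; split; [lra | auto].
  - intros P Q (e & He & HP) (d & Hd & HQ).
    exists (Rmin e d). split; [apply Rmin_pos; auto|]. intros z Hz.
    pose proof (Rmin_l e d). pose proof (Rmin_r e d).
    split; [apply HP | apply HQ]; lra.
  - intros P Q H (e & He & HP). exists e; split; auto.
Qed.

#[local] Instance Cinfty_filter : Filter Cinfty.
Proof.
  constructor.
  - exists 1; auto.
  - intros P Q (e & HP) (d & HQ). exists (Rmax e d). intros z Hz.
    pose proof (Rmax_l e d). pose proof (Rmax_r e d).
    split; [apply HP | apply HQ]; lra.
  - intros P Q H (e & HP). exists e; auto.
Qed.

Lemma Clim_of_filterlim {T : Type} (F : (T -> Prop) -> Prop) `{HF : Filter T F} f (l : C) :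
  filterlim f F (locally l) -> Clim F f l.
Proof.
  intros H e He. apply (H (fun y => Cmod (y - l) < e)).
  apply locally_C. exists (mkposreal e He). intros y Hy. exact Hy.
Qed.

Lemma Clim_ext_F {T : Type} (F : (T -> Prop) -> Prop) `{HF : Filter T F} f g l : F (fun z => f z = g z) -> Clim F f l -> Clim F g l.
Proof.
  intros H H1 e He. generalize (filter_and _ _ H (H1 e He)).
  apply filter_imp. intros x [-> Hx]; exact Hx.
Qed.

Lemma Clim_ext {T : Type} (F : (T -> Prop) -> Prop) `{HF : Filter T F} f g l : (forall z, f z = g z) -> Clim F f l -> Clim F g l.
Proof.
  intros H. apply Clim_ext_F; auto. apply filter_imp with (2 := filter_true). auto.
Qed.

Ltac clim_ext f := apply Clim_ext with f; [typeclasses eauto | |].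
Ltac clim_ext_near f := apply Clim_ext_F with f; [typeclasses eauto | |].

Lemma Clim_const {T : Type} (F : (T -> Prop) -> Prop) `{HF : Filter T F} (c : C) : Clim F (fun _ => c) c.
Proof.
  intros e He. apply filter_imp with (2 := filter_true). intros _ _.
  replace (c - c)%C with (RtoC 0) by ring. rewrite Cmod_0. exact He.
Qed.

Lemma Clim_plus {T : Type} (F : (T -> Prop) -> Prop) `{HF : Filter T F} f g l m : Clim F f l -> Clim F g m ->
  Clim F (fun z => f z + g z)%C (l + m)%C.
Proof.
  intros Hf Hg e He.
  assert (He2 : 0 < e / 2) by lra.
  generalize (filter_and _ _ (Hf _ He2) (Hg _ He2)). apply filter_imp. intros z [H1 H2].
  replace (f z + g z - (l + m))%C with ((f z - l) + (g z - m))%C by ring.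
  eapply Rle_lt_trans; [apply Cmod_triangle|]. lra.
Qed.

Lemma Clim_mult {T : Type} (F : (T -> Prop) -> Prop) `{HF : Filter T F} f g l m : Clim F f l -> Clim F g m ->
  Clim F (fun z => f z * g z)%C (l * m)%C.
Proof.
  intros Hf Hg e He.
  pose proof (Cmod_ge_0 l) as Hl. pose proof (Cmod_ge_0 m) as Hm.
  (* The error is at most [d * (1 + Cmod l + Cmod m)]; the extra 1 in [k] makes the final inequality
     strict. *)
  set (k := 2 + Cmod l + Cmod m). assert (Hk : 0 < k) by (unfold k; lra).
  assert (He2 : 0 < e / k) by (apply Rdiv_lt_0_compat; auto).
  set (d := Rmin 1 (e / k)). assert (Hd : 0 < d) by (apply Rmin_pos; lra).
  generalize (filter_and _ _ (Hf _ Hd) (Hg _ Hd)). apply filter_imp. intros z [H1 H2].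
  replace (f z * g z - l * m)%C
    with ((f z - l) * (g z - m) + ((f z - l) * m + l * (g z - m)))%C by ring.
  eapply Rle_lt_trans; [apply Cmod_triangle|].
  rewrite Cmod_mult.
  assert (H3 : Cmod ((f z - l) * m + l * (g z - m)) <= d * Cmod m + Cmod l * d).
  { eapply Rle_trans; [apply Cmod_triangle|]. rewrite !Cmod_mult.
    apply Rplus_le_compat; [apply Rmult_le_compat_r | apply Rmult_le_compat_l]; lra. }
  assert (H4 : Cmod (f z - l) * Cmod (g z - m) <= d * 1).
  { apply Rmult_le_compat; try apply Cmod_ge_0; try lra.
    pose proof (Rmin_l 1 (e / k)). fold d in H. lra. }
  assert (H5 : d * k <= e).
  { pose proof (Rmin_r 1 (e / k)). fold d in H.
    apply Rmult_le_compat_r with (r := k) in H; [|lra].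
    replace (e / k * k) with e in H by (field; lra). exact H. }
  unfold k in H5. nra.
Qed.

Lemma Clim_opp {T : Type} (F : (T -> Prop) -> Prop) `{HF : Filter T F} f l : Clim F f l -> Clim F (fun z => - f z)%C (- l)%C.
Proof.
  intros Hf e He. generalize (Hf e He). apply filter_imp. intros z H.
  replace (- f z - - l)%C with (- (f z - l))%C by ring. rewrite Cmod_opp. exact H.
Qed.

Lemma Clim_minus {T : Type} (F : (T -> Prop) -> Prop) `{HF : Filter T F} f g l m : Clim F f l -> Clim F g m ->
  Clim F (fun z => f z - g z)%C (l - m)%C.
Proof. intros Hf Hg. apply Clim_plus; auto. apply Clim_opp; auto. Qed.

Lemma Cmod_sub_ge (a b : C) : Cmod b - Cmod (a - b) <= Cmod a.
Proof.
  pose proof (Cmod_triangle a (b - a)) as H.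
  replace (a + (b - a))%C with b in H by ring.
  replace (b - a)%C with (- (a - b))%C in H by ring. rewrite Cmod_opp in H. lra.
Qed.

Lemma Clim_inv {T : Type} (F : (T -> Prop) -> Prop) `{HF : Filter T F} f (l : C) : l <> 0 -> Clim F f l -> Clim F (fun z => / f z)%C (/ l)%C.
Proof.
  intros Hl Hf e He. pose proof (Cmod_pos _ Hl) as Hl'.
  set (d := Rmin (Cmod l / 2) (e * (Cmod l * Cmod l) / 2)).
  assert (Hd : 0 < d). { apply Rmin_pos; [lra|]. apply Rdiv_lt_0_compat; [|lra].
    apply Rmult_lt_0_compat; [lra|]. apply Rmult_lt_0_compat; lra. }
  generalize (Hf d Hd). apply filter_imp. intros z H.
  pose proof (Rmin_l (Cmod l / 2) (e * (Cmod l * Cmod l) / 2)) as H1.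
  pose proof (Rmin_r (Cmod l / 2) (e * (Cmod l * Cmod l) / 2)) as H2. fold d in H1, H2.
  pose proof (Cmod_sub_ge (f z) l) as H3.
  assert (Hfz : f z <> 0). { apply Cneq_of_Cmod. lra. }
  replace (/ f z - / l)%C with (- (f z - l) / (f z * l))%C by (field; auto).
  rewrite Cmod_div by (apply Cmult_neq_0; auto). rewrite Cmod_opp, Cmod_mult.
  apply Rmult_lt_reg_r with (Cmod (f z) * Cmod l). { apply Rmult_lt_0_compat; lra. }
  replace (Cmod (f z - l) / (Cmod (f z) * Cmod l) * (Cmod (f z) * Cmod l))
    with (Cmod (f z - l)) by (field; lra).
  assert (e * Cmod l * (Cmod l / 2) <= e * Cmod l * Cmod (f z)).
  { apply Rmult_le_compat_l; [|lra]. apply Rmult_le_pos; lra. }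
  lra.
Qed.

Lemma Clim_conj {T : Type} (F : (T -> Prop) -> Prop) `{HF : Filter T F} f l : Clim F f l -> Clim F (fun z => Cconj (f z)) (Cconj l).
Proof.
  intros Hf e He. generalize (Hf e He). apply filter_imp. intros z H.
  rewrite <- Cminus_conj, Cmod_conj. exact H.
Qed.

Lemma Clim_comp {T : Type} (F : (T -> Prop) -> Prop) `{HF : Filter T F} f g l : Clim F f l -> Ccont g l -> Clim F (fun z => g (f z)) (g l).
Proof.
  intros Hf Hg e He. destruct (Hg e He) as (d & Hd & H).
  generalize (Hf d Hd). apply filter_imp. auto.
Qed.

Lemma Clim_Cpunct_of_near f p l : Clim (Cnear p) f l -> Clim (Cpunct p) f l.
Proof. intros H e He. destruct (H e He) as (d & Hd & H1). exists d; auto. Qed.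

#[local] Hint Resolve Clim_const Clim_plus Clim_mult Clim_opp Clim_minus Clim_inv Clim_conj: lim.
#[local] Hint Resolve Cnear_filter Cpunct_filter Cinfty_filter : core.

Lemma Ccont_id z : Ccont (fun w => w) z.
Proof. intros e He. exists e; auto. Qed.

Lemma Ccont_const (c z : C) : Ccont (fun _ => c) z.
Proof. apply (Clim_const (Cnear z) c); auto with typeclass_instances. Qed.

Lemma Ccont_plus f g z : Ccont f z -> Ccont g z -> Ccont (fun w => f w + g w)%C z.
Proof. apply (Clim_plus (Cnear z)). Qed.

Lemma Ccont_minus f g z : Ccont f z -> Ccont g z -> Ccont (fun w => f w - g w)%C z.
Proof. apply (Clim_minus (Cnear z)). Qed.

Lemma Ccont_mult f g z : Ccont f z -> Ccont g z -> Ccont (fun w => f w * g w)%C z.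
Proof. apply (Clim_mult (Cnear z)). Qed.

Lemma Ccont_inv (f : C -> C) z : f z <> 0 -> Ccont f z -> Ccont (fun w => / f w)%C z.
Proof. apply (Clim_inv (Cnear z)). Qed.

Lemma Ccont_comp f g z : Ccont f z -> Ccont g (f z) -> Ccont (fun w => g (f w)) z.
Proof. apply (Clim_comp (Cnear z)). Qed.

Lemma Ccont_conj f z : Ccont f z -> Ccont (fun w => Cconj (f w)) z.
Proof. apply (Clim_conj (Cnear z)). Qed.

#[local] Hint Resolve Ccont_id Ccont_const Ccont_plus Ccont_minus Ccont_mult : lim.

Lemma Cnear_self p (P : C -> Prop) : Cnear p P -> P p.
Proof.
  intros (e & He & H). apply H. replace (p - p)%C with (RtoC 0) by ring. now rewrite Cmod_0.
Qed.

Lemma Ccont_ext f g z : Cnear z (fun w => f w = g w) -> Ccont f z -> Ccont g z.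
Proof.
  intros H H1. unfold Ccont. rewrite <- (Cnear_self _ _ H).
  apply Clim_ext_F with f; auto.
Qed.

Lemma CD_cont f z : CD f z -> Ccont f z.
Proof.
  intros (q & Hq & H).
  apply Ccont_ext with (fun w => f z + q w * (w - z))%C.
  - revert H. apply filter_imp. intros w H. rewrite <- H. ring.
  - auto 10 with lim.
Qed.

Lemma CD_ext f g z : Cnear z (fun w => f w = g w) -> CD f z -> CD g z.
Proof.
  intros H (q & Hq & H1). exists q; split; auto.
  pose proof (Cnear_self _ _ H) as Hz.
  generalize (filter_and _ _ H H1). apply filter_imp. intros w [<- H2]. rewrite <- Hz. exact H2.
Qed.

Lemma CD_const (c z : C) : CD (fun _ => c) z.
Proof.
  exists (fun _ => RtoC 0); split; [apply Ccont_const|].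
  apply filter_imp with (2 := filter_true). intros; ring.
Qed.

Lemma CD_id z : CD (fun w => w) z.
Proof.
  exists (fun _ => RtoC 1); split; [apply Ccont_const|].
  apply filter_imp with (2 := filter_true). intros; ring.
Qed.

Lemma CD_plus f g z : CD f z -> CD g z -> CD (fun w => f w + g w)%C z.
Proof.
  intros (q & Hq & H) (r & Hr & H1). exists (fun w => q w + r w)%C; split.
  - apply Ccont_plus; auto.
  - generalize (filter_and _ _ H H1). apply filter_imp. intros w [H2 H3].
    replace (f w + g w - (f z + g z))%C with ((f w - f z) + (g w - g z))%C by ring.
    rewrite H2, H3. ring.
Qed.

Lemma CD_mult f g z : CD f z -> CD g z -> CD (fun w => f w * g w)%C z.
Proof.
  intros Hf (r & Hr & H1). pose proof (CD_cont _ _ Hf) as Hc. destruct Hf as (q & Hq & H).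
  exists (fun w => f w * r w + q w * g z)%C; split.
  - apply Ccont_plus; apply Ccont_mult; auto. apply Ccont_const.
  - generalize (filter_and _ _ H H1). apply filter_imp. intros w [H2 H3].
    replace (f w * g w - f z * g z)%C with (f w * (g w - g z) + (f w - f z) * g z)%C by ring.
    rewrite H2, H3. ring.
Qed.

Lemma CD_opp f z : CD f z -> CD (fun w => - f w)%C z.
Proof.
  intros H. apply CD_ext with (fun w => (-1) * f w)%C.
  - apply filter_imp with (2 := filter_true). intros; ring.
  - apply CD_mult; [apply CD_const | exact H].
Qed.

Lemma CD_minus f g z : CD f z -> CD g z -> CD (fun w => f w - g w)%C z.
Proof. intros Hf Hg. apply CD_plus; auto. apply CD_opp; auto. Qed.

Lemma Ccont_neq_0 (f : C -> C) z : Ccont f z -> f z <> 0 -> Cnear z (fun w => f w <> 0).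
Proof.
  intros Hf Hz. pose proof (Cmod_pos _ Hz) as Hz'. generalize (Hf _ Hz'). apply filter_imp.
  intros w Hw. apply Cneq_of_Cmod. pose proof (Cmod_sub_ge (f w) (f z)). lra.
Qed.

Lemma CD_inv (f : C -> C) z : f z <> 0 -> CD f z -> CD (fun w => / f w)%C z.
Proof.
  intros Hz Hf. pose proof (CD_cont _ _ Hf) as Hc. destruct Hf as (q & Hq & H).
  exists (fun w => - (q w * (/ f w * / f z)))%C; split.
  - apply (Clim_opp (Cnear z)).
    apply (Ccont_mult q (fun w => / f w * / f z)%C); auto.
    apply (Ccont_mult (fun w => / f w)%C (fun _ => / f z)%C).
    + apply Ccont_inv; auto.
    + apply Ccont_const.
  - generalize (filter_and _ _ H (Ccont_neq_0 _ _ Hc Hz)). apply filter_imp. intros w [H2 H3].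
    replace (/ f w - / f z)%C with (- ((f w - f z) * (/ f w * / f z)))%C by (field; auto).
    rewrite H2. ring.
Qed.

Lemma CD_comp f g z : CD f z -> CD g (f z) -> CD (fun w => g (f w)) z.
Proof.
  intros Hf (r & Hr & H1). pose proof (CD_cont _ _ Hf) as Hc. destruct Hf as (q & Hq & H).
  exists (fun w => r (f w) * q w)%C; split.
  - apply Ccont_mult; auto. apply (Ccont_comp f r); auto.
  - destruct H1 as (d & Hd & H1). generalize (filter_and _ _ H (Hc d Hd)).
    apply filter_imp. intros w [H2 H3]. rewrite H1 by exact H3. rewrite H2. ring.
Qed.

Lemma CD_conj f z : CD f (Cconj z) -> CD (fun w => Cconj (f (Cconj w))) z.
Proof.
  intros (q & Hq & H). exists (fun w => Cconj (q (Cconj w))); split.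
  - apply Ccont_conj. apply (Ccont_comp Cconj q); auto. apply Ccont_conj, Ccont_id.
  - destruct H as (d & Hd & H). exists d; split; auto. intros w Hw.
    rewrite <- Cminus_conj, H.
    + rewrite Cmult_conj, Cminus_conj, !Cconj_conj. reflexivity.
    + rewrite <- Cminus_conj, Cmod_conj. exact Hw.
Qed.

#[local] Hint Resolve CD_id CD_const CD_plus CD_minus CD_mult CD_opp : lim.

Lemma Ceq_em (a b : C) : {a = b} + {a <> b}.
Proof. apply excluded_middle_informative. Qed.

Lemma CD_of_ex_derive (f : C -> C) (z : C) : ex_derive f z -> CD f z.
Proof.
  intros [l Hl]. exists (fun w => if Ceq_em w z then l else (f w - f z) / (w - z))%C. split.
  - intros e He. destruct Hl as [_ Hl]. specialize (Hl z (fun P H => H)).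
    assert (He2 : 0 < e / 2) by lra.
    destruct (Ceq_em z z) as [_|n]; [|now elim n].
    destruct (Hl (mkposreal _ He2)) as [d Hd]. exists d; split; [apply cond_pos|].
    intros w Hw. destruct (Ceq_em w z) as [_|n].
    + replace (l - l)%C with (RtoC 0) by ring. now rewrite Cmod_0.
    + pose proof (Csub_neq _ _ n) as Hn.
      specialize (Hd w Hw). simpl in Hd.
      replace ((f w - f z) / (w - z) - l)%C with ((f w - f z - (w - z) * l) / (w - z))%C by (field; auto).
      rewrite Cmod_div by auto.
      apply Cmod_pos in Hn.
      apply Rle_lt_trans with (e / 2); [|lra].
      apply Rmult_le_reg_r with (Cmod (w - z)); auto.
      unfold Rdiv at 1. rewrite Rmult_assoc, Rinv_l, Rmult_1_r by lra. exact Hd.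
  - apply filter_imp with (2 := filter_true). intros w _. destruct (Ceq_em w z) as [->|n].
    + ring.
    + field. apply Csub_neq, n.
Qed.

(** * The complex exponential and integrals along real intervals *)

Lemma Cmod_le_abs (z : C) : Cmod z <= Rabs (fst z) + Rabs (snd z).
Proof.
  unfold Cmod. pose proof (Rabs_pos (fst z)). pose proof (Rabs_pos (snd z)).
  rewrite <- (sqrt_pow2 (Rabs (fst z) + Rabs (snd z))) by lra.
  apply sqrt_le_1_alt. rewrite <- (pow2_abs (fst z)), <- (pow2_abs (snd z)). nra.
Qed.

Lemma abs_fst_le (z : C) : Rabs (fst z) <= Cmod z.
Proof. eapply Rle_trans; [apply Rmax_l | apply Rmax_Cmod]. Qed.

Lemma abs_snd_le (z : C) : Rabs (snd z) <= Cmod z.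
Proof. eapply Rle_trans; [apply Rmax_r | apply Rmax_Cmod]. Qed.

Lemma Cmod_sq (z : C) : Cmod z ^ 2 = fst z ^ 2 + snd z ^ 2.
Proof. unfold Cmod. apply pow2_sqrt. nra. Qed.

Lemma Cexp_plus (z w : C) : Cexp (z + w)%C = (Cexp z * Cexp w)%C.
Proof.
  unfold Cexp. destruct z as [x y], w as [u v]. simpl.
  rewrite exp_plus, cos_plus, sin_plus. apply injective_projections; simpl; ring.
Qed.

Lemma Cexp_0 : Cexp 0%C = 1%C.
Proof. unfold Cexp. simpl. rewrite exp_0, cos_0, sin_0. apply injective_projections; simpl; ring. Qed.

Lemma Cexp_opp_mult (z : C) : (Cexp (- z) * Cexp z)%C = 1%C.
Proof. rewrite <- Cexp_plus. replace (- z + z)%C with (RtoC 0) by ring. apply Cexp_0. Qed.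

Lemma Cexp_neq_0 (z : C) : Cexp z <> 0.
Proof.
  intros H. pose proof (Cexp_opp_mult z) as H1. rewrite H, Cmult_0_r in H1.
  apply RtoC_inj in H1. lra.
Qed.

Lemma Cexp_opp (z : C) : Cexp (- z)%C = (/ Cexp z)%C.
Proof.
  rewrite <- (Cmult_1_r (/ Cexp z)%C), <- (Cexp_opp_mult z). field. apply Cexp_neq_0.
Qed.

Lemma Cmod_Cexp (z : C) : Cmod (Cexp z) = exp (fst z).
Proof.
  unfold Cexp. rewrite Cmod_mult, Cmod_R, Rabs_pos_eq by (left; apply exp_pos).
  replace (Cmod (cos (snd z), sin (snd z))) with 1; [ring|].
  unfold Cmod. simpl. pose proof (sin2_cos2 (snd z)) as H. unfold Rsqr in H.
  apply eq_trans with (sqrt 1); [symmetry; apply sqrt_1 | f_equal; lra].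
Qed.

Lemma Cexp_conj (z : C) : Cconj (Cexp z) = Cexp (Cconj z).
Proof.
  unfold Cexp, Cconj. simpl. rewrite cos_neg, sin_neg.
  apply injective_projections; simpl; ring.
Qed.

Lemma abs_sin_le (y : R) : Rabs (sin y) <= Rabs y.
Proof.
  destruct (MVT_gen sin 0 y cos) as (c & Hc & H).
  - intros x _. apply is_derive_sin.
  - intros x _. apply continuity_pt_filterlim, continuous_sin.
  - rewrite sin_0, !Rminus_0_r in H. rewrite H, Rabs_mult.
    rewrite <- (Rmult_1_l (Rabs y)) at 2. apply Rmult_le_compat_r; [apply Rabs_pos|].
    apply Rabs_le. pose proof (COS_bound c). lra.
Qed.

Lemma cos_ge_quadratic (y : R) : 1 - y ^ 2 / 2 <= cos y.
Proof.
  replace y with (2 * (y / 2)) at 2 by field. rewrite cos_2a_sin.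
  pose proof (abs_sin_le (y / 2)) as H. apply Rsqr_le_abs_1 in H. unfold Rsqr in H. nra.
Qed.

Lemma abs_sin_minus_le (y : R) : Rabs (sin y - y) <= Rabs y * y ^ 2.
Proof.
  destruct (MVT_gen (fun t => sin t - t) 0 y (fun t => cos t - 1)) as (c & Hc & H).
  - intros x _. auto_derive; auto. ring.
  - intros x _. apply continuity_pt_filterlim.
    apply (continuous_minus sin (fun t => t)); [apply continuous_sin | apply continuous_id].
  - rewrite sin_0, !Rminus_0_r in H. rewrite H, Rabs_mult, Rmult_comm.
    apply Rmult_le_compat_l; [apply Rabs_pos|].
    pose proof (COS_bound c). pose proof (cos_ge_quadratic c).
    assert (c ^ 2 <= y ^ 2).
    { unfold Rmin, Rmax in Hc. destruct (Rle_dec 0 y); nra. }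
    rewrite Rabs_left1; lra.
Qed.

(** The two real directions separate: e^(x+iy) - 1 - (x+iy) = (e^x - 1 - x) e^(iy) + (e^(iy) - 1 -
    iy) + x (e^(iy) - 1), and every term is quadratic in (x, y). *)
Lemma Cexp_taylor (z : C) : Cmod z <= / 2 -> Cmod (Cexp z - 1 - z) <= 4 * Cmod z ^ 2.
Proof.
  intros Hz. destruct z as [x y]. pose proof (abs_fst_le (x, y)) as Hx.
  pose proof (abs_snd_le (x, y)) as Hy. simpl in Hx, Hy.
  set (e := (cos y, sin y) : C).
  assert (E : (Cexp (x, y) - 1 - (x, y))%C =
     (RtoC (exp x - 1 - x) * e + ((e - 1 - (0, y)) + RtoC x * (e - 1)))%C).
  { unfold Cexp, e. simpl. apply injective_projections; simpl; ring. }
  rewrite E. clear E.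
  assert (H1 : Rabs (exp x - 1 - x) <= 2 * x ^ 2).
  { pose proof (exp_ineq1_le x). pose proof (exp_ineq1_le (- x)) as H2.
    rewrite exp_Ropp in H2. pose proof (exp_pos x).
    assert (Hx' : Rabs x <= / 2) by lra. apply Rabs_le_between in Hx'.
    assert (exp x * (1 + - x) <= 1).
    { apply Rmult_le_compat_l with (r := exp x) in H2; [|lra]. rewrite Rinv_r in H2; lra. }
    rewrite Rabs_pos_eq by lra. nra. }
  assert (He : Cmod e = 1).
  { unfold e, Cmod. simpl. pose proof (sin2_cos2 y) as H. unfold Rsqr in H.
    apply eq_trans with (sqrt 1); [f_equal; lra | apply sqrt_1]. }
  pose proof (COS_bound y) as Hc1. pose proof (cos_ge_quadratic y) as Hc2.
  pose proof (abs_sin_le y) as Hs. pose proof (abs_sin_minus_le y) as Hs2.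
  pose proof (Rabs_pos x) as Px. pose proof (Rabs_pos y) as Py.
  pose proof (pow2_abs x) as Sx. pose proof (pow2_abs y) as Sy.
  assert (H2 : Cmod (e - 1 - (0, y)) <= y ^ 2).
  { eapply Rle_trans; [apply Cmod_le_abs|]. 
    replace (fst (e - 1 - (0, y))%C) with (cos y - 1) by (unfold e; simpl; ring).
    replace (snd (e - 1 - (0, y))%C) with (sin y - y) by (unfold e; simpl; ring).
    rewrite (Rabs_left1 (cos y - 1)) by lra.
    assert (Rabs y * y ^ 2 <= / 2 * y ^ 2) by (apply Rmult_le_compat_r; [apply pow2_ge_0 | lra]). lra. }
  assert (H3 : Cmod (e - 1) <= 2 * Rabs y).
  { eapply Rle_trans; [apply Cmod_le_abs|]. 
    replace (fst (e - 1)%C) with (cos y - 1) by (unfold e; simpl; ring).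
    replace (snd (e - 1)%C) with (sin y) by (unfold e; simpl; ring).
    rewrite (Rabs_left1 (cos y - 1)) by lra. nra. }
  eapply Rle_trans; [apply Cmod_triangle|]. rewrite Cmod_mult, He, Cmod_R.
  eapply Rle_trans; [apply Rplus_le_compat_l, Cmod_triangle|]. rewrite Cmod_mult, Cmod_R.
  assert (Rabs x * Cmod (e - 1) <= Rabs x * (2 * Rabs y)) by (apply Rmult_le_compat_l; auto).
  rewrite Cmod_sq. simpl fst. simpl snd. nra.
Qed.

(** At 0 the Taylor bound gives the continuous difference quotient; the addition law carries it to
    [z]. *)
Lemma CD_Cexp (z : C) : CD Cexp z.
Proof.
  assert (H0 : CD Cexp 0%C).
  { exists (fun w => if Ceq_em w 0%C then RtoC 1 else ((Cexp w - 1) / w)%C). split.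
    - intros e He. destruct (Ceq_em 0%C 0%C) as [_|n]; [|now elim n].
      exists (Rmin (/ 2) (e / 4)). split; [apply Rmin_pos; lra|]. intros w Hw.
      pose proof (Rmin_l (/ 2) (e / 4)). pose proof (Rmin_r (/ 2) (e / 4)).
      replace (w - 0)%C with w in Hw by ring.
      destruct (Ceq_em w 0%C) as [_|n].
      + replace (1 - 1)%C with (RtoC 0) by ring. now rewrite Cmod_0.
      + replace ((Cexp w - 1) / w - 1)%C with ((Cexp w - 1 - w) / w)%C by (field; auto).
        rewrite Cmod_div by auto. apply Cmod_pos in n.
        apply Rle_lt_trans with (4 * Cmod w); [|lra].
        apply Rmult_le_reg_r with (Cmod w); auto.
        unfold Rdiv. rewrite Rmult_assoc, Rinv_l, Rmult_1_r by lra.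
        pose proof (Cexp_taylor w). nra.
    - apply filter_imp with (2 := filter_true). intros w _. rewrite Cexp_0.
      destruct (Ceq_em w 0%C) as [->|n]; [rewrite Cexp_0; ring | field; auto]. }
  apply CD_ext with (fun w => Cexp z * Cexp (w - z))%C.
  - apply filter_imp with (2 := filter_true). intros w _. rewrite <- Cexp_plus. f_equal. ring.
  - apply CD_mult; [apply CD_const|]. apply (CD_comp (fun w => w - z)%C Cexp).
    + auto with lim.
    + replace (z - z)%C with (RtoC 0) by ring. exact H0.
Qed.

Definition RC (f : R -> C) (t : R) : Prop := Clim (locally t) f (f t).

Definition CInt (f : R -> C) (a b : R) : C :=
  (RInt (fun t => fst (f t)) a b, RInt (fun t => snd (f t)) a b).

Lemma RC_fst f t : RC f t -> continuous (fun s => fst (f s)) t.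
Proof.
  intros H. apply filterlim_locally. intros e.
  generalize (H e (cond_pos e)). apply filter_imp. intros s Hs.
  eapply Rle_lt_trans; [|exact Hs]. apply (abs_fst_le (f s - f t)%C).
Qed.

Lemma RC_snd f t : RC f t -> continuous (fun s => snd (f s)) t.
Proof.
  intros H. apply filterlim_locally. intros e.
  generalize (H e (cond_pos e)). apply filter_imp. intros s Hs.
  eapply Rle_lt_trans; [|exact Hs]. apply (abs_snd_le (f s - f t)%C).
Qed.

Lemma RC_pair (u v : R -> R) t : continuous u t -> continuous v t -> RC (fun s => (u s, v s)) t.
Proof.
  intros Hu Hv e He. assert (He2 : 0 < e / 2) by lra.
  generalize (filter_and _ _ (proj1 (filterlim_locally _ _) Hu (mkposreal _ He2))
     (proj1 (filterlim_locally _ _) Hv (mkposreal _ He2))).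
  apply filter_imp. intros s [H1 H2]. eapply Rle_lt_trans; [apply Cmod_le_abs|].
  change (Rabs (u s - u t) < e / 2) in H1. change (Rabs (v s - v t) < e / 2) in H2.
  simpl. unfold Rminus in *. lra.
Qed.

Lemma RC_comp (g : C -> C) (f : R -> C) t : RC f t -> Ccont g (f t) -> RC (fun s => g (f s)) t.
Proof. apply (Clim_comp (locally t)). Qed.

Lemma RC_plus f g t : RC f t -> RC g t -> RC (fun s => f s + g s)%C t.
Proof. apply (Clim_plus (locally t)). Qed.

Lemma RC_minus f g t : RC f t -> RC g t -> RC (fun s => f s - g s)%C t.
Proof. apply (Clim_minus (locally t)). Qed.

Lemma RC_mult f g t : RC f t -> RC g t -> RC (fun s => f s * g s)%C t.
Proof. apply (Clim_mult (locally t)). Qed.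

Lemma RC_const (c : C) t : RC (fun _ => c) t.
Proof. apply (Clim_const (locally t) c). Qed.

Lemma RC_Cmod f t : RC f t -> continuous (fun s => Cmod (f s)) t.
Proof.
  intros H. apply filterlim_locally. intros e.
  generalize (H e (cond_pos e)). apply filter_imp. intros s Hs.
  change (Rabs (Cmod (f s) - Cmod (f t)) < e).
  pose proof (Cmod_sub_ge (f s) (f t)). pose proof (Cmod_sub_ge (f t) (f s)) as H1.
  replace (f t - f s)%C with (- (f s - f t))%C in H1 by ring. rewrite Cmod_opp in H1.
  apply Rabs_def1; lra.
Qed.

Lemma ex_RInt_cont (f : R -> R) a b : a <= b ->
  (forall t, a <= t <= b -> continuous f t) -> ex_RInt f a b.
Proof.
  intros Hab H. apply (@ex_RInt_continuous R_CompleteNormedModule).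
  rewrite Rmin_left, Rmax_right by auto. exact H.
Qed.

Lemma ex_RInt_fst f a b : a <= b -> (forall t, a <= t <= b -> RC f t) ->
  ex_RInt (fun t => fst (f t)) a b.
Proof. intros Hab H. apply ex_RInt_cont; auto. intros; apply RC_fst; auto. Qed.

Lemma ex_RInt_snd f a b : a <= b -> (forall t, a <= t <= b -> RC f t) ->
  ex_RInt (fun t => snd (f t)) a b.
Proof. intros Hab H. apply ex_RInt_cont; auto. intros; apply RC_snd; auto. Qed.

Lemma CInt_ext f g a b : a <= b -> (forall t, a <= t <= b -> f t = g t) -> CInt f a b = CInt g a b.
Proof.
  intros Hab H. unfold CInt. f_equal; apply RInt_ext; rewrite Rmin_left, Rmax_right by auto;
  intros x Hx; rewrite H; auto; lra.
Qed.

Lemma CInt_plus f g a b : a <= b ->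
  (forall t, a <= t <= b -> RC f t) -> (forall t, a <= t <= b -> RC g t) ->
  CInt (fun t => f t + g t)%C a b = (CInt f a b + CInt g a b)%C.
Proof.
  intros Hab Hf Hg. unfold CInt. apply injective_projections; simpl.
  - apply (RInt_plus (fun t => fst (f t)) (fun t => fst (g t))); apply ex_RInt_fst; auto.
  - apply (RInt_plus (fun t => snd (f t)) (fun t => snd (g t))); apply ex_RInt_snd; auto.
Qed.

Lemma CInt_scal (c : C) f a b : a <= b -> (forall t, a <= t <= b -> RC f t) ->
  CInt (fun t => c * f t)%C a b = (c * CInt f a b)%C.
Proof.
  intros Hab Hf. pose proof (ex_RInt_fst f a b Hab Hf) as H1.
  pose proof (ex_RInt_snd f a b Hab Hf) as H2.
  assert (S : forall k (u : R -> R), ex_RInt u a b -> RInt (fun t => k * u t) a b = k * RInt u a b).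
  { intros k u Hu. apply (RInt_scal u a b k Hu). }
  assert (S' : forall k (u : R -> R), ex_RInt u a b -> ex_RInt (fun t => k * u t) a b).
  { intros k u Hu. apply (ex_RInt_scal u a b k Hu). }
  unfold CInt. apply injective_projections; simpl.
  - rewrite <- !S by auto.
    apply (RInt_minus (fun t => fst c * fst (f t)) (fun t => snd c * snd (f t))); auto.
  - rewrite <- !S by auto.
    apply (RInt_plus (fun t => fst c * snd (f t)) (fun t => snd c * fst (f t))); auto.
Qed.

Lemma CInt_minus f g a b : a <= b ->
  (forall t, a <= t <= b -> RC f t) -> (forall t, a <= t <= b -> RC g t) ->
  CInt (fun t => f t - g t)%C a b = (CInt f a b - CInt g a b)%C.
Proof.
  intros Hab Hf Hg.
  rewrite (CInt_ext _ (fun t => f t + (-1) * g t)%C) by (auto; intros; ring).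
  rewrite CInt_plus, CInt_scal; auto; [ring|].
  intros t Ht. apply RC_mult; auto. apply RC_const.
Qed.

Lemma CInt_const (c : C) a b : CInt (fun _ => c) a b = (RtoC (b - a) * c)%C.
Proof.
  unfold CInt. rewrite !RInt_const. apply injective_projections; simpl; unfold scal; simpl; unfold mult; simpl; ring.
Qed.

Lemma CInt_Chasles f a m b : a <= m <= b -> (forall t, a <= t <= b -> RC f t) ->
  CInt f a b = (CInt f a m + CInt f m b)%C.
Proof.
  intros [Ham Hmb] H. unfold CInt. apply injective_projections; simpl; symmetry.
  - apply (RInt_Chasles (fun t => fst (f t))); apply ex_RInt_fst; auto; intros; apply H; lra.
  - apply (RInt_Chasles (fun t => snd (f t))); apply ex_RInt_snd; auto; intros; apply H; lra.
Qed.

(** The factor 2 is the price of bounding real and imaginary parts separately; every application has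
    room for it. *)
Lemma CInt_bound f a b M : a <= b -> (forall t, a <= t <= b -> RC f t) ->
  (forall t, a <= t <= b -> Cmod (f t) <= M) -> Cmod (CInt f a b) <= 2 * ((b - a) * M).
Proof.
  intros Hab Hf HM. eapply Rle_trans; [apply Cmod_le_abs|]. simpl.
  assert (Rabs (RInt (fun t => fst (f t)) a b) <= (b - a) * M).
  { apply abs_RInt_le_const; auto; [apply ex_RInt_fst; auto|].
    intros t Ht. eapply Rle_trans; [apply abs_fst_le | auto]. }
  assert (Rabs (RInt (fun t => snd (f t)) a b) <= (b - a) * M).
  { apply abs_RInt_le_const; auto; [apply ex_RInt_snd; auto|].
    intros t Ht. eapply Rle_trans; [apply abs_snd_le | auto]. }
  lra.
Qed.

(** * Goursat's theorem and circle means *)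

(* The boundary integral of [G dw] over [a,b] x [c,d], opposite sides paired. *)
Definition rectI (G : C -> C) (a b c d : R) : C :=
  (CInt (fun x => G (x, c) - G (x, d)) a b + Ci * CInt (fun y => G (b, y) - G (a, y)) c d)%C.

Definition rectC (G : C -> C) (a b c d : R) : Prop :=
  forall x y, a <= x <= b -> c <= y <= d -> Ccont G (x, y).

Lemma RC_hor G x y : Ccont G (x, y) -> RC (fun s => G (s, y)) x.
Proof.
  intros H. apply (RC_comp G (fun s => (s, y)) x); auto.
  apply (RC_pair (fun s => s) (fun _ => y)); [apply continuous_id | apply continuous_const].
Qed.

Lemma RC_ver G x y : Ccont G (x, y) -> RC (fun s => G (x, s)) y.
Proof.
  intros H. apply (RC_comp G (fun s => (x, s)) y); auto.
  apply (RC_pair (fun _ => x) (fun s => s)); [apply continuous_const | apply continuous_id].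
Qed.

Lemma RC_hor_minus G a b c d x : rectC G a b c d -> c <= d -> a <= x <= b ->
  forall y y', c <= y <= d -> c <= y' <= d -> RC (fun s => G (s, y) - G (s, y'))%C x.
Proof. intros H Hcd Hx y y' Hy Hy'. apply RC_minus; apply RC_hor; auto. Qed.

Lemma RC_ver_minus G a b c d y : rectC G a b c d -> a <= b -> c <= y <= d ->
  forall x x', a <= x <= b -> a <= x' <= b -> RC (fun s => G (x, s) - G (x', s))%C y.
Proof. intros H Hab Hy x x' Hx Hx'. apply RC_minus; apply RC_ver; auto. Qed.

Lemma rectI_split_hor G a m b c d : a <= m <= b -> c <= d -> rectC G a b c d ->
  rectI G a b c d = (rectI G a m c d + rectI G m b c d)%C.
Proof.
  intros Hm Hcd H. unfold rectI.
  rewrite (CInt_Chasles _ a m b) by (auto; intros; eapply RC_hor_minus; eauto; lra).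
  rewrite (CInt_ext (fun y => G (b, y) - G (a, y))%C
     (fun y => (G (m, y) - G (a, y)) + (G (b, y) - G (m, y)))%C) by (auto; intros; ring).
  rewrite CInt_plus; [ring | auto | |]; intros t Ht;
    apply (RC_ver_minus G a b c d); auto; lra.
Qed.

Lemma rectI_split_ver G a b c m d : a <= b -> c <= m <= d -> rectC G a b c d ->
  rectI G a b c d = (rectI G a b c m + rectI G a b m d)%C.
Proof.
  intros Hab Hm H. unfold rectI.
  rewrite (CInt_Chasles _ c m d) by (auto; intros; eapply RC_ver_minus; eauto; lra).
  rewrite (CInt_ext (fun x => G (x, c) - G (x, d))%C
     (fun x => (G (x, c) - G (x, m)) + (G (x, m) - G (x, d)))%C) by (auto; intros; ring).
  rewrite CInt_plus; [ring | auto | |]; intros t Ht;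
    apply (RC_hor_minus G a b c d); auto; lra.
Qed.

(** Along opposite sides an affine function differs by a constant, and the contributions i be (c -
    d) (b - a) and i be (b - a) (d - c) cancel. This lets [goursat] subtract a first-order
    expansion. *)
Lemma rectI_affine (al be : C) a b c d :
  rectI (fun w => al + be * w)%C a b c d = RtoC 0.
Proof.
  unfold rectI.
  replace (fun x : R => al + be * (x, c) - (al + be * (x, d)))%C with
    (fun _ : R => (be * (0, (c - d)%R))%C) by (apply functional_extensionality; intros x;
       apply injective_projections; simpl; ring).
  replace (fun y : R => al + be * (b, y) - (al + be * (a, y)))%C with
    (fun _ : R => (be * ((b - a)%R, 0))%C) by (apply functional_extensionality; intros x;
       apply injective_projections; simpl; ring).
  rewrite !CInt_const. apply injective_projections; simpl; ring.
Qed.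

Lemma rectI_minus F G a b c d : a <= b -> c <= d -> rectC F a b c d -> rectC G a b c d ->
  rectI (fun w => F w - G w)%C a b c d = (rectI F a b c d - rectI G a b c d)%C.
Proof.
  intros Hab Hcd HF HG. unfold rectI.
  rewrite (CInt_ext _ (fun x => (F (x, c) - F (x, d)) - (G (x, c) - G (x, d)))%C) by
    (auto; intros; ring).
  rewrite (CInt_ext (fun y => F (b, y) - G (b, y) - (F (a, y) - G (a, y)))%C
    (fun y => (F (b, y) - F (a, y)) - (G (b, y) - G (a, y)))%C) by (auto; intros; ring).
  rewrite (CInt_minus (fun x => F (x, c) - F (x, d))%C), (CInt_minus (fun y => F (b, y) - F (a, y))%C);
  auto; try ring; intros t Ht;
  solve [eapply RC_ver_minus; eauto; lra | eapply RC_hor_minus; eauto; lra].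
Qed.

Lemma rectI_bound G a b c d M : a <= b -> c <= d -> rectC G a b c d ->
  (forall x y, a <= x <= b -> c <= y <= d -> Cmod (G (x, y)) <= M) ->
  Cmod (rectI G a b c d) <= 4 * ((b - a) + (d - c)) * M.
Proof.
  intros Hab Hcd H HM. unfold rectI.
  eapply Rle_trans; [apply Cmod_triangle|]. rewrite Cmod_mult, Cmod_Ci, Rmult_1_l.
  assert (T : forall u v : C, Cmod u <= M -> Cmod v <= M -> Cmod (u - v) <= 2 * M).
  { intros u v Hu Hv. eapply Rle_trans; [apply Cmod_triangle|]. rewrite Cmod_opp. lra. }
  assert (H1 : Cmod (CInt (fun x => G (x, c) - G (x, d))%C a b) <= 2 * ((b - a) * (2 * M))).
  { apply CInt_bound; auto; intros t Ht; [eapply RC_hor_minus; eauto; lra|].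
    apply T; apply HM; lra. }
  assert (H2 : Cmod (CInt (fun y => G (b, y) - G (a, y))%C c d) <= 2 * ((d - c) * (2 * M))).
  { apply CInt_bound; auto; intros t Ht; [eapply RC_ver_minus; eauto; lra|].
    apply T; apply HM; lra. }
  lra.
Qed.

Lemma pow_half_pos n : 0 < (/ 2) ^ n.
Proof. apply pow_lt. lra. Qed.

(** Every left endpoint lies below every right endpoint, so the supremum of the left endpoints
    belongs to all the intervals. *)
Lemma nested_halving (u : nat -> R) (L : R) : 0 <= L ->
  (forall n, u n <= u (S n) /\ u (S n) + L * (/ 2) ^ S n <= u n + L * (/ 2) ^ n) ->
  exists l, forall n, u n <= l <= u n + L * (/ 2) ^ n.
Proof.
  intros HL H.
  assert (Hi : forall n k, u n <= u (n + k)%nat /\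
     u (n + k)%nat + L * (/ 2) ^ (n + k) <= u n + L * (/ 2) ^ n).
  { intros n k. induction k as [|k IH].
    - rewrite Nat.add_0_r. lra.
    - rewrite Nat.add_succ_r. specialize (H (n + k)%nat). lra. }
  assert (Hb : forall n m, u n <= u m + L * (/ 2) ^ m).
  { intros n m. destruct (Hi n m) as [H1 _]. destruct (Hi m n) as [_ H2].
    rewrite (Nat.add_comm m n) in H2. pose proof (pow_half_pos (n + m)). nra. }
  destruct (completeness (fun r => exists n, r = u n)) as [l [Hl1 Hl2]].
  - exists (u 0%nat + L * (/ 2) ^ 0). intros r [n ->]. apply Hb.
  - exists (u 0%nat), 0%nat. reflexivity.
  - exists l. intros n. split.
    + apply Hl1. exists n; auto.
    + apply Hl2. intros r [m ->]. apply Hb.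
Qed.

Lemma pow_half_small (e : R) : 0 < e -> exists n, (/ 2) ^ n < e.
Proof.
  intros He. destruct (pow_lt_1_zero (/ 2)) with (y := e) as [N HN]; auto.
  - rewrite Rabs_pos_eq; lra.
  - exists N. specialize (HN N (Nat.le_refl N)).
    rewrite Rabs_pos_eq in HN; auto. left; apply pow_half_pos.
Qed.

(** Bisection: some quarter of each rectangle keeps at least a quarter of the integral, so after n
    steps at least [eta] / 4^n remains. At the common point of the rectangles the first-order
    expansion of [G] has integral 0 and the remainder is smaller than any multiple of 4^(-n), a
    contradiction. *)
Lemma goursat (G : C -> C) (a b c d : R) : a <= b -> c <= d ->
  (forall x y, a <= x <= b -> c <= y <= d -> CD G (x, y)) ->
  rectI G a b c d = RtoC 0.
Proof.
  intros Hab Hcd HG. destruct (Ceq_em (rectI G a b c d) (RtoC 0)) as [E|E]; [exact E|exfalso].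
  apply Cmod_pos in E. set (eta := Cmod (rectI G a b c d)) in *.
  set (h := b - a). set (k := d - c).
  assert (Hh : 0 <= h) by (unfold h; lra). assert (Hk : 0 <= k) by (unfold k; lra).
  set (ht := fun n => h * (/ 2) ^ n). set (kt := fun n => k * (/ 2) ^ n).
  assert (Hht : forall n, 0 <= ht n) by (intros n; unfold ht; pose proof (pow_half_pos n); nra).
  assert (Hkt : forall n, 0 <= kt n) by (intros n; unfold kt; pose proof (pow_half_pos n); nra).
  assert (HhtS : forall n, ht n = ht (S n) + ht (S n)) by (intros n; unfold ht; simpl; lra).
  assert (HktS : forall n, kt n = kt (S n) + kt (S n)) by (intros n; unfold kt; simpl; lra).
  set (inside := fun n (p : R * R) => a <= fst p /\ fst p + ht n <= b /\ c <= snd p /\ snd p + kt n <= d).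
  set (big := fun n (p : R * R) => eta * ((/ 2) ^ n * (/ 2) ^ n) <=
     Cmod (rectI G (fst p) (fst p + ht n) (snd p) (snd p + kt n))).
  (* The condition on [p] sits inside the existential, so a witness exists for every [p] and the
     choice function [next] is total. *)
  assert (step : forall n p, exists p', inside n p /\ big n p ->
     (inside (S n) p' /\ big (S n) p') /\
     (fst p' = fst p \/ fst p' = fst p + ht (S n)) /\ (snd p' = snd p \/ snd p' = snd p + kt (S n))).
  { intros n [x y]. destruct (classic (inside n (x, y) /\ big n (x, y))) as [[Hi Hb]|N];
      [|exists (x, y); intros H; now elim N].
    unfold inside, big in Hi, Hb. simpl in Hi, Hb.
    assert (HC : rectC G x (x + ht n) y (y + kt n)).
    { intros u v Hu Hv. apply CD_cont, HG; lra. }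
    pose proof (Hht (S n)) as P1. pose proof (Hkt (S n)) as P2.
    pose proof (HhtS n) as S1. pose proof (HktS n) as S2.
    rewrite (rectI_split_hor G x (x + ht (S n))) in Hb by (auto; lra).
    rewrite (rectI_split_ver G x (x + ht (S n)) y (y + kt (S n))) in Hb
      by (try lra; intros u v Hu Hv; apply HC; lra).
    rewrite (rectI_split_ver G (x + ht (S n)) (x + ht n) y (y + kt (S n))) in Hb
      by (try lra; intros u v Hu Hv; apply HC; lra).
    set (R1 := rectI G x (x + ht (S n)) y (y + kt (S n))) in Hb.
    set (R2 := rectI G x (x + ht (S n)) (y + kt (S n)) (y + kt n)) in Hb.
    set (R3 := rectI G (x + ht (S n)) (x + ht n) y (y + kt (S n))) in Hb.
    set (R4 := rectI G (x + ht (S n)) (x + ht n) (y + kt (S n)) (y + kt n)) in Hb.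
    assert (T : eta * ((/ 2) ^ n * (/ 2) ^ n) <= Cmod R1 + Cmod R2 + Cmod R3 + Cmod R4).
    { eapply Rle_trans; [exact Hb|]. pose proof (Cmod_triangle (R1 + R2) (R3 + R4)).
      pose proof (Cmod_triangle R1 R2). pose proof (Cmod_triangle R3 R4). lra. }
    set (q := eta * ((/ 2) ^ S n * (/ 2) ^ S n)).
    assert (Q : eta * ((/ 2) ^ n * (/ 2) ^ n) = 4 * q) by (unfold q; simpl; lra).
    assert (Ex : x + ht n = x + ht (S n) + ht (S n)) by lra.
    assert (Ey : y + kt n = y + kt (S n) + kt (S n)) by lra.
    unfold inside, big. fold q.
    destruct (Rle_dec q (Cmod R1)) as [L1|L1].
    { exists (x, y). intros _. cbn [fst snd]. repeat split; auto; lra. }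
    destruct (Rle_dec q (Cmod R2)) as [L2|L2].
    { exists (x, y + kt (S n)). intros _. cbn [fst snd]. rewrite <- Ey. repeat split; auto; lra. }
    destruct (Rle_dec q (Cmod R3)) as [L3|L3].
    { exists (x + ht (S n), y). intros _. cbn [fst snd]. rewrite <- Ex. repeat split; auto; lra. }
    exists (x + ht (S n), y + kt (S n)). intros _. cbn [fst snd]. rewrite <- Ex, <- Ey.
    fold R4. repeat split; auto; lra. }
  set (next := fun n p => proj1_sig (constructive_indefinite_description _ (step n p))).
  set (s := fix s (n : nat) : R * R := match n with O => (a, c) | S m => next m (s m) end).
  assert (Hs : forall n, inside n (s n) /\ big n (s n)).
  { induction n as [|n IH].
    - unfold inside, big. simpl. unfold ht, kt, h, k. simpl.
      replace (a + (b - a) * 1) with b by ring. replace (c + (d - c) * 1) with d by ring.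
      fold eta. repeat split; try lra.
    - simpl. unfold next. destruct (constructive_indefinite_description _ (step n (s n))) as [p' Hp'].
      simpl. apply Hp'; auto. }
  assert (Hs' : forall n, (fst (s (S n)) = fst (s n) \/ fst (s (S n)) = fst (s n) + ht (S n)) /\
       (snd (s (S n)) = snd (s n) \/ snd (s (S n)) = snd (s n) + kt (S n))).
  { intros n. simpl. unfold next. destruct (constructive_indefinite_description _ (step n (s n))) as [p' Hp'].
    simpl. apply Hp'; auto. }
  destruct (nested_halving (fun n => fst (s n)) h Hh) as [xs Hxs].
  { intros n. destruct (Hs' n) as [H _]. fold (ht n) (ht (S n)).
    pose proof (Hht (S n)). pose proof (HhtS n). lra. }
  destruct (nested_halving (fun n => snd (s n)) k Hk) as [ys Hys].
  { intros n. destruct (Hs' n) as [_ H]. fold (kt n) (kt (S n)).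
    pose proof (Hkt (S n)). pose proof (HktS n). lra. }
  assert (Hx : a <= xs <= b).
  { specialize (Hxs 0%nat). simpl in Hxs. unfold h in Hxs. lra. }
  assert (Hy : c <= ys <= d).
  { specialize (Hys 0%nat). simpl in Hys. unfold k in Hys. lra. }
  destruct (HG xs ys Hx Hy) as (q & Hq & Hd).
  set (W := h + k + 1). assert (HW : 0 < W) by (unfold W; lra).
  (* Chosen so that [rectI_bound], with perimeter and remainder estimated through [W], leaves
     [eta / 2] times 4^(-n). The 1 in [W] keeps it positive for degenerate rectangles. *)
  set (e := eta / (8 * W * W)).
  assert (He : 0 < e) by (unfold e; apply Rdiv_lt_0_compat; nra).
  destruct (filter_and _ _ (Hq e He) Hd) as (dl & Hdl & Hloc).
  destruct (pow_half_small (dl / W)) as [n Hn]; [apply Rdiv_lt_0_compat; auto|].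
  assert (Hn' : (/ 2) ^ n * W < dl).
  { apply Rmult_lt_compat_r with (r := W) in Hn; auto.
    replace (dl / W * W) with dl in Hn by (field; lra). exact Hn. }
  destruct (Hs n) as [Hi Hb]. unfold inside in Hi. unfold big in Hb.
  specialize (Hxs n). specialize (Hys n). cbv beta in Hxs, Hys. fold (ht n) in Hxs. fold (kt n) in Hys.
  set (x := fst (s n)) in *. set (y := snd (s n)) in *.
  pose proof (Hht n) as P1. pose proof (Hkt n) as P2. pose proof (pow_half_pos n) as P3.
  set (A := fun w => (G (xs, ys) - q (xs, ys) * (xs, ys) + q (xs, ys) * w)%C).
  assert (HA : rectC A x (x + ht n) y (y + kt n)).
  { intros u v _ _. unfold A. apply Ccont_plus; [apply Ccont_const|].
    auto with lim. }
  assert (HGc : rectC G x (x + ht n) y (y + kt n)).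
  { intros u v Hu Hv. apply CD_cont, HG; lra. }
  assert (EG : rectI G x (x + ht n) y (y + kt n) = rectI (fun w => G w - A w)%C x (x + ht n) y (y + kt n)).
  { rewrite rectI_minus by (auto; lra). unfold A at 1. rewrite rectI_affine. ring. }
  rewrite EG in Hb.
  assert (Hbd : Cmod (rectI (fun w => G w - A w)%C x (x + ht n) y (y + kt n)) <=
     4 * ((x + ht n - x) + (y + kt n - y)) * (e * ((/ 2) ^ n * W))).
  { apply rectI_bound; try lra.
    - intros u v Hu Hv. apply Ccont_minus; auto.
    - intros u v Hu Hv.
      assert (Hdist : Cmod ((u, v) - (xs, ys))%C <= (/ 2) ^ n * W).
      { eapply Rle_trans; [apply Cmod_le_abs|]. simpl.
        assert (Rabs (u + - xs) <= ht n) by (apply Rabs_le; lra).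
        assert (Rabs (v + - ys) <= kt n) by (apply Rabs_le; lra).
        unfold ht, kt in *. unfold W. lra. }
      destruct (Hloc (u, v)) as [H1 H2]; [lra|].
      replace (G (u, v) - A (u, v))%C with ((q (u, v) - q (xs, ys)) * ((u, v) - (xs, ys)))%C.
      + rewrite Cmod_mult. apply Rmult_le_compat; try apply Cmod_ge_0; lra.
      + replace (G (u, v)) with ((G (u, v) - G (xs, ys)) + G (xs, ys))%C by ring.
        rewrite H2. unfold A. ring. }
  assert (F : 4 * ((x + ht n - x) + (y + kt n - y)) * (e * ((/ 2) ^ n * W)) <=
     4 * ((/ 2) ^ n * W) * (e * ((/ 2) ^ n * W))).
  { apply Rmult_le_compat_r; [|unfold ht, kt, W; nra].
    apply Rmult_le_pos; [lra|]. apply Rmult_le_pos; lra. }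
  assert (F2 : 4 * ((/ 2) ^ n * W) * (e * ((/ 2) ^ n * W)) = eta / 2 * ((/ 2) ^ n * (/ 2) ^ n)).
  { unfold e. field. lra. }
  assert (F3 : 0 < eta * ((/ 2) ^ n * (/ 2) ^ n)) by (apply Rmult_lt_0_compat; [lra | apply Rmult_lt_0_compat; lra]).
  lra.
Qed.

Lemma Ci_neq_0 : Ci <> 0.
Proof. apply Cneq_of_Cmod. rewrite Cmod_Ci. lra. Qed.

Definition circ (r t : R) : C := (r * cos t, r * sin t).

(** Not normalised: the mean value property below carries the factor [2 * PI]. *)
Definition cmean (f : C -> C) (r : R) : C := CInt (fun t => f (circ r t)) 0 (2 * PI).

Lemma Cmod_circ r t : Cmod (circ r t) = Rabs r.
Proof.
  unfold circ. replace (r * cos t, r * sin t) with (r * (cos t, sin t))%C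
    by (apply injective_projections; simpl; ring).
  rewrite Cmod_mult, Cmod_R. replace (Cmod (cos t, sin t)) with 1; [ring|].
  unfold Cmod. simpl. pose proof (sin2_cos2 t) as H. unfold Rsqr in H.
  apply eq_trans with (sqrt 1); [symmetry; apply sqrt_1 | f_equal; lra].
Qed.

Lemma RC_circ r t : RC (circ r) t.
Proof.
  apply (RC_pair (fun t => r * cos t) (fun t => r * sin t)).
  - apply (continuous_scal_r r cos), continuous_cos.
  - apply (continuous_scal_r r sin), continuous_sin.
Qed.

Lemma Cexp_ln r t : 0 < r -> Cexp (ln r, t) = circ r t.
Proof.
  intros Hr. unfold Cexp, circ. simpl. rewrite exp_ln by auto.
  apply injective_projections; simpl; ring.
Qed.

(** The exponential maps the rectangle [ln r1, ln r2] x [0, 2 pi] onto the annulus. Goursat's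
    theorem applies to the composition; the horizontal sides cancel by periodicity and the vertical
    ones are the two circle means. *)
Lemma cmean_annulus f r1 r2 : 0 < r1 <= r2 ->
  (forall z, r1 <= Cmod z <= r2 -> CD f z) -> cmean f r1 = cmean f r2.
Proof.
  intros Hr Hf. pose proof PI_RGT_0 as HPI.
  assert (Hl : ln r1 <= ln r2) by (apply ln_le; lra).
  assert (HG : forall x y, ln r1 <= x <= ln r2 -> CD (fun w => f (Cexp w)) (x, y)).
  { intros x y Hx. apply (CD_comp Cexp f); [apply CD_Cexp|]. apply Hf.
    rewrite Cmod_Cexp. simpl. split.
    - rewrite <- (exp_ln r1) by lra. destruct (proj1 Hx) as [H| ->]; [left; apply exp_increasing; auto | lra].
    - rewrite <- (exp_ln r2) by lra. destruct (proj2 Hx) as [H|H]; [left; apply exp_increasing; auto | rewrite H; lra]. }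
  assert (G := goursat (fun w => f (Cexp w)) (ln r1) (ln r2) 0 (2 * PI) Hl ltac:(lra)
     (fun x y Hx _ => HG x y Hx)).
  unfold rectI in G.
  rewrite (CInt_ext _ (fun _ => RtoC 0)) in G.
  2:{ exact Hl. }
  2:{ intros x _. replace (Cexp (x, 2 * PI)) with (Cexp (x, 0)); [ring|].
      unfold Cexp. simpl. rewrite cos_2PI, sin_2PI, cos_0, sin_0. reflexivity. }
  rewrite CInt_const, Cmult_0_r, Cplus_0_l in G.
  rewrite CInt_minus in G; try lra;
    try (intros t _; apply (RC_ver (fun w => f (Cexp w))); apply CD_cont, HG; lra).
  assert (E : forall r, 0 < r -> CInt (fun t => f (Cexp (ln r, t))) 0 (2 * PI) = cmean f r).
  { intros r H0. apply CInt_ext; [lra|]. intros t _. rewrite Cexp_ln; auto. }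
  rewrite !E in G by lra.
  assert (G2 : (cmean f r2 - cmean f r1)%C = RtoC 0).
  { replace (cmean f r2 - cmean f r1)%C with (/ Ci * (Ci * (cmean f r2 - cmean f r1)))%C.
    - rewrite G. ring.
    - field. apply Ci_neq_0. }
  replace (cmean f r2) with ((cmean f r2 - cmean f r1) + cmean f r1)%C by ring.
  rewrite G2. ring.
Qed.

(** * The mean value property and removable singularities *)

Lemma Ccont_ext_global (f g : C -> C) z : (forall w, f w = g w) -> Ccont f z -> Ccont g z.
Proof. intros H. apply Ccont_ext. apply filter_imp with (2 := filter_true). auto. Qed.

Lemma CD_ext_global (f g : C -> C) z : (forall w, f w = g w) -> CD f z -> CD g z.
Proof. intros H. apply CD_ext. apply filter_imp with (2 := filter_true). auto. Qed.

Lemma RtoC_neq_0 (x : R) : x <> 0 -> RtoC x <> 0.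
Proof. intros H E. apply H. apply RtoC_inj, E. Qed.

Lemma Ccont_fst z : Ccont (fun p => RtoC (fst p)) z.
Proof.
  intros e He. exists e; split; auto. intros w Hw. rewrite <- RtoC_minus, Cmod_R.
  eapply Rle_lt_trans; [apply (abs_fst_le (w - z)%C) | exact Hw].
Qed.

Lemma Ccont_snd z : Ccont (fun p => RtoC (snd p)) z.
Proof.
  intros e He. exists e; split; auto. intros w Hw. rewrite <- RtoC_minus, Cmod_R.
  eapply Rle_lt_trans; [apply (abs_snd_le (w - z)%C) | exact Hw].
Qed.

Lemma circ_Cexp r t : circ r t = (RtoC r * Cexp (Ci * RtoC t))%C.
Proof.
  unfold circ, Cexp. replace (fst (Ci * RtoC t)%C) with 0 by (simpl; ring).
  replace (snd (Ci * RtoC t)%C) with t by (simpl; ring).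
  rewrite exp_0. apply injective_projections; simpl; ring.
Qed.

Lemma Ccont_circ z : Ccont (fun p => circ (fst p) (snd p)) z.
Proof.
  apply Ccont_ext_global with (fun p => RtoC (fst p) * Cexp (Ci * RtoC (snd p)))%C.
  - intros w. symmetry. apply circ_Cexp.
  - apply Ccont_mult; [apply Ccont_fst|].
    apply (Ccont_comp (fun p => Ci * RtoC (snd p))%C Cexp).
    + apply Ccont_mult; [apply Ccont_const | apply Ccont_snd].
    + apply CD_cont, CD_Cexp.
Qed.

Lemma RC_on_circ f r t : Ccont f (circ r t) -> RC (fun s => f (circ r s)) t.
Proof. apply (RC_comp f (circ r)), RC_circ. Qed.

Lemma cmean_cont f r0 : 0 <= r0 <= 1 -> (forall z, Cmod z <= 1 -> Ccont f z) ->
  forall e, 0 < e -> exists d, 0 < d /\ forall r, 0 <= r <= 1 -> Rabs (r - r0) < d ->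
    Cmod (cmean f r - cmean f r0) <= e.
Proof.
  intros Hr0 Hf e He. pose proof PI_RGT_0 as HPI.
  set (e' := e / (8 * PI)). assert (He' : 0 < e') by (unfold e'; apply Rdiv_lt_0_compat; lra).
  assert (H : forall t, exists d : posreal, forall r s, Rabs (r - r0) < d -> Rabs (s - t) < d ->
     Cmod (f (circ r s) - f (circ r0 t)) < e').
  { intros t.
    assert (Hc : Ccont (fun p => f (circ (fst p) (snd p))) (r0, t)).
    { apply (Ccont_comp (fun p => circ (fst p) (snd p)) f); [apply Ccont_circ|].
      apply Hf. cbn [fst snd]. rewrite Cmod_circ, Rabs_pos_eq; lra. }
    destruct (Hc e' He') as (d & Hd & H).
    assert (Hd2 : 0 < d / 2) by lra. exists (mkposreal _ Hd2). intros r s H1 H2. simpl in H1, H2.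
    apply (H (r, s)). eapply Rle_lt_trans; [apply Cmod_le_abs|]. simpl. unfold Rminus in *. lra. }
  set (dl := fun t => proj1_sig (constructive_indefinite_description _ (H t))).
  assert (Hdl : forall t r s, Rabs (r - r0) < dl t -> Rabs (s - t) < dl t ->
     Cmod (f (circ r s) - f (circ r0 t)) < e').
  { intros t. unfold dl. destruct (constructive_indefinite_description _ (H t)) as [d Hd]. exact Hd. }
  (* The second interval is the single point 0, so this is compactness of [0, 2 pi] in one
     variable. *)
  destruct (compactness_value_2d 0 (2 * PI) 0 0 (fun t _ => dl t)) as [d Hd].
  exists d. split; [apply cond_pos|]. intros r Hr Hrd.
  unfold cmean. rewrite <- CInt_minus; try lra.
  - replace e with (2 * ((2 * PI - 0) * (2 * e'))) by (unfold e'; field; lra).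
    apply CInt_bound; try lra.
    + intros t Ht. apply RC_minus; apply RC_on_circ, Hf; rewrite Cmod_circ, Rabs_pos_eq; lra.
    + intros s Hs. destruct (NNPP _ (Hd s 0 Hs ltac:(lra))) as (t & v & _ & _ & H1 & _ & H2).
      assert (A1 := Hdl t r s ltac:(lra) H1).
      assert (A2 := Hdl t r0 s ltac:(rewrite Rminus_diag, Rabs_R0; apply cond_pos) H1).
      replace (f (circ r s) - f (circ r0 s))%C with
        ((f (circ r s) - f (circ r0 t)) - (f (circ r0 s) - f (circ r0 t)))%C by ring.
      eapply Rle_trans; [apply Cmod_triangle|]. rewrite Cmod_opp. lra.
  - intros t Ht. apply RC_on_circ, Hf. rewrite Cmod_circ, Rabs_pos_eq; lra.
  - intros t Ht. apply RC_on_circ, Hf. rewrite Cmod_circ, Rabs_pos_eq; lra.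
Qed.

Lemma Ceq_of_small (x y : C) : (forall e, 0 < e -> Cmod (x - y) <= e) -> x = y.
Proof.
  intros H. destruct (Ceq_em x y) as [E|n]; auto. exfalso.
  pose proof (Cmod_pos _ (Csub_neq _ _ n)) as P.
  specialize (H (Cmod (x - y) / 2) ltac:(lra)). lra.
Qed.

Lemma const_off_list (l : list R) : forall a b (j : R -> C), a <= b ->
  (forall x, a <= x <= b -> forall e, 0 < e -> exists d, 0 < d /\
     forall y, a <= y <= b -> Rabs (y - x) < d -> Cmod (j y - j x) <= e) ->
  (forall r1 r2, a < r1 <= r2 -> r2 < b -> (forall x, In x l -> ~ (r1 <= x <= r2)) -> j r1 = j r2) ->
  j a = j b.
Proof.
  induction l as [|x0 l IH]; intros a b j Hab Hc Hj.
  - destruct (Req_dec a b) as [->|n]; auto. set (m := (a + b) / 2).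
    apply eq_trans with (j m); apply Ceq_of_small; intros e He.
    + destruct (Hc a ltac:(lra) e He) as (d & Hd & H).
      pose proof (Rmin_l m (a + d / 2)). pose proof (Rmin_r m (a + d / 2)).
      assert (a < Rmin m (a + d / 2)) by (apply Rmin_glb_lt; unfold m; lra).
      rewrite <- (Hj (Rmin m (a + d / 2)) m); [| lra | unfold m; lra | intros x []].
      replace (j a - j (Rmin m (a + d / 2)))%C with (- (j (Rmin m (a + d / 2)) - j a))%C by ring.
      rewrite Cmod_opp. apply H; [unfold m in *; lra|]. rewrite Rabs_pos_eq; lra.
    + destruct (Hc b ltac:(lra) e He) as (d & Hd & H).
      pose proof (Rmax_l m (b - d / 2)). pose proof (Rmax_r m (b - d / 2)).
      assert (Rmax m (b - d / 2) < b) by (apply Rmax_lub_lt; unfold m; lra).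
      rewrite (Hj m (Rmax m (b - d / 2))); [| unfold m in *; lra | lra | intros x []].
      apply H; [unfold m in *; lra|]. rewrite Rabs_left1; lra.
  - destruct (Rlt_dec a x0) as [H1|H1]; [destruct (Rlt_dec x0 b) as [H2|H2]|].
    + apply eq_trans with (j x0); apply IH; try lra.
      * intros x Hx e He. destruct (Hc x ltac:(lra) e He) as (d & Hd & H).
        exists d; split; auto. intros y Hy. apply H. lra.
      * intros r1 r2 Hr Hr2 Hn. apply Hj; try lra. intros x [<-|Hx]; [lra | auto].
      * intros x Hx e He. destruct (Hc x ltac:(lra) e He) as (d & Hd & H).
        exists d; split; auto. intros y Hy. apply H. lra.
      * intros r1 r2 Hr Hr2 Hn. apply Hj; try lra. intros x [<-|Hx]; [lra | auto].
    + apply IH; auto. intros r1 r2 Hr Hr2 Hn. apply Hj; auto. intros x [<-|Hx]; [lra | auto].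
    + apply IH; auto. intros r1 r2 Hr Hr2 Hn. apply Hj; auto. intros x [<-|Hx]; [lra | auto].
Qed.

(* The finite exceptional set spares the proof of differentiability at points
   where a singularity has been removed by continuity. *)
Definition disc_fun (f : C -> C) : Prop :=
  (forall z, Cmod z <= 1 -> Ccont f z) /\
  exists l : list C, forall z, Cmod z < 1 -> ~ In z l -> CD f z.

(** The circle mean is constant between the moduli of the exceptional points and continuous in the
    radius, hence constant on [0, 1]; at radius 0 the integrand is [f 0]. *)
Lemma mean_value f : disc_fun f -> cmean f 1 = (RtoC (2 * PI) * f 0%C)%C.
Proof.
  intros [Hc [l Hl]].
  rewrite <- (const_off_list (map Cmod l) 0 1 (cmean f)); try lra.
  - unfold cmean. rewrite (CInt_ext _ (fun _ => f 0%C)).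
    + rewrite CInt_const. f_equal. f_equal. ring.
    + pose proof PI_RGT_0. lra.
    + intros t _. f_equal. unfold circ. apply injective_projections; simpl; ring.
  - intros x Hx e He. destruct (cmean_cont f x Hx Hc e He) as (d & Hd & H). exists d; split; auto.
  - intros r1 r2 Hr1 Hr2 Hn. apply cmean_annulus; [lra|]. intros z Hz. apply Hl; [lra|].
    intros Hin. apply (Hn (Cmod z)); auto. apply in_map; auto.
Qed.

Lemma disc_const (c : C) : disc_fun (fun _ => c).
Proof. split; [intros; apply Ccont_const | exists nil; intros; apply CD_const]. Qed.

Lemma disc_mult f g : disc_fun f -> disc_fun g -> disc_fun (fun z => f z * g z)%C.
Proof.
  intros [Hf [l Hl]] [Hg [m Hm]]. split.
  - intros z Hz. apply Ccont_mult; auto.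
  - exists (l ++ m). intros z Hz Hn. rewrite in_app_iff in Hn. apply CD_mult; auto.
Qed.

Lemma disc_minus f g : disc_fun f -> disc_fun g -> disc_fun (fun z => f z - g z)%C.
Proof.
  intros [Hf [l Hl]] [Hg [m Hm]]. split.
  - intros z Hz. apply Ccont_minus; auto.
  - exists (l ++ m). intros z Hz Hn. rewrite in_app_iff in Hn. apply CD_minus; auto.
Qed.

#[local] Hint Resolve disc_const disc_mult disc_minus : lim.

Lemma CInt_conj f a b : a <= b -> (forall t, a <= t <= b -> RC f t) ->
  CInt (fun t => Cconj (f t)) a b = Cconj (CInt f a b).
Proof.
  intros Hab H. unfold CInt, Cconj. simpl. f_equal.
  apply (RInt_opp (fun t => snd (f t)) a b). apply ex_RInt_snd; auto.
Qed.

(** On the unit circle z / (z - w) is the conjugate of 1 / (1 - conj w z), which is analytic on the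
    disc with value 1 at 0. *)
Lemma cauchy_kernel_mean (w : C) : Cmod w <= / 2 ->
  CInt (fun t => circ 1 t / (circ 1 t - w))%C 0 (2 * PI) = RtoC (2 * PI).
Proof.
  intros Hw. pose proof PI_RGT_0 as HPI.
  assert (Hn : forall z, Cmod z <= 1 -> (1 - Cconj w * z)%C <> 0).
  { intros z Hz. apply Cneq_of_Cmod. pose proof (Cmod_sub_ge (1 - Cconj w * z) 1) as H.
    replace (1 - Cconj w * z - 1)%C with (- (Cconj w * z))%C in H by ring.
    rewrite Cmod_opp, Cmod_mult, Cmod_conj, Cmod_1 in H. pose proof (Cmod_ge_0 z).
    pose proof (Cmod_ge_0 w). nra. }
  assert (D : forall z, Cmod z <= 1 -> CD (fun z => / (1 - Cconj w * z))%C z).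
  { intros z Hz. apply (CD_inv (fun z => 1 - Cconj w * z)%C); [apply Hn; auto|].
    apply CD_minus; [apply CD_const|]. auto with lim. }
  assert (M := mean_value (fun z => / (1 - Cconj w * z))%C). cbv beta in M.
  replace (/ (1 - Cconj w * 0))%C with (RtoC 1) in M by (field; apply RtoC_neq_0; lra).
  rewrite Cmult_1_r in M.
  apply (f_equal Cconj) in M.
  2:{ split; [intros; apply CD_cont; auto | exists nil; intros; apply D; lra]. }
  unfold cmean in M. rewrite <- CInt_conj in M; try lra.
  - rewrite (CInt_ext _ (fun t => Cconj (/ (1 - Cconj w * circ 1 t)))); [|lra|].
    + rewrite M. unfold Cconj. apply injective_projections; simpl; ring.
    + intros t _. assert (Hc : Cmod (circ 1 t) = 1) by (rewrite Cmod_circ; apply Rabs_R1).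
      rewrite Cinv_conj by (apply Hn; lra).
      rewrite Cminus_conj, Cmult_conj, Cconj_conj.
      assert (Hcc : (circ 1 t * Cconj (circ 1 t))%C = 1%C).
      { rewrite <- Cmod2_conj, Hc. f_equal. ring. }
      assert (H0 : circ 1 t <> 0) by (apply Cneq_of_Cmod; lra).
      assert (H1 : (circ 1 t - w)%C <> 0).
      { apply Cneq_of_Cmod. pose proof (Cmod_sub_ge (circ 1 t - w) (circ 1 t)) as H.
        replace (circ 1 t - w - circ 1 t)%C with (- w)%C in H by ring. rewrite Cmod_opp in H. lra. }
      replace (Cconj (circ 1 t)) with (/ circ 1 t)%C.
      * replace (Cconj 1) with (RtoC 1) by (apply injective_projections; simpl; ring).
        field. split; auto.
      * rewrite <- (Cmult_1_r (/ circ 1 t)%C), <- Hcc. field. auto.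
  - intros t _. apply (RC_on_circ (fun z => / (1 - Cconj w * z))%C). apply CD_cont, D. rewrite Cmod_circ, Rabs_R1. lra.
Qed.

Lemma circle_bounded f : (forall z, Cmod z <= 1 -> Ccont f z) ->
  exists B, 0 < B /\ forall t, 0 <= t <= 2 * PI -> Cmod (f (circ 1 t)) <= B.
Proof.
  intros Hf. pose proof PI_RGT_0 as HPI.
  destruct (continuity_ab_maj (fun t => Cmod (f (circ 1 t))) 0 (2 * PI)) as (m & Hm & _); [lra| |].
  - intros t _. apply continuity_pt_filterlim. apply (RC_Cmod (fun s => f (circ 1 s))).
    apply RC_on_circ, Hf. rewrite Cmod_circ, Rabs_R1. lra.
  - exists (Cmod (f (circ 1 m)) + 1). pose proof (Cmod_ge_0 (f (circ 1 m))).
    split; [lra|]. intros t Ht. specialize (Hm t Ht). simpl in Hm. lra.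
Qed.

(** The function g = z f extends continuously by 0 and is thus admissible in [mean_value] with
    exceptional point 0. Cauchy's formula then writes f = g / w near 0 as an integral that depends
    continuously on w, including w = 0. *)
Lemma removable_0 (f : C -> C) :
  (forall z : C, z <> 0 -> Cmod z < 2 -> CD f z) ->
  Clim (Cpunct 0%C) (fun z => z * f z)%C 0%C ->
  exists l, Clim (Cpunct 0%C) f l.
Proof.
  intros Hf H0. pose proof PI_RGT_0 as HPI.
  set (g := fun z => (z * f z)%C).
  assert (g0 : g 0%C = 0%C) by (unfold g; ring).
  assert (Dg : forall z : C, z <> 0 -> Cmod z < 2 -> CD g z).
  { intros z Hz Hz2. apply CD_mult; [apply CD_id | apply Hf; auto]. }
  assert (Cg : forall z, Cmod z < 2 -> Ccont g z).
  { intros z Hz. destruct (Ceq_em z 0%C) as [->|n]; [|apply CD_cont, Dg; auto].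
    intros e He. destruct (H0 e He) as (d & Hd & H). exists d; split; auto.
    intros w Hw. destruct (Ceq_em w 0%C) as [->|n]; [|rewrite g0; apply H; auto].
    replace (g 0 - g 0)%C with (RtoC 0) by ring. rewrite Cmod_0. auto. }
  assert (Hsep : forall w t, Cmod w < / 2 -> / 2 <= Cmod (circ 1 t - w)).
  { intros w t Hw. pose proof (Cmod_sub_ge (circ 1 t - w) (circ 1 t)) as H.
    replace (circ 1 t - w - circ 1 t)%C with (- w)%C in H by ring.
    rewrite Cmod_opp, Cmod_circ, Rabs_R1 in H. lra. }
  assert (Hsep' : forall w t, Cmod w < / 2 -> (circ 1 t - w)%C <> 0).
  { intros w t Hw. apply Cneq_of_Cmod. pose proof (Hsep w t Hw). lra. }
  assert (RCk : forall w t, Cmod w < / 2 -> RC (fun t => / (circ 1 t - w))%C t).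
  { intros w t Hw. apply (RC_comp (fun z => / (z - w))%C (circ 1)); [apply RC_circ|].
    apply (Ccont_inv (fun z => z - w)%C); auto.
    auto with lim. }
  assert (RCg : forall t, RC (fun t => g (circ 1 t)) t).
  { intros t. apply RC_on_circ, Cg. rewrite Cmod_circ, Rabs_R1. lra. }
  assert (RCgk : forall w t, Cmod w < / 2 -> RC (fun t => g (circ 1 t) * / (circ 1 t - w))%C t).
  { intros w t Hw. apply RC_mult; auto. }
  assert (RCck : forall w t, Cmod w < / 2 -> RC (fun t => circ 1 t / (circ 1 t - w))%C t).
  { intros w t Hw. apply RC_mult; auto. apply RC_circ. }
  (* Cauchy's formula for [g], divided by [w] *)
  assert (Cau : forall w : C, w <> 0 -> Cmod w < / 2 ->
     f w = (/ (RtoC (2 * PI)) * CInt (fun t => g (circ 1 t) * / (circ 1 t - w)) 0 (2 * PI))%C).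
  { intros w Hw Hw2. destruct (Dg w Hw ltac:(lra)) as (q & Hq & Hd).
    (* In the angular variable dz / (z - w) becomes i z / (z - w) dt, which explains the factor z;
       it also gives k(0) = 0, so the mean of k vanishes. At w the difference quotient is completed
       by Caratheodory's [q]. *)
    set (k := fun z => if Ceq_em z w then (z * q z)%C else (z * ((g z - g w) / (z - w)))%C).
    assert (Dk : forall z : C, z <> 0 -> z <> w -> Cmod z < 2 -> CD k z).
    { intros z Hz Hzw Hz2. apply CD_ext with (fun z => z * ((g z - g w) / (z - w)))%C.
      - pose proof (Cmod_pos _ (Csub_neq _ _ Hzw)) as P. exists (Cmod (z - w)). split; auto.
        intros y Hy. unfold k. destruct (Ceq_em y w) as [->|_]; auto.
        replace (w - z)%C with (- (z - w))%C in Hy by ring. rewrite Cmod_opp in Hy. lra.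
      - apply CD_mult; [apply CD_id|]. apply CD_mult.
        + apply CD_minus; [apply Dg; auto | apply CD_const].
        + apply (CD_inv (fun z => z - w)%C); [apply Csub_neq; auto|].
          auto with lim. }
    assert (Mk : cmean k 1 = (RtoC (2 * PI) * k 0%C)%C).
    { apply mean_value. split.
      - intros z Hz. destruct (Ceq_em z w) as [->|n].
        + apply Ccont_ext with (fun z => z * q z)%C; [|apply Ccont_mult; auto; apply Ccont_id].
          revert Hd. apply filter_imp. intros z' Hz'. unfold k. destruct (Ceq_em z' w) as [_|n]; auto.
          rewrite Hz'. field. apply Csub_neq; auto.
        + apply Ccont_ext with (fun z => z * ((g z - g w) / (z - w)))%C.
          * pose proof (Cmod_pos _ (Csub_neq _ _ n)) as P. exists (Cmod (z - w)). split; auto.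
            intros y Hy. unfold k. destruct (Ceq_em y w) as [->|_]; auto.
            replace (w - z)%C with (- (z - w))%C in Hy by ring. rewrite Cmod_opp in Hy. lra.
          * apply Ccont_mult; [apply Ccont_id|]. apply Ccont_mult.
            -- apply Ccont_minus; [apply Cg; lra | apply Ccont_const].
            -- apply (Ccont_inv (fun z => z - w)%C); [apply Csub_neq; auto|].
               auto with lim.
      - exists (RtoC 0 :: w :: nil). intros z Hz Hn. apply Dk; try lra; intros ->; apply Hn; simpl; auto. }
    assert (k0 : k 0%C = 0%C).
    { unfold k. destruct (Ceq_em 0%C w); ring. }
    rewrite k0, Cmult_0_r in Mk. unfold cmean in Mk.
    (* Splitting z = (z - w) + w separates the mean of g, which is g(0) = 0, from the Cauchy
       integral and the kernel mean. *)
    rewrite (CInt_ext _ (fun t => (g (circ 1 t) + w * (g (circ 1 t) * / (circ 1 t - w)))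
       - g w * (circ 1 t / (circ 1 t - w)))%C) in Mk; [|lra|].
    2:{ intros t _. unfold k. destruct (Ceq_em (circ 1 t) w) as [E|n].
        - exfalso. apply (Hsep' w t Hw2). rewrite E. ring.
        - field. apply Hsep'; auto. }
    rewrite CInt_minus in Mk; try lra.
    2:{ intros t _. apply RC_plus; auto. apply RC_mult; auto. apply RC_const. }
    2:{ intros t _. apply RC_mult; auto. apply RC_const. }
    rewrite CInt_plus in Mk; auto; try lra.
    2:{ intros t _. apply RC_mult; auto. apply RC_const. }
    rewrite !CInt_scal in Mk; auto; try lra.
    rewrite cauchy_kernel_mean in Mk by lra.
    assert (Mg : CInt (fun t => g (circ 1 t)) 0 (2 * PI) = 0%C).
    { change (cmean g 1 = 0%C). rewrite mean_value, g0; [ring|].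
      split; [intros; apply Cg; lra|]. exists (RtoC 0 :: nil). intros z Hz Hn.
      apply Dg; try lra. intros ->. apply Hn; simpl; auto. }
    rewrite Mg in Mk.
    set (I := CInt (fun t => g (circ 1 t) * / (circ 1 t - w))%C 0 (2 * PI)) in *.
    unfold g in Mk.
    assert (E : (w * (I - f w * RtoC (2 * PI)))%C = 0%C).
    { rewrite <- Mk. ring. }
    assert (HP : RtoC (2 * PI) <> 0) by (apply RtoC_neq_0; lra).
    assert (E2 : (I - f w * RtoC (2 * PI))%C = 0%C).
    { replace (I - f w * RtoC (2 * PI))%C with (/ w * (w * (I - f w * RtoC (2 * PI))))%C by (field; auto).
      rewrite E. ring. }
    replace I with ((I - f w * RtoC (2 * PI)) + f w * RtoC (2 * PI))%C by ring.
    rewrite E2. field. auto. }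
  exists (/ (RtoC (2 * PI)) * CInt (fun t => g (circ 1 t) * / (circ 1 t - 0)) 0 (2 * PI))%C.
  destruct (circle_bounded g) as (B & HB & Hbd); [intros; apply Cg; lra|].
  intros e He. set (K := 4 * PI * (B * 4)). assert (HK : 0 < K) by (unfold K; nra).
  exists (Rmin (/ 2) (e / K)). split; [apply Rmin_pos; [lra | apply Rdiv_lt_0_compat; auto]|].
  intros w Hw Hn. pose proof (Rmin_l (/ 2) (e / K)). pose proof (Rmin_r (/ 2) (e / K)).
  replace (w - 0)%C with w in Hw by ring. assert (Hw2 : Cmod w < / 2) by lra.
  assert (H02 : Cmod 0 < / 2) by (rewrite Cmod_0; lra).
  rewrite Cau by auto.
  match goal with |- Cmod (?c * ?x - ?c * ?y) < _ =>
    replace (c * x - c * y)%C with (c * (x - y))%C by ring end.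
  rewrite <- CInt_minus; auto; try lra.
  rewrite Cmod_mult, Cmod_inv, Cmod_R, Rabs_pos_eq by (try lra; apply RtoC_neq_0; lra).
  assert (Bd : Cmod (CInt (fun t => g (circ 1 t) * / (circ 1 t - w) - g (circ 1 t) * / (circ 1 t - 0))%C 0 (2 * PI))
     <= 2 * ((2 * PI - 0) * (B * (4 * Cmod w)))).
  { apply CInt_bound; [lra | intros; apply RC_minus; auto |]. intros t Ht.
    replace (g (circ 1 t) * / (circ 1 t - w) - g (circ 1 t) * / (circ 1 t - 0))%C
      with (g (circ 1 t) * (w / ((circ 1 t - w) * (circ 1 t - 0))))%C
      by (field; split; [|apply Hsep'; auto];
          intros E; apply (Hsep' 0%C t H02); rewrite E; ring).
    rewrite Cmod_mult. apply Rmult_le_compat; try apply Cmod_ge_0; auto.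
    pose proof (Hsep w t Hw2). pose proof (Hsep 0%C t H02).
    rewrite Cmod_div by (apply Cmult_neq_0; apply Hsep'; auto).
    rewrite Cmod_mult. pose proof (Cmod_ge_0 w).
    apply Rmult_le_reg_r with (Cmod (circ 1 t - w) * Cmod (circ 1 t - 0)); [nra|].
    unfold Rdiv. rewrite Rmult_assoc, Rinv_l by nra. rewrite Rmult_1_r, Rmult_assoc.
    assert (1 <= 4 * (Cmod (circ 1 t - w) * Cmod (circ 1 t - 0))) by nra. nra. }
  apply Rle_lt_trans with (/ (2 * PI) * (2 * ((2 * PI - 0) * (B * (4 * Cmod w))))).
  { apply Rmult_le_compat_l; auto. left. apply Rinv_0_lt_compat. lra. }
  replace (/ (2 * PI) * (2 * ((2 * PI - 0) * (B * (4 * Cmod w))))) with (8 * B * Cmod w) by (field; lra).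
  assert (Cmod w * K < e).
  { apply Rlt_le_trans with (e / K * K); [apply Rmult_lt_compat_r; lra|]. right. field. lra. }
  unfold K in *. pose proof PI2_3_2. pose proof (Cmod_ge_0 w).
  assert (8 * B * Cmod w <= Cmod w * (4 * PI * (B * 4))); [|lra].
  assert (0 <= B * Cmod w) by nra. unfold PI2 in *. nra.
Qed.

(** * Functions on the closed disc and the Hardy orthogonality *)

Lemma Clim_punct_affine f (p q c l : C) : c <> 0 -> Clim (Cpunct p) f l ->
  Clim (Cpunct q) (fun z => f (p + c * (z - q))%C) l.
Proof.
  intros Hc Hf e He. destruct (Hf e He) as (d & Hd & H). apply Cmod_pos in Hc as Hc'.
  exists (d / Cmod c). split; [apply Rdiv_lt_0_compat; auto|]. intros z Hz Hn. apply H.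
  - replace (p + c * (z - q) - p)%C with (c * (z - q))%C by ring. rewrite Cmod_mult.
    apply Rmult_lt_compat_l with (r := Cmod c) in Hz; auto.
    replace (Cmod c * (d / Cmod c)) with d in Hz by (field; lra). exact Hz.
  - intros E. apply Hn. replace z with (/ c * ((p + c * (z - q)) - p) + q)%C by (field; auto).
    rewrite E. ring.
Qed.

Lemma CD_affine f (p q c z : C) : CD f (p + c * (z - q))%C -> CD (fun z => f (p + c * (z - q)))%C z.
Proof.
  intros H. apply (CD_comp (fun z => p + c * (z - q))%C f); auto.
  auto 10 with lim.
Qed.

Lemma removable (f : C -> C) (p : C) (rho : R) : 0 < rho ->
  (forall z, z <> p -> Cmod (z - p) < rho -> CD f z) ->
  Clim (Cpunct p) (fun z => (z - p) * f z)%C 0%C ->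
  exists l, Clim (Cpunct p) f l.
Proof.
  intros Hr Hf H0. set (c := RtoC (rho / 2)).
  assert (Hc : c <> 0) by (apply RtoC_neq_0; lra).
  assert (Hcm : Cmod c = rho / 2) by (unfold c; rewrite Cmod_R, Rabs_pos_eq; lra).
  destruct (removable_0 (fun z => f (p + c * (z - 0)))%C) as [l Hl].
  - intros z Hz Hz2. apply CD_affine. apply Hf.
    + intros E. apply Hz. replace z with (/ c * ((p + c * (z - 0)) - p))%C by (field; auto).
      rewrite E. ring.
    + replace (p + c * (z - 0) - p)%C with (c * z)%C by ring. rewrite Cmod_mult, Hcm. nra.
  - assert (H1 := Clim_punct_affine _ p 0%C c _ Hc H0). cbv beta in H1.
    replace (RtoC 0) with (/ c * 0)%C at 2 by ring.
    clim_ext (fun z => / c * ((p + c * (z - 0) - p) * f (p + c * (z - 0))))%C;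
      [intros z; field; auto |].
    auto with lim.
  - exists l.
    assert (Hc2 : (/ c)%C <> 0).
    { intros E. assert (c * / c = 1)%C by (field; auto). rewrite E, Cmult_0_r in H.
      apply RtoC_inj in H. lra. }
    apply (Clim_punct_affine _ 0%C p (/ c)%C) in Hl; auto. cbv beta in Hl.
    refine (Clim_ext _ _ _ _ _ Hl).
    intros z. f_equal. field. auto.
Qed.

Lemma list_isolated (l : list C) (p : C) :
  exists rho, 0 < rho /\ forall z, z <> p -> Cmod (z - p) < rho -> ~ In z l.
Proof.
  induction l as [|q l (rho & Hr & H)].
  - exists 1; split; [lra|]. intros z _ _ [].
  - destruct (Ceq_em q p) as [->|n].
    + exists rho; split; auto. intros z Hz Hz2 [E|Hin]; [auto | eapply H; eauto].
    + pose proof (Cmod_pos _ (Csub_neq _ _ n)) as P.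
      exists (Rmin rho (Cmod (q - p))). split; [apply Rmin_pos; auto|].
      intros z Hz Hz2. pose proof (Rmin_l rho (Cmod (q - p))). pose proof (Rmin_r rho (Cmod (q - p))).
      intros [E|Hin]; [subst; lra|]. apply (H z); auto. lra.
Qed.

(** The value at each listed point becomes the limit there. Continuity is all that [disc_fun]
    requires at these points, so [l] serves as its exceptional set. *)
Lemma disc_of_removable (f : C -> C) (l : list C) :
  (forall p, In p l -> Cmod p < 1 /\ Clim (Cpunct p) (fun z => (z - p) * f z)%C 0%C) ->
  (forall z, Cmod z <= 1 -> ~ In z l -> CD f z) ->
  exists F : C -> C, disc_fun F /\ forall z, ~ In z l -> F z = f z.
Proof.
  intros Hl Hf.
  assert (HL : forall p, exists y, In p l -> Clim (Cpunct p) f y).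
  { intros p. destruct (classic (In p l)) as [Hin|n]; [|exists (RtoC 0); tauto].
    destruct (Hl p Hin) as [Hp H0]. destruct (list_isolated l p) as (rho & Hr & Hiso).
    destruct (removable f p (Rmin rho (1 - Cmod p))) as [y Hy]; auto.
    - apply Rmin_pos; lra.
    - intros z Hz Hz2. pose proof (Rmin_l rho (1 - Cmod p)). pose proof (Rmin_r rho (1 - Cmod p)).
      apply Hf; [|apply Hiso; auto; lra].
      pose proof (Cmod_triangle (z - p) p) as T. replace (z - p + p)%C with z in T by ring. lra.
    - exists y; auto. }
  set (lim := fun p => proj1_sig (constructive_indefinite_description _ (HL p))).
  assert (Hlim : forall p, In p l -> Clim (Cpunct p) f (lim p)).
  { intros p. unfold lim. destruct (constructive_indefinite_description _ (HL p)) as [y Hy]. exact Hy. }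
  set (F := fun z => if excluded_middle_informative (In z l) then lim z else f z).
  assert (HF : forall z, ~ In z l -> F z = f z).
  { intros z Hz. unfold F. destruct (excluded_middle_informative (In z l)); tauto. }
  assert (Hloc : forall z, exists rho, 0 < rho /\ forall w, w <> z -> Cmod (w - z) < rho -> f w = F w).
  { intros z. destruct (list_isolated l z) as (rho & Hr & Hiso). exists rho; split; auto.
    intros w Hw Hw2. symmetry. apply HF, Hiso; auto. }
  assert (Hnear : forall z, ~ In z l -> Cnear z (fun w => f w = F w)).
  { intros z Hz. destruct (Hloc z) as (rho & Hr & H). exists rho; split; auto.
    intros w Hw. destruct (Ceq_em w z) as [->|n]; auto. symmetry; apply HF; auto. }
  exists F. split; auto. split.
  - intros z Hz. destruct (classic (In z l)) as [Hin|n].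
    + intros e He. destruct (Hloc z) as (rho & Hr & H). destruct (Hlim z Hin e He) as (d & Hd & H1).
      exists (Rmin rho d). split; [apply Rmin_pos; auto|].
      intros w Hw. pose proof (Rmin_l rho d). pose proof (Rmin_r rho d).
      destruct (Ceq_em w z) as [->|n].
      * replace (F z - F z)%C with (RtoC 0) by ring. rewrite Cmod_0; auto.
      * rewrite <- H by (auto; lra). replace (F z) with (lim z); [apply H1; auto; lra|].
        unfold F. destruct (excluded_middle_informative (In z l)); tauto.
    + apply Ccont_ext with f; auto. apply CD_cont, Hf; auto.
  - exists l. intros z Hz n. apply CD_ext with f; auto. apply Hf; auto. lra.
Qed.

(** Interior limits at every boundary point already force the boundary values to be continuous.
    Beyond the circle [F] is constant along rays, because [Ccont] at a boundary point refers to a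
    full neighbourhood. *)
Lemma disc_extend (f fm : C -> C) :
  (forall z, Cmod z < 1 -> Ccont f z) ->
  (exists l : list C, forall z, Cmod z < 1 -> ~ In z l -> CD f z) ->
  (forall z, Cmod z = 1 -> Clim (Cfrom_in z) f (fm z)) ->
  exists F : C -> C, disc_fun F /\ (forall z, Cmod z < 1 -> F z = f z) /\ (forall z, Cmod z = 1 -> F z = fm z).
Proof.
  intros Hc [l Hl] Hb.
  set (F := fun z => if Rlt_dec (Cmod z) 1 then f z else fm (z / RtoC (Cmod z))%C).
  assert (FI : forall z, Cmod z < 1 -> F z = f z).
  { intros z Hz. unfold F. destruct (Rlt_dec (Cmod z) 1); tauto. }
  assert (FB : forall z, Cmod z = 1 -> F z = fm z).
  { intros z Hz. unfold F. destruct (Rlt_dec (Cmod z) 1); [lra|]. f_equal. rewrite Hz. field. }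
  assert (FN : forall z, Cmod z < 1 -> Cnear z (fun w => f w = F w)).
  { intros z Hz. exists (1 - Cmod z). split; [lra|]. intros w Hw. symmetry; apply FI.
    pose proof (Cmod_triangle (w - z) z) as T. replace (w - z + z)%C with w in T by ring. lra. }
  exists F. split; [|split; auto]. split.
  - intros z Hz. destruct (Rle_lt_or_eq_dec _ _ Hz) as [Hz1|Hz1].
    + apply Ccont_ext with f; auto.
    + intros e He. assert (He2 : 0 < e / 2) by lra.
      destruct (Hb z Hz1 _ He2) as (d & Hd & H). rewrite FB by auto.
      exists (d / 4). split; [lra|]. intros w Hw. unfold F.
      destruct (Rlt_dec (Cmod w) 1) as [Hw1|Hw1].
      * eapply Rlt_trans; [apply H; auto|]; lra.
      * set (w' := (w / RtoC (Cmod w))%C).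
        assert (Hwr : RtoC (Cmod w) <> 0) by (apply RtoC_neq_0; lra).
        assert (Hw' : Cmod w' = 1).
        { unfold w'. rewrite Cmod_div by auto. rewrite Cmod_R, Rabs_pos_eq by lra. field. lra. }
        assert (Hd' : Cmod (w' - z) < d / 2).
        { replace (w' - z)%C with ((w' - w) + (w - z))%C by ring.
          eapply Rle_lt_trans; [apply Cmod_triangle|].
          assert (Cmod (w' - w) <= Cmod (w - z)); [|lra].
          replace (w' - w)%C with (w' * RtoC (1 - Cmod w))%C
            by (unfold w'; rewrite RtoC_minus; field; auto).
          rewrite Cmod_mult, Hw', Cmod_R, Rabs_left1 by lra.
          pose proof (Cmod_triangle (w - z) z) as T. replace (w - z + z)%C with w in T by ring. lra. }
        destruct (Hb w' Hw' _ He2) as (d2 & Hd2 & H2).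
        set (s := Rmin (/ 2) (Rmin (d / 4) (d2 / 2))).
        assert (Hs : 0 < s) by (repeat apply Rmin_pos; lra).
        pose proof (Rmin_l (/ 2) (Rmin (d / 4) (d2 / 2))) as S1.
        pose proof (Rmin_r (/ 2) (Rmin (d / 4) (d2 / 2))) as S2.
        pose proof (Rmin_l (d / 4) (d2 / 2)) as S3. pose proof (Rmin_r (d / 4) (d2 / 2)) as S4.
        fold s in S1, S2.
        (* This interior point lies close enough to both [w'] and [z] for the two one-sided limits
           to apply, so it links [fm w'] with [fm z]. *)
        set (y := (w' * RtoC (1 - s))%C).
        assert (Hy : Cmod y = 1 - s).
        { unfold y. rewrite Cmod_mult, Hw', Cmod_R, Rabs_pos_eq by lra. ring. }
        assert (Hyw : Cmod (y - w') = s).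
        { replace (y - w')%C with (w' * RtoC (- s))%C.
          - rewrite Cmod_mult, Hw', Cmod_R, Rabs_left1 by lra. ring.
          - unfold y. rewrite RtoC_opp, RtoC_minus. ring. }
        assert (A1 : Cmod (f y - fm w') < e / 2) by (apply H2; lra).
        assert (A2 : Cmod (f y - fm z) < e / 2).
        { apply H; [|lra]. replace (y - z)%C with ((y - w') + (w' - z))%C by ring.
          eapply Rle_lt_trans; [apply Cmod_triangle|]. lra. }
        replace (fm w' - fm z)%C with ((f y - fm z) - (f y - fm w'))%C by ring.
        eapply Rle_lt_trans; [apply Cmod_triangle|]. rewrite Cmod_opp. lra.
  - exists l. intros z Hz n. apply CD_ext with f; auto.
Qed.

Lemma Cconj_neq_0 (z : C) : z <> 0 -> Cconj z <> 0.
Proof. intros H. apply Cneq_of_Cmod. rewrite Cmod_conj. apply Cmod_pos, H. Qed.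

Lemma conj_inv_circle (z : C) : Cmod z = 1 -> (/ Cconj z)%C = z.
Proof.
  intros Hz. assert (H0 : z <> 0) by (apply Cneq_of_Cmod; lra).
  apply Cconj_neq_0 in H0 as H1. pose proof (Cmod2_conj z) as H2. rewrite Hz in H2.
  replace (RtoC (1 ^ 2)) with (RtoC 1) in H2 by (f_equal; ring).
  rewrite <- (Cmult_1_r (/ Cconj z)%C), H2. field. auto.
Qed.

(* Schwarz reflection in the unit circle represents an exterior function by a
   function on the disc whose boundary values are the complex conjugates. *)
Lemma disc_reflect (f fp : C -> C) (L : C) :
  (forall z, 1 < Cmod z -> CD f z) -> Clim Cinfty f L ->
  (forall z, Cmod z = 1 -> Clim (Cfrom_out z) f (fp z)) ->
  exists V : C -> C, disc_fun V /\ V 0%C = Cconj L /\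
    (forall z : C, z <> 0 -> Cmod z < 1 -> V z = Cconj (f (/ Cconj z)%C)) /\
    (forall z, Cmod z = 1 -> Cconj (V z) = fp z).
Proof.
  intros Hf HL Hb.
  set (fs := fun z => if Ceq_em z 0%C then Cconj L else Cconj (f (/ Cconj z)%C)).
  assert (Hn : forall z : C, z <> 0 -> Cnear z (fun w => Cconj (f (/ Cconj w)%C) = fs w)).
  { intros z Hz. exists (Cmod z). split; [apply Cmod_pos; auto|]. intros w Hw.
    unfold fs. destruct (Ceq_em w 0%C) as [->|_]; auto.
    replace (0 - z)%C with (- z)%C in Hw by ring. rewrite Cmod_opp in Hw. lra. }
  assert (Hinv : forall z : C, z <> 0 -> Cmod (/ Cconj z) = / Cmod z).
  { intros z Hz. rewrite Cmod_inv, Cmod_conj; auto. apply Cconj_neq_0; auto. }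
  assert (Hout : forall z : C, z <> 0 -> Cmod z < 1 -> 1 < Cmod (/ Cconj z)).
  { intros z Hz Hz1. rewrite Hinv by auto. rewrite <- Rinv_1. apply Rinv_lt_contravar; auto.
    pose proof (Cmod_pos z Hz). lra. }
  assert (HD : forall z : C, z <> 0 -> Cmod z < 1 -> CD fs z).
  { intros z Hz Hz1. apply CD_ext with (fun w => Cconj (f (/ Cconj w)%C)); auto.
    apply (CD_conj (fun w => f (/ w)%C)). apply (CD_comp (fun w => / w)%C f).
    - apply (CD_inv (fun w => w)); [apply Cconj_neq_0; auto | apply CD_id].
    - apply Hf, Hout; auto. }
  destruct (disc_extend fs (fun z => Cconj (fp z))) as (V & HV & HV1 & HV2).
  - intros z Hz. destruct (Ceq_em z 0%C) as [->|n]; [|apply CD_cont, HD; auto].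
    intros e He. destruct (HL e He) as (B & HB).
    pose proof (Rmax_l B 1). pose proof (Rmax_r B 1).
    exists (/ Rmax B 1). split; [apply Rinv_0_lt_compat; lra|]. intros w Hw.
    unfold fs. destruct (Ceq_em 0%C 0%C) as [_|n0]; [|now elim n0].
    destruct (Ceq_em w 0%C) as [->|n].
    + replace (Cconj L - Cconj L)%C with (RtoC 0) by ring. rewrite Cmod_0; auto.
    + rewrite <- Cminus_conj, Cmod_conj. apply HB. rewrite Hinv by auto.
      replace (w - 0)%C with w in Hw by ring. pose proof (Cmod_pos _ n).
      apply Rle_lt_trans with (Rmax B 1); auto. rewrite <- (Rinv_inv (Rmax B 1)).
      apply Rinv_lt_contravar; auto. apply Rmult_lt_0_compat; auto. apply Rinv_0_lt_compat; lra.
  - exists (RtoC 0 :: nil). intros z Hz Hn0. apply HD; auto. intros ->. apply Hn0; simpl; auto.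
  - intros z Hz e He. destruct (Hb z Hz e He) as (d & Hd & H).
    exists (Rmin (/ 2) (d / 2)). split; [apply Rmin_pos; lra|]. intros w Hw Hw1.
    pose proof (Rmin_l (/ 2) (d / 2)). pose proof (Rmin_r (/ 2) (d / 2)).
    assert (Hw2 : / 2 <= Cmod w). { pose proof (Cmod_sub_ge w z). lra. }
    assert (Hw0 : w <> 0) by (apply Cneq_of_Cmod; lra).
    unfold fs. destruct (Ceq_em w 0%C) as [E|_]; [tauto|].
    rewrite <- Cminus_conj, Cmod_conj. apply H; [|apply Hout; auto].
    rewrite <- (conj_inv_circle z Hz) at 1.
    assert (Hz0 : z <> 0) by (apply Cneq_of_Cmod; lra).
    apply Cconj_neq_0 in Hz0. apply Cconj_neq_0 in Hw0.
    replace (/ Cconj w - / Cconj z)%C with (- Cconj (w - z) / (Cconj w * Cconj z))%C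
      by (rewrite Cminus_conj; field; auto).
    rewrite Cmod_div by (apply Cmult_neq_0; auto).
    rewrite Cmod_opp, Cmod_mult, !Cmod_conj, Hz, Rmult_1_r.
    apply Rmult_lt_reg_r with (Cmod w); [lra|]. unfold Rdiv. rewrite Rmult_assoc, Rinv_l by lra. nra.
  - exists V. split; [auto|]. split; [|split].
    + rewrite HV1 by (rewrite Cmod_0; lra). unfold fs. destruct (Ceq_em _ _) as [_|n]; [reflexivity | now elim n].
    + intros z Hz Hz1. rewrite HV1 by auto. unfold fs. destruct (Ceq_em _ _) as [E|_]; [now elim Hz | reflexivity].
    + intros z Hz. rewrite HV2 by auto. apply Cconj_conj.
Qed.

Definition sqn (f : C -> C) (t : R) : R := Cmod (f (circ 1 t)) ^ 2.

Lemma disc_RC f t : disc_fun f -> RC (fun s => f (circ 1 s)) t.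
Proof. intros [Hf _]. apply RC_on_circ, Hf. rewrite Cmod_circ, Rabs_R1. lra. Qed.

Lemma sqn_continuous f t : disc_fun f -> continuous (sqn f) t.
Proof.
  intros Hf. pose proof (RC_Cmod _ _ (disc_RC f t Hf)) as H. unfold sqn.
  apply continuous_ext with (fun s => mult (Cmod (f (circ 1 s))) (Cmod (f (circ 1 s)))).
  - intros s. simpl. unfold mult; simpl. ring.
  - apply (continuous_mult (fun s => Cmod (f (circ 1 s))) (fun s => Cmod (f (circ 1 s)))); auto.
Qed.

Lemma ex_RInt_sqn f : disc_fun f -> ex_RInt (sqn f) 0 (2 * PI).
Proof.
  intros Hf. pose proof PI_RGT_0. apply ex_RInt_cont; [lra|]. intros t _. apply sqn_continuous; auto.
Qed.

Definition L2 (f : C -> C) : R := RInt (sqn f) 0 (2 * PI).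

Lemma L2_ge_0 f : disc_fun f -> 0 <= L2 f.
Proof.
  intros Hf. pose proof PI_RGT_0. apply RInt_ge_0; [lra | apply ex_RInt_sqn; auto |].
  intros; unfold sqn; apply pow2_ge_0.
Qed.

(* The mean of [u * v] vanishes, i.e. [u] and [conj v] are orthogonal in L2. *)
Lemma hardy_orthogonality (u v : C -> C) (m : R -> R) : disc_fun u -> disc_fun v -> v 0%C = 0%C ->
  ex_RInt m 0 (2 * PI) ->
  (forall t, 0 <= t <= 2 * PI -> Cmod (Cconj (v (circ 1 t)) - u (circ 1 t)) ^ 2 <= m t) ->
  L2 u + L2 v <= RInt m 0 (2 * PI).
Proof.
  intros Hu Hv Hv0 Hm Hbd. pose proof PI_RGT_0 as HPI.
  assert (M := mean_value _ (disc_mult _ _ Hu Hv)). cbv beta in M.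
  rewrite Hv0, !Cmult_0_r in M. apply (f_equal fst) in M. simpl in M.
  set (w := fun t => fst (u (circ 1 t) * v (circ 1 t))%C).
  assert (Hw : ex_RInt w 0 (2 * PI)).
  { apply (ex_RInt_fst (fun t => u (circ 1 t) * v (circ 1 t))%C); [lra|].
    intros t _. apply RC_mult; apply disc_RC; auto. }
  change (RInt w 0 (2 * PI) = 0) in M.
  pose proof (ex_RInt_sqn u Hu) as Eu. pose proof (ex_RInt_sqn v Hv) as Ev.
  assert (Euv : ex_RInt (fun t => sqn u t + sqn v t) 0 (2 * PI)) by (apply (ex_RInt_plus (sqn u) (sqn v)); auto).
  assert (Emw : ex_RInt (fun t => m t + 2 * w t) 0 (2 * PI)).
  { apply (ex_RInt_plus m (fun t => 2 * w t)); auto. apply (ex_RInt_scal w _ _ 2); auto. }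
  assert (I : RInt (fun t => sqn u t + sqn v t) 0 (2 * PI) <= RInt (fun t => m t + 2 * w t) 0 (2 * PI)).
  { apply RInt_le; auto; [lra|]. intros t Ht. specialize (Hbd t ltac:(lra)).
    unfold sqn, w. rewrite Cmod_sq in Hbd. rewrite !Cmod_sq. simpl in *. lra. }
  replace (RInt (fun t => sqn u t + sqn v t) 0 (2 * PI)) with (L2 u + L2 v) in I.
  2:{ symmetry. apply (RInt_plus (sqn u) (sqn v)); auto. }
  replace (RInt (fun t => m t + 2 * w t) 0 (2 * PI)) with (RInt m 0 (2 * PI) + 2 * RInt w 0 (2 * PI)) in I.
  - rewrite M in I. lra.
  - symmetry. etransitivity.
    + apply (RInt_plus m (fun t => 2 * w t)); auto. apply (ex_RInt_scal w _ _ 2); auto.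
    + unfold plus; simpl. f_equal. apply (RInt_scal w _ _ 2); auto.
Qed.

Lemma L2_zero f : disc_fun f -> L2 f <= 0 -> forall t, 0 <= t <= 2 * PI -> f (circ 1 t) = 0%C.
Proof.
  intros Hf HL t0 Ht. pose proof PI_RGT_0 as HPI.
  destruct (Ceq_em (f (circ 1 t0)) 0%C) as [E|n]; auto. exfalso. apply Cmod_pos in n.
  assert (Hs : 0 < sqn f t0) by (unfold sqn; apply pow_lt; auto).
  pose proof (sqn_continuous f t0 Hf) as Hc.
  destruct (proj1 (filterlim_locally _ _) Hc (mkposreal _ Hs)) as [d Hd].
  pose proof (cond_pos d) as Pd.
  set (a := Rmax 0 (t0 - d / 2)). set (b := Rmin (2 * PI) (t0 + d / 2)).
  pose proof (Rmax_l 0 (t0 - d / 2)) as A1. pose proof (Rmax_r 0 (t0 - d / 2)) as A2.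
  pose proof (Rmin_l (2 * PI) (t0 + d / 2)) as B1. pose proof (Rmin_r (2 * PI) (t0 + d / 2)) as B2.
  fold a in A1, A2. fold b in B1, B2.
  assert (Hab : a < b).
  { unfold a, b. apply Rmax_lub_lt; apply Rmin_glb_lt; lra. }
  assert (P : 0 < RInt (sqn f) a b).
  { apply RInt_gt_0; auto.
    - intros t Htt. assert (Hb : Rabs (t - t0) < d) by (apply Rabs_def1; lra).
      specialize (Hd t Hb). change (Rabs (sqn f t - sqn f t0) < sqn f t0) in Hd.
      apply Rabs_def2 in Hd. lra.
    - intros; apply sqn_continuous; auto. }
  assert (Ex : forall x y, x <= y -> ex_RInt (sqn f) x y).
  { intros x y Hxy. apply ex_RInt_cont; auto. intros; apply sqn_continuous; auto. }
  assert (G : forall x y, x <= y -> 0 <= RInt (sqn f) x y).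
  { intros x y Hxy. apply RInt_ge_0; auto. intros; unfold sqn; apply pow2_ge_0. }
  unfold L2 in HL.
  rewrite <- (RInt_Chasles (sqn f) 0 a (2 * PI)) in HL by (apply Ex; lra).
  rewrite <- (RInt_Chasles (sqn f) a b (2 * PI)) in HL by (apply Ex; lra).
  unfold plus in HL; simpl in HL.
  pose proof (G 0 a ltac:(lra)). pose proof (G b (2 * PI) ltac:(lra)). lra.
Qed.

(** * Stability of the Riemann-Hilbert problem *)

Definition isq2 : C := RtoC (/ sqrt 2).

Lemma isq2_sq : (isq2 * isq2)%C = (/ 2)%C.
Proof.
  unfold isq2. rewrite <- RtoC_mult, <- Rinv_mult, sqrt_sqrt by lra.
  rewrite RtoC_inv; [reflexivity | lra].
Qed.

Lemma Cmod_isq2_le : Cmod isq2 <= 1.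
Proof.
  assert (H : Cmod isq2 ^ 2 = / 2).
  { replace (Cmod isq2 ^ 2) with (Cmod isq2 * Cmod isq2) by ring.
    rewrite <- Cmod_mult, isq2_sq.
    replace (/ 2)%C with (RtoC (/ 2)) by (apply RtoC_inv; lra). rewrite Cmod_R, Rabs_pos_eq; lra. }
  pose proof (Cmod_ge_0 isq2). nra.
Qed.

(* A row of the solution of the Riemann-Hilbert problem with jump matrix
   [isq2 * ((1, 1/g), (-g, 1))]; the exterior entries are the reflections
   [conj b1], [conj b2]. *)
Definition row_sol (g a1 a2 b1 b2 : C -> C) : Prop :=
  disc_fun a1 /\ disc_fun a2 /\ disc_fun b1 /\ disc_fun b2 /\
  forall z, Cmod z = 1 ->
    Cconj (b1 z) = (isq2 * (a1 z - g z * a2 z))%C /\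
    Cconj (b2 z) = (isq2 * (a1 z * / g z + a2 z))%C.

(** The left side is the determinant of two exterior rows, one with jump [g] (reciprocal [gi]), the
    other the reference with jump [g0]. It differs from the interior determinant only by terms
    linear in [g - g0] and [gi - / g0], so equal jumps give equal determinants on the circle. *)
Lemma row_quotient_jump (a1 a2 q1 q2 g gi g0 : C) : g0 <> 0 ->
  ((isq2 * (a1 - g * a2)) * (isq2 * (q1 * / g0 + q2))
    - (isq2 * (a1 * gi + a2)) * (isq2 * (q1 - g0 * q2)) =
  (a1 * q2 - a2 * q1) - isq2 * ((g - g0) * a2 * (isq2 * (q1 * / g0 + q2))
    + (gi - / g0) * a1 * (isq2 * (q1 - g0 * q2))))%C.
Proof.
  intros H.
  transitivity ((a1 * q2 - a2 * q1) * (2 * (isq2 * isq2)) - (isq2 * isq2) * ((g - g0) * a2 * (q1 * / g0 + q2)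
    + (gi - / g0) * a1 * (q1 - g0 * q2)))%C; [field; auto|].
  replace (2 * (isq2 * isq2))%C with (RtoC 1); [ring|].
  rewrite isq2_sq. field.
Qed.

(** Both rows have the same jump, so the determinant minus 1 has matching values from inside and
    outside and vanishes at infinity. [hardy_orthogonality] with bound 0 then makes it vanish on the
    circle. *)
Lemma det_const_on_circle (g p1 p2 P1 P2 q1 q2 Q1 Q2 : C -> C) :
  row_sol g p1 p2 P1 P2 -> row_sol g q1 q2 Q1 Q2 ->
  P1 0%C = 1%C -> P2 0%C = 0%C -> Q1 0%C = 0%C -> Q2 0%C = 1%C ->
  (forall z, Cmod z = 1 -> g z <> 0) ->
  forall t, 0 <= t <= 2 * PI ->
    (p1 (circ 1 t) * q2 (circ 1 t) - p2 (circ 1 t) * q1 (circ 1 t))%C = 1%C.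
Proof.
  intros (Dp1 & Dp2 & DP1 & DP2 & Jp) (Dq1 & Dq2 & DQ1 & DQ2 & Jq) E1 E2 E3 E4 Hg t Ht.
  set (u := fun z => (p1 z * q2 z - p2 z * q1 z - 1)%C).
  set (v := fun z => (P1 z * Q2 z - P2 z * Q1 z - 1)%C).
  assert (Du : disc_fun u) by (unfold u; auto 10 with lim).
  assert (Dv : disc_fun v) by (unfold v; auto 10 with lim).
  assert (H : L2 u + L2 v <= RInt (fun _ => 0) 0 (2 * PI)).
  { apply (hardy_orthogonality u v (fun _ => 0)); auto.
    - unfold v. rewrite E1, E2, E3, E4. ring.
    - apply ex_RInt_const.
    - intros s _. assert (Hc : Cmod (circ 1 s) = 1) by (rewrite Cmod_circ; apply Rabs_R1).
      destruct (Jp _ Hc) as [J1 J2]. destruct (Jq _ Hc) as [J3 J4]. specialize (Hg _ Hc).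
      unfold u, v. rewrite !Cminus_conj, !Cmult_conj, J1, J2, J3, J4.
      rewrite row_quotient_jump by auto.
      match goal with |- Cmod ?x ^ 2 <= 0 => replace x with (RtoC 0) end.
      + rewrite Cmod_0. lra.
      + replace (Cconj 1) with (RtoC 1) by (apply injective_projections; simpl; ring). ring. }
  rewrite RInt_const in H. unfold scal in H; simpl in H; unfold mult in H; simpl in H.
  pose proof (L2_ge_0 v Dv). assert (Hu := L2_zero u Du ltac:(lra) t Ht). unfold u in Hu.
  replace (p1 (circ 1 t) * q2 (circ 1 t) - p2 (circ 1 t) * q1 (circ 1 t))%C with
    (p1 (circ 1 t) * q2 (circ 1 t) - p2 (circ 1 t) * q1 (circ 1 t) - 1 + 1)%C by ring.
  rewrite Hu. ring.
Qed.

Lemma Cmod_mult_le (x y : C) (a b : R) : Cmod x <= a -> Cmod y <= b -> Cmod (x * y) <= a * b.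
Proof. intros Hx Hy. rewrite Cmod_mult. apply Rmult_le_compat; auto using Cmod_ge_0. Qed.

Lemma Cmod_plus_le (x y : C) (a b : R) : Cmod x <= a -> Cmod y <= b -> Cmod (x + y) <= a + b.
Proof. intros Hx Hy. eapply Rle_trans; [apply Cmod_triangle|]. lra. Qed.

Lemma Cmod_minus_le (x y : C) (a b : R) : Cmod x <= a -> Cmod y <= b -> Cmod (x - y) <= a + b.
Proof. intros Hx Hy. apply Cmod_plus_le; auto. rewrite Cmod_opp. auto. Qed.

(** As the reference determinant is 1, the entries of a - a' and of a' are recovered linearly from
    the quotients d and f. Writing x a - x' a' = x (a - a') + (x - x') a' pairs d with the small
    size [dl] and f with the distance [eta] of the two jumps. *)
Lemma jump_difference_bound (a1 a2 a1' a2' p1 p2 q1 q2 x y x' y' S1 S2 d1 d2 f1 f2 : C) (C0 dl eta : R) :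
  (p1 * q2 - p2 * q1)%C = 1%C ->
  d1 = ((a1 * q2 - a2 * q1) - (a1' * q2 - a2' * q1))%C ->
  d2 = ((a2 * p1 - a1 * p2) - (a2' * p1 - a1' * p2))%C ->
  f1 = (a1' * q2 - a2' * q1)%C -> f2 = (a2' * p1 - a1' * p2)%C ->
  Cmod p1 <= C0 -> Cmod p2 <= C0 -> Cmod q1 <= C0 -> Cmod q2 <= C0 ->
  Cmod S1 <= C0 -> Cmod S2 <= C0 ->
  Cmod x <= dl -> Cmod y <= dl -> Cmod (x - x') <= eta -> Cmod (y - y') <= eta ->
  Cmod (isq2 * (x * a2 * S2 + y * a1 * S1) - isq2 * (x' * a2' * S2 + y' * a1' * S1)) ^ 2
  <= 16 * dl ^ 2 * C0 ^ 4 * (Cmod d1 ^ 2 + Cmod d2 ^ 2)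
     + 16 * eta ^ 2 * C0 ^ 4 * (Cmod f1 ^ 2 + Cmod f2 ^ 2).
Proof.
  intros Hdet E1 E2 E3 E4 Hp1 Hp2 Hq1 Hq2 HS1 HS2 Hx Hy Hxx Hyy.
  assert (A1 : (a1 - a1' = d1 * p1 + d2 * q1)%C).
  { rewrite <- (Cmult_1_r (a1 - a1')%C), <- Hdet, E1, E2. ring. }
  assert (A2 : (a2 - a2' = d1 * p2 + d2 * q2)%C).
  { rewrite <- (Cmult_1_r (a2 - a2')%C), <- Hdet, E1, E2. ring. }
  assert (A3 : (a1' = f1 * p1 + f2 * q1)%C).
  { rewrite <- (Cmult_1_r a1') at 1. rewrite <- Hdet, E3, E4. ring. }
  assert (A4 : (a2' = f1 * p2 + f2 * q2)%C).
  { rewrite <- (Cmult_1_r a2') at 1. rewrite <- Hdet, E3, E4. ring. }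
  clear E1 E2 E3 E4.
  replace (isq2 * (x * a2 * S2 + y * a1 * S1) - isq2 * (x' * a2' * S2 + y' * a1' * S1))%C
    with (isq2 * ((x * (a2 - a2') * S2 + y * (a1 - a1') * S1)
       + ((x - x') * a2' * S2 + (y - y') * a1' * S1)))%C by ring.
  rewrite A1, A2, A3, A4.
  set (s := Cmod d1 + Cmod d2). set (s' := Cmod f1 + Cmod f2).
  pose proof (Cmod_ge_0 d1). pose proof (Cmod_ge_0 d2). pose proof (Cmod_ge_0 f1). pose proof (Cmod_ge_0 f2).
  assert (L : forall u v r1 r2 : C, Cmod r1 <= C0 -> Cmod r2 <= C0 ->
     Cmod (u * r1 + v * r2) <= (Cmod u + Cmod v) * C0).
  { intros u v r1 r2 H3 H4. replace ((Cmod u + Cmod v) * C0) with (Cmod u * C0 + Cmod v * C0) by ring.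
    apply Cmod_plus_le; apply Cmod_mult_le; auto; apply Rle_refl. }
  assert (B : Cmod (isq2 * ((x * (d1 * p2 + d2 * q2) * S2 + y * (d1 * p1 + d2 * q1) * S1)
       + ((x - x') * (f1 * p2 + f2 * q2) * S2 + (y - y') * (f1 * p1 + f2 * q1) * S1)))
     <= 1 * ((dl * (s * C0) * C0 + dl * (s * C0) * C0) + (eta * (s' * C0) * C0 + eta * (s' * C0) * C0))).
  { apply Cmod_mult_le; [apply Cmod_isq2_le|].
    apply Cmod_plus_le; apply Cmod_plus_le; apply Cmod_mult_le; auto; apply Cmod_mult_le; auto; apply L; auto. }
  eapply Rle_trans; [apply pow_incr; split; [apply Cmod_ge_0 | exact B]|].
  set (X := dl * C0 * C0). set (Y := eta * C0 * C0).
  replace (1 * ((dl * (s * C0) * C0 + dl * (s * C0) * C0) + (eta * (s' * C0) * C0 + eta * (s' * C0) * C0)))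
    with (2 * (X * s + Y * s')) by (unfold X, Y; ring).
  replace (16 * dl ^ 2 * C0 ^ 4) with (16 * X ^ 2) by (unfold X; ring).
  replace (16 * eta ^ 2 * C0 ^ 4) with (16 * Y ^ 2) by (unfold Y; ring).
  assert (T1 : (X * s + Y * s') ^ 2 <= 2 * (X ^ 2 * s ^ 2) + 2 * (Y ^ 2 * s' ^ 2)).
  { pose proof (pow2_ge_0 (X * s - Y * s')). nra. }
  assert (T2 : s ^ 2 <= 2 * (Cmod d1 ^ 2 + Cmod d2 ^ 2)).
  { unfold s. pose proof (pow2_ge_0 (Cmod d1 - Cmod d2)). nra. }
  assert (T3 : s' ^ 2 <= 2 * (Cmod f1 ^ 2 + Cmod f2 ^ 2)).
  { unfold s'. pose proof (pow2_ge_0 (Cmod f1 - Cmod f2)). nra. }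
  pose proof (Rmult_le_compat_l _ _ _ (pow2_ge_0 X) T2).
  pose proof (Rmult_le_compat_l _ _ _ (pow2_ge_0 Y) T3). nra.
Qed.

Lemma RInt_lincomb (f g : R -> R) (c k a b : R) : ex_RInt f a b -> ex_RInt g a b ->
  ex_RInt (fun t => c * f t + k * g t) a b /\
  RInt (fun t => c * f t + k * g t) a b = c * RInt f a b + k * RInt g a b.
Proof.
  intros Hf Hg.
  assert (H : is_RInt (fun t => c * f t + k * g t) a b (c * RInt f a b + k * RInt g a b)).
  { apply (is_RInt_plus (fun t => c * f t) (fun t => k * g t));
      [apply (is_RInt_scal f) | apply (is_RInt_scal g)]; apply (RInt_correct (V := R_CompleteNormedModule)); auto. }
  split; [eexists; exact H | apply is_RInt_unique, H].
Qed.

(** * A priori estimate relative to a fixed reference solution *)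

Section Perturbation.

Variables (g0 p1 p2 P1 P2 q1 q2 Q1 Q2 : C -> C) (w0 : C).
Hypotheses (Hp : row_sol g0 p1 p2 P1 P2) (Hq : row_sol g0 q1 q2 Q1 Q2)
  (HP1 : P1 0%C = 1%C) (HP2 : P2 0%C = 0%C) (HQ1 : Q1 0%C = 0%C) (HQ2 : Q2 0%C = 1%C)
  (Hg0 : forall z, Cmod z = 1 -> g0 z <> 0)
  (Hw0 : Clim (Cpunct 0%C) (fun z => P2 z / z)%C w0).

(** Both off-diagonal entries of the jump matrix enter the estimate, hence the bound on the
    reciprocals. *)
Definition close_jump (dl : R) (g g' : C -> C) : Prop :=
  forall z, Cmod z = 1 -> Cmod (g z - g' z) <= dl /\ Cmod (/ g z - / g' z) <= dl.

(** The interior differences [d1], [d2] and the exterior ones [e1], [e2] of the quotients satisfy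
    the hypotheses of [hardy_orthogonality]: the exterior ones vanish at 0 since the normalisations
    agree. The pointwise defect contains a small multiple of the [d] terms, which is absorbed on the
    left because [dl] is small. Of the exterior terms [e2] is kept, since it carries the coefficient
    extracted later. *)
Lemma quotient_L2_bound : exists C1, 0 < C1 /\
  forall dl eta g g' a1 a2 b1 b2 a1' a2' b1' b2',
  C1 * dl ^ 2 <= / 2 ->
  close_jump dl g g0 -> close_jump eta g g' ->
  row_sol g a1 a2 b1 b2 -> row_sol g' a1' a2' b1' b2' ->
  b1 0%C = b1' 0%C -> b2 0%C = b2' 0%C ->
  L2 (fun z => (a1 z * q2 z - a2 z * q1 z) - (a1' z * q2 z - a2' z * q1 z))%C
  + L2 (fun z => (a2 z * p1 z - a1 z * p2 z) - (a2' z * p1 z - a1' z * p2 z))%C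
  + L2 (fun z => (b2 z * P1 z - b1 z * P2 z) - (b2' z * P1 z - b1' z * P2 z))%C
  <= C1 * eta ^ 2 * (L2 (fun z => a1' z * q2 z - a2' z * q1 z)%C + L2 (fun z => a2' z * p1 z - a1' z * p2 z)%C).
Proof.
  pose proof PI_RGT_0 as HPI.
  destruct (Hp) as (Dp1 & Dp2 & DP1 & DP2 & Jp). destruct (Hq) as (Dq1 & Dq2 & DQ1 & DQ2 & Jq).
  destruct (circle_bounded p1) as (B1 & PB1 & HB1); [apply Dp1|].
  destruct (circle_bounded p2) as (B2 & PB2 & HB2); [apply Dp2|].
  destruct (circle_bounded q1) as (B3 & PB3 & HB3); [apply Dq1|].
  destruct (circle_bounded q2) as (B4 & PB4 & HB4); [apply Dq2|].
  destruct (circle_bounded P1) as (B5 & PB5 & HB5); [apply DP1|].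
  destruct (circle_bounded P2) as (B6 & PB6 & HB6); [apply DP2|].
  destruct (circle_bounded Q1) as (B7 & PB7 & HB7); [apply DQ1|].
  destruct (circle_bounded Q2) as (B8 & PB8 & HB8); [apply DQ2|].
  set (C0 := B1 + B2 + B3 + B4 + B5 + B6 + B7 + B8).
  assert (HC0 : 0 < C0) by (unfold C0; lra).
  exists (64 * C0 ^ 4). split; [apply Rmult_lt_0_compat; [lra | apply pow_lt; auto]|].
  intros dl eta g g' a1 a2 b1 b2 a1' a2' b1' b2' Hdl Hgg0 Hgg'
    (Da1 & Da2 & Db1 & Db2 & Ja) (Da1' & Da2' & Db1' & Db2' & Ja') Eb1 Eb2.
  set (d1 := fun z => ((a1 z * q2 z - a2 z * q1 z) - (a1' z * q2 z - a2' z * q1 z))%C).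
  set (d2 := fun z => ((a2 z * p1 z - a1 z * p2 z) - (a2' z * p1 z - a1' z * p2 z))%C).
  set (e1 := fun z => ((b1 z * Q2 z - b2 z * Q1 z) - (b1' z * Q2 z - b2' z * Q1 z))%C).
  set (e2 := fun z => ((b2 z * P1 z - b1 z * P2 z) - (b2' z * P1 z - b1' z * P2 z))%C).
  set (f1 := fun z => (a1' z * q2 z - a2' z * q1 z)%C).
  set (f2 := fun z => (a2' z * p1 z - a1' z * p2 z)%C).
  assert (Dd1 : disc_fun d1) by (unfold d1; auto 10 with lim).
  assert (Dd2 : disc_fun d2) by (unfold d2; auto 10 with lim).
  assert (De1 : disc_fun e1) by (unfold e1; auto 10 with lim).
  assert (De2 : disc_fun e2) by (unfold e2; auto 10 with lim).
  assert (Df1 : disc_fun f1) by (unfold f1; auto 10 with lim).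
  assert (Df2 : disc_fun f2) by (unfold f2; auto 10 with lim).
  set (c := 16 * dl ^ 2 * C0 ^ 4). set (k := 16 * eta ^ 2 * C0 ^ 4).
  set (m := fun t => c * (1 * sqn d1 t + 1 * sqn d2 t) + k * (1 * sqn f1 t + 1 * sqn f2 t)).
  destruct (RInt_lincomb (sqn d1) (sqn d2) 1 1 0 (2 * PI)) as [X12 IX]; try (apply ex_RInt_sqn; auto).
  destruct (RInt_lincomb (sqn f1) (sqn f2) 1 1 0 (2 * PI)) as [Y12 IY]; try (apply ex_RInt_sqn; auto).
  destruct (RInt_lincomb _ _ c k 0 (2 * PI) X12 Y12) as [Xm Im]. rewrite IX, IY in Im.
  assert (PW : forall t, 0 <= t <= 2 * PI ->
     Cmod (Cconj (e1 (circ 1 t)) - d1 (circ 1 t)) ^ 2 <= m t /\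
     Cmod (Cconj (e2 (circ 1 t)) - d2 (circ 1 t)) ^ 2 <= m t).
  { intros t Ht. assert (Hc : Cmod (circ 1 t) = 1) by (rewrite Cmod_circ; apply Rabs_R1).
    assert (Hdet := det_const_on_circle g0 p1 p2 P1 P2 q1 q2 Q1 Q2 Hp Hq HP1 HP2 HQ1 HQ2 Hg0 t Ht).
    specialize (HB1 t Ht). specialize (HB2 t Ht). specialize (HB3 t Ht). specialize (HB4 t Ht).
    specialize (HB5 t Ht). specialize (HB6 t Ht). specialize (HB7 t Ht). specialize (HB8 t Ht).
    set (z := circ 1 t) in *.
    destruct (Jp z Hc) as [JP1 JP2]. destruct (Jq z Hc) as [JQ1 JQ2].
    destruct (Ja z Hc) as [JA1 JA2]. destruct (Ja' z Hc) as [JA1' JA2'].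
    specialize (Hg0 z Hc). destruct (Hgg0 z Hc) as [Hx Hy]. destruct (Hgg' z Hc) as [Hxx Hyy].
    unfold m, sqn. fold z. rewrite !Rmult_1_l.
    assert (Hxx' : Cmod ((g z - g0 z) - (g' z - g0 z)) <= eta)
      by (replace ((g z - g0 z) - (g' z - g0 z))%C with (g z - g' z)%C by ring; auto).
    assert (Hyy' : Cmod ((/ g z - / g0 z) - (/ g' z - / g0 z)) <= eta)
      by (replace ((/ g z - / g0 z) - (/ g' z - / g0 z))%C with (/ g z - / g' z)%C by ring; auto).
    split.
    - replace (Cconj (e1 z) - d1 z)%C with
       (- (isq2 * ((g z - g0 z) * a2 z * Cconj (Q2 z) + (/ g z - / g0 z) * a1 z * Cconj (Q1 z))
         - isq2 * ((g' z - g0 z) * a2' z * Cconj (Q2 z) + (/ g' z - / g0 z) * a1' z * Cconj (Q1 z))))%C.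
      + rewrite Cmod_opp.
        apply (jump_difference_bound _ _ _ _ (p1 z) (p2 z) (q1 z) (q2 z)); auto;
        rewrite ?Cmod_conj; unfold C0; lra.
      + unfold e1, d1. rewrite !Cminus_conj, !Cmult_conj, JA1, JA2, JA1', JA2', JQ1, JQ2.
        rewrite !row_quotient_jump by auto. ring.
    - replace (Cconj (e2 z) - d2 z)%C with
       (isq2 * ((g z - g0 z) * a2 z * Cconj (P2 z) + (/ g z - / g0 z) * a1 z * Cconj (P1 z))
         - isq2 * ((g' z - g0 z) * a2' z * Cconj (P2 z) + (/ g' z - / g0 z) * a1' z * Cconj (P1 z)))%C.
      + apply (jump_difference_bound _ _ _ _ (p1 z) (p2 z) (q1 z) (q2 z)); auto;
        rewrite ?Cmod_conj; unfold C0; lra.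
      + unfold e2, d2. rewrite !Cminus_conj, !Cmult_conj, JA1, JA2, JA1', JA2', JP1, JP2.
        pose proof (row_quotient_jump (a1 z) (a2 z) (p1 z) (p2 z) (g z) (/ g z) (g0 z) Hg0) as K1.
        pose proof (row_quotient_jump (a1' z) (a2' z) (p1 z) (p2 z) (g' z) (/ g' z) (g0 z) Hg0) as K2.
        match type of K1 with ?u = _ => match type of K2 with ?v = _ =>
          transitivity (- u + v - ((a2 z * p1 z - a1 z * p2 z) - (a2' z * p1 z - a1' z * p2 z)))%C end end.
        * rewrite K1, K2. ring.
        * ring. }
  assert (I1 : L2 d1 + L2 e1 <= RInt m 0 (2 * PI)).
  { apply (hardy_orthogonality d1 e1); auto; [|intros t Ht; apply PW; auto].
    unfold e1. rewrite Eb1, Eb2. ring. }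
  assert (I2 : L2 d2 + L2 e2 <= RInt m 0 (2 * PI)).
  { apply (hardy_orthogonality d2 e2); auto; [|intros t Ht; apply PW; auto].
    unfold e2. rewrite Eb1, Eb2. ring. }
  fold m in Im. rewrite Im in I1, I2. fold (L2 d1) (L2 d2) (L2 f1) (L2 f2) in I1, I2.
  pose proof (L2_ge_0 _ Dd1). pose proof (L2_ge_0 _ Dd2). pose proof (L2_ge_0 _ De1).
  pose proof (L2_ge_0 _ De2). pose proof (L2_ge_0 _ Df1). pose proof (L2_ge_0 _ Df2).
  assert (Hc4 : 4 * c <= / 2) by (unfold c; lra).
  assert (Hk : 64 * C0 ^ 4 * eta ^ 2 = 4 * k) by (unfold k; ring). rewrite Hk.
  fold d1 d2 e2 f1 f2.
  pose proof (Rmult_le_compat_r (L2 d1 + L2 d2) _ _ ltac:(lra) Hc4). lra.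
Qed.

Lemma CInt_bound_RInt f m a b : a <= b -> (forall t, a <= t <= b -> RC f t) -> ex_RInt m a b ->
  (forall t, a <= t <= b -> Cmod (f t) <= m t) -> Cmod (CInt f a b) <= 2 * RInt m a b.
Proof.
  intros Hab Hf Hm Hb. eapply Rle_trans; [apply Cmod_le_abs|]. simpl.
  assert (A : forall h : C -> R, (forall z, Rabs (h z) <= Cmod z) ->
    ex_RInt (fun t => h (f t)) a b -> Rabs (RInt (fun t => h (f t)) a b) <= RInt m a b).
  { intros h Hh Hex. apply Rabs_le. split.
    - apply Ropp_le_cancel. rewrite Ropp_involutive.
      replace (- RInt (fun t => h (f t)) a b) with (RInt (fun t => - h (f t)) a b)
        by (apply (RInt_opp (fun t => h (f t))); auto).
      apply RInt_le; auto; [apply (ex_RInt_opp (fun t => h (f t))); auto|].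
      intros t Ht. specialize (Hb t ltac:(lra)). specialize (Hh (f t)). apply Rabs_le_between in Hh. lra.
    - apply RInt_le; auto.
      intros t Ht. specialize (Hb t ltac:(lra)). specialize (Hh (f t)). apply Rabs_le_between in Hh. lra. }
  pose proof (A fst abs_fst_le (ex_RInt_fst f a b Hab Hf)).
  pose proof (A snd abs_snd_le (ex_RInt_snd f a b Hab Hf)). lra.
Qed.

(** [quotient_L2_bound] is used twice: against the reference row itself, to bound the size of the
    primed quotient, and then between the two rows, to get a difference of order [eta]. The mean
    value property converts the L2 bound of the exterior entry [v] into a bound on its coefficient
    at 0. *)
Lemma perturbation : exists dl K, 0 < dl /\ 0 < K /\
  forall g g' eta a1 a2 b1 b2 a1' a2' b1' b2' w w', 0 < eta ->
  close_jump dl g g0 -> close_jump dl g' g0 -> close_jump eta g g' ->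
  row_sol g a1 a2 b1 b2 -> row_sol g' a1' a2' b1' b2' ->
  b1 0%C = 1%C -> b2 0%C = 0%C -> b1' 0%C = 1%C -> b2' 0%C = 0%C ->
  Clim (Cpunct 0%C) (fun z => b2 z / z)%C w -> Clim (Cpunct 0%C) (fun z => b2' z / z)%C w' ->
  Cmod (w - w') <= K * eta.
Proof.
  pose proof PI_RGT_0 as HPI.
  destruct quotient_L2_bound as (C1 & HC1 & HQ). destruct (Hp) as (Dp1 & Dp2 & DP1 & DP2 & Jp).
  destruct (Hq) as (Dq1 & Dq2 & DQ1 & DQ2 & Jq).
  set (dl := / (1 + 2 * C1)). assert (Hdl : 0 < dl) by (apply Rinv_0_lt_compat; lra).
  assert (Hdl2 : C1 * dl ^ 2 <= / 2).
  { unfold dl. apply Rmult_le_reg_r with ((1 + 2 * C1) ^ 2); [nra|].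
    replace (C1 * (/ (1 + 2 * C1)) ^ 2 * (1 + 2 * C1) ^ 2) with C1 by (field; lra). nra. }
  set (K := 4 * PI + C1 * (12 * PI)). assert (HK : 0 < K) by (unfold K; nra).
  exists dl, K. split; [exact Hdl|]. split; [exact HK|].
  intros g g' eta a1 a2 b1 b2 a1' a2' b1' b2' w w' Heta Hg Hg' Hgg' Hr Hr' E1 E2 E3 E4 Hw Hw'.
  destruct (Hr) as (Da1 & Da2 & Db1 & Db2 & Ja). destruct (Hr') as (Da1' & Da2' & Db1' & Db2' & Ja').
  set (f1 := fun z => (a1' z * q2 z - a2' z * q1 z)%C).
  set (f2 := fun z => (a2' z * p1 z - a1' z * p2 z)%C).
  assert (Df1 : disc_fun f1) by (unfold f1; auto 10 with lim).
  assert (Df2 : disc_fun f2) by (unfold f2; auto 10 with lim).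
  set (n1 := fun z => (p1 z * q2 z - p2 z * q1 z)%C).
  set (n2 := fun z => (p2 z * p1 z - p1 z * p2 z)%C).
  assert (Dn1 : disc_fun n1) by (unfold n1; auto 10 with lim).
  assert (Dn2 : disc_fun n2) by (unfold n2; auto 10 with lim).
  assert (N1 : L2 n1 = 2 * PI).
  { unfold L2. rewrite (RInt_ext _ (fun _ => 1)).
    - rewrite RInt_const. unfold scal; simpl; unfold mult; simpl. ring.
    - rewrite Rmin_left, Rmax_right by lra. intros t Ht. unfold sqn, n1.
      rewrite (det_const_on_circle g0 p1 p2 P1 P2 q1 q2 Q1 Q2) by (auto; lra).
      rewrite Cmod_1. apply pow1. }
  assert (N2 : L2 n2 = 0).
  { unfold L2. rewrite (RInt_ext _ (fun _ => 0)).
    - rewrite RInt_const. unfold scal; simpl; unfold mult; simpl. ring.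
    - intros t _. unfold sqn, n2.
      match goal with |- Cmod ?x ^ 2 = 0 => replace x with (RtoC 0) by ring end.
      rewrite Cmod_0. apply pow_i. lia. }
  (* The reference quotient is the row (1, 0) with L2 norm [2 * PI], and the distance to it
     contributes at most [PI]; f = e + n doubles both, whence 6 pi. *)
  assert (SA : L2 f1 + L2 f2 <= 6 * PI).
  { assert (Q := HQ dl dl g' g0 a1' a2' b1' b2' p1 p2 P1 P2 Hdl2 Hg' Hg' Hr' Hp
       ltac:(congruence) ltac:(congruence)).
    fold n1 n2 in Q. rewrite N1, N2 in Q.
    set (e1 := fun z => (a1' z * q2 z - a2' z * q1 z - (p1 z * q2 z - p2 z * q1 z))%C) in Q.
    set (e2 := fun z => (a2' z * p1 z - a1' z * p2 z - (p2 z * p1 z - p1 z * p2 z))%C) in Q.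
    set (e3 := fun z => (b2' z * P1 z - b1' z * P2 z - (P2 z * P1 z - P1 z * P2 z))%C) in Q.
    assert (De1 : disc_fun e1) by (unfold e1; auto 10 with lim).
    assert (De2 : disc_fun e2) by (unfold e2; auto 10 with lim).
    assert (De3 : disc_fun e3) by (unfold e3; auto 10 with lim).
    assert (M1 : L2 f1 <= 2 * L2 e1 + 2 * L2 n1).
    { destruct (RInt_lincomb (sqn e1) (sqn n1) 2 2 0 (2 * PI)) as [X IX]; try (apply ex_RInt_sqn; auto).
      apply Rle_trans with (RInt (fun t => 2 * sqn e1 t + 2 * sqn n1 t) 0 (2 * PI)).
      - apply RInt_le; auto; [lra | apply ex_RInt_sqn; auto|]. intros t _. unfold sqn.
        replace (f1 (circ 1 t)) with (e1 (circ 1 t) + n1 (circ 1 t))%C by (unfold f1, e1, n1; ring).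
        pose proof (Cmod_triangle (e1 (circ 1 t)) (n1 (circ 1 t))).
        pose proof (Cmod_ge_0 (e1 (circ 1 t) + n1 (circ 1 t))).
        pose proof (pow2_ge_0 (Cmod (e1 (circ 1 t)) - Cmod (n1 (circ 1 t)))). nra.
      - right. exact IX. }
    assert (M2 : L2 f2 = L2 e2).
    { unfold L2. apply RInt_ext. intros t _. unfold sqn. do 2 f_equal. unfold f2, e2. ring. }
    pose proof (L2_ge_0 _ De1). pose proof (L2_ge_0 _ De2). pose proof (L2_ge_0 _ De3).
    rewrite N1 in M1. nra. }
  assert (Q := HQ dl eta g g' a1 a2 b1 b2 a1' a2' b1' b2' Hdl2 Hg Hgg' Hr Hr'
     ltac:(congruence) ltac:(congruence)).
  fold f1 f2 in Q.
  match type of Q with L2 ?x + L2 ?y + L2 ?z <= _ => set (u1 := x) in Q; set (u2 := y) in Q; set (v := z) in Q end.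
  assert (Du1 : disc_fun u1) by (unfold u1; auto 10 with lim).
  assert (Du2 : disc_fun u2) by (unfold u2; auto 10 with lim).
  assert (Dv : disc_fun v) by (unfold v; auto 10 with lim).
  pose proof (L2_ge_0 _ Du1). pose proof (L2_ge_0 _ Du2).
  assert (HL : L2 v <= C1 * eta ^ 2 * (6 * PI)).
  { assert (C1 * eta ^ 2 * (L2 f1 + L2 f2) <= C1 * eta ^ 2 * (6 * PI)); [|lra].
    apply Rmult_le_compat_l; auto. pose proof (pow2_ge_0 eta). nra. }
  (* The limit of v / z at 0 is [w - w']: the terms containing [w0] cancel because [b1] and [b1']
     both equal 1 there. *)
  set (h := fun z => if Ceq_em z 0%C then (w - w')%C else (v z * / z)%C).
  assert (Hlim0 : forall b : C -> C, disc_fun b -> Clim (Cpunct 0%C) b (b 0%C)).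
  { intros b Hb. apply Clim_Cpunct_of_near. apply Hb. rewrite Cmod_0. lra. }
  assert (Hh : Clim (Cpunct 0%C) (fun z => v z * / z)%C (w - w')%C).
  { replace (w - w')%C with ((w * P1 0%C - b1 0%C * w0) - (w' * P1 0%C - b1' 0%C * w0))%C
      by (rewrite HP1, E1, E3; ring).
    clim_ext (fun z => (b2 z / z * P1 z - b1 z * (P2 z / z)) - (b2' z / z * P1 z - b1' z * (P2 z / z)))%C;
      [intros z; unfold v, Cdiv; ring |].
    auto 10 with lim. }
  assert (Dh : disc_fun h).
  { destruct (Dv) as [Cv [l Hl]].
    assert (Hn : forall z : C, z <> 0 -> Cnear z (fun y => (v y * / y)%C = h y)).
    { intros z Hz. exists (Cmod z). split; [apply Cmod_pos; auto|]. intros y Hy.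
      unfold h. destruct (Ceq_em y 0%C) as [->|_]; auto.
      replace (0 - z)%C with (- z)%C in Hy by ring. rewrite Cmod_opp in Hy. lra. }
    split.
    - intros z Hz. destruct (Ceq_em z 0%C) as [->|n].
      + intros e He. destruct (Hh e He) as (d & Hd & H1). exists d; split; auto.
        intros y Hy. unfold h. destruct (Ceq_em 0%C 0%C) as [_|n0]; [|now elim n0].
        destruct (Ceq_em y 0%C) as [_|n]; auto.
        replace (w - w' - (w - w'))%C with (RtoC 0) by ring. rewrite Cmod_0; auto.
      + apply Ccont_ext with (fun z => v z * / z)%C; auto. apply Ccont_mult; auto.
        apply (Ccont_inv (fun z => z)); auto. apply Ccont_id.
    - exists (RtoC 0 :: l). intros z Hz Hn0. simpl in Hn0.
      assert (z <> 0) by (intros ->; tauto).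
      apply CD_ext with (fun z => v z * / z)%C; auto. apply CD_mult; auto.
      apply (CD_inv (fun z => z)); auto. apply CD_id. }
  assert (M := mean_value h Dh).
  assert (h0 : h 0%C = (w - w')%C) by (unfold h; destruct (Ceq_em 0%C 0%C) as [_|n]; [auto | now elim n]).
  rewrite h0 in M. apply (f_equal Cmod) in M. rewrite Cmod_mult, Cmod_R, Rabs_pos_eq in M by lra.
  (* The inequality |v| <= eta + |v|^2 / eta replaces Cauchy-Schwarz. Integrated, and doubled by the
     componentwise bound, it yields the constant [K]. *)
  destruct (RInt_lincomb (fun _ => eta) (sqn v) 1 (/ eta) 0 (2 * PI)) as [X EI];
    [apply ex_RInt_const | apply ex_RInt_sqn; auto |].
  rewrite RInt_const in EI. unfold scal in EI; simpl in EI; unfold mult in EI; simpl in EI.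
  assert (I : Cmod (cmean h 1) <= 2 * RInt (fun t => 1 * eta + / eta * sqn v t) 0 (2 * PI)).
  { apply CInt_bound_RInt; auto; [lra | intros t _; apply disc_RC; auto |].
    intros t _. assert (Hc : Cmod (circ 1 t) = 1) by (rewrite Cmod_circ; apply Rabs_R1).
    unfold h. destruct (Ceq_em (circ 1 t) 0%C) as [E|n]; [rewrite E, Cmod_0 in Hc; lra|].
    rewrite Cmod_mult, Cmod_inv, Hc by auto. unfold sqn.
    set (y := Cmod (v (circ 1 t))). assert (0 <= y) by apply Cmod_ge_0.
    apply Rmult_le_reg_l with eta; auto.
    replace (eta * (1 * eta + / eta * y ^ 2)) with (eta ^ 2 + y ^ 2) by (field; lra).
    pose proof (pow2_ge_0 (eta - y)). nra. }
  rewrite EI in I. rewrite M in I. fold (L2 v) in I.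
  assert (J : / eta * L2 v <= C1 * eta * (6 * PI)).
  { apply Rmult_le_reg_l with eta; auto.
    replace (eta * (/ eta * L2 v)) with (L2 v) by (field; lra). nra. }
  assert (T : Cmod (w - w') <= 2 * PI * Cmod (w - w')).
  { pose proof PI2_3_2. unfold PI2 in *. pose proof (Cmod_ge_0 (w - w')). nra. }
  unfold K. lra.
Qed.

End Perturbation.

(** * The two Riemann-Hilbert problems as row problems *)

(** Under reflection the coefficient of 1/z at infinity becomes, up to conjugation, the coefficient
    of z at 0. *)
Lemma reflect_limit (f V : C -> C) (w : C) :
  Clim Cinfty (fun y => y * f y)%C w ->
  (forall z : C, z <> 0 -> Cmod z < 1 -> V z = Cconj (f (/ Cconj z)%C)) ->
  Clim (Cpunct 0%C) (fun z => V z / z)%C (Cconj w).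
Proof.
  intros Hf HV e He. destruct (Hf e He) as (B & HB).
  pose proof (Rmax_l B 1). pose proof (Rmax_r B 1).
  assert (P : 0 < / Rmax B 1) by (apply Rinv_0_lt_compat; lra).
  exists (/ Rmax B 1). split; auto. intros z Hz Hn.
  replace (z - 0)%C with z in Hz by ring. pose proof (Cmod_pos _ Hn) as Pz.
  assert (H1 : Rmax B 1 < / Cmod z).
  { rewrite <- (Rinv_inv (Rmax B 1)). apply Rinv_lt_contravar; auto. apply Rmult_lt_0_compat; auto. }
  assert (Hz1 : Cmod z < 1).
  { eapply Rlt_le_trans; [exact Hz|]. apply Rle_trans with (/ 1); [apply Rinv_le_contravar; lra | lra]. }
  rewrite HV by auto. pose proof (Cconj_neq_0 z Hn) as Hn'.
  replace (Cconj (f (/ Cconj z)) / z - Cconj w)%C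
    with (Cconj (/ Cconj z * f (/ Cconj z) - w))%C.
  - rewrite Cmod_conj. apply HB. rewrite Cmod_inv, Cmod_conj by auto. lra.
  - rewrite Cminus_conj, Cmult_conj, Cinv_conj, Cconj_conj by auto. unfold Cdiv. ring.
Qed.

Lemma jumpPsi_entries Mdeg X T z :
  let g := Cexp (2 * Ci * theta Mdeg X T z)%C in
  jumpPsi Mdeg X T z = mkM2 isq2 (isq2 * / g)%C (- (isq2 * g))%C isq2.
Proof.
  unfold jumpPsi, expsig3, Qinv, M2scal, M2mul. simpl.
  set (th := theta Mdeg X T z).
  assert (E1 : Cexp (2 * Ci * th) = (Cexp (Ci * th) * Cexp (Ci * th))%C)
    by (rewrite <- Cexp_plus; f_equal; ring).
  replace (- Ci * th)%C with (- (Ci * th))%C by ring.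
  replace (- - (Ci * th))%C with (Ci * th)%C by ring.
  rewrite E1, Cexp_opp. pose proof (Cexp_neq_0 (Ci * th)) as Hn.
  fold isq2. f_equal; field; auto.
Qed.

Lemma M2holo_CD f z : M2holo f z ->
  CD (fun w => m11 (f w)) z /\ CD (fun w => m12 (f w)) z /\
  CD (fun w => m21 (f w)) z /\ CD (fun w => m22 (f w)) z.
Proof. intros (H1 & H2 & H3 & H4). repeat split; apply CD_of_ex_derive; auto. Qed.

Lemma M2lim_Clim f F L :  Filter F -> M2lim f F L ->
  Clim F (fun w => m11 (f w)) (m11 L) /\ Clim F (fun w => m12 (f w)) (m12 L) /\
  Clim F (fun w => m21 (f w)) (m21 L) /\ Clim F (fun w => m22 (f w)) (m22 L).
Proof. intros HF (H1 & H2 & H3 & H4). repeat split; apply Clim_of_filterlim; auto. Qed.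

Definition gPsi (Mdeg : nat) (X T : R) (z : C) : C := Cexp (2 * Ci * theta Mdeg X T z)%C.

Lemma Cconj_RtoC (x : R) : Cconj (RtoC x) = RtoC x.
Proof. apply injective_projections; simpl; ring. Qed.

(** Both rows are extracted because the perturbation estimate divides by a full reference matrix.
    The perturbed problem enters through its first row only. *)
Lemma Psi_rows Mdeg X T Psi : is_Psi Mdeg X T Psi ->
  exists p1 p2 P1 P2 q1 q2 Q1 Q2 w,
    row_sol (gPsi Mdeg X T) p1 p2 P1 P2 /\ row_sol (gPsi Mdeg X T) q1 q2 Q1 Q2 /\
    P1 0%C = 1%C /\ P2 0%C = 0%C /\ Q1 0%C = 0%C /\ Q2 0%C = 1%C /\
    Clim (Cpunct 0%C) (fun z => P2 z / z)%C (Cconj w) /\ Psi = (2 * Ci * w)%C.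
Proof.
  intros (Rf & Hholo & (Rm & Rp & Hj) & Hinf & w & Hw & EPsi).
  apply (M2lim_Clim _ _ _ Cinfty_filter) in Hinf. destruct Hinf as (I1 & I2 & I3 & I4). simpl in I1, I2, I3, I4.
  assert (HD : forall z, Cmod z <> 1 -> _) by (intros z Hz; exact (M2holo_CD _ _ (Hholo z Hz))).
  assert (Hin : forall z, Cmod z = 1 -> _) by
    (intros z Hz; exact (M2lim_Clim _ _ _ (Cfrom_in_filter z) (proj1 (Hj z Hz)))).
  assert (Hout : forall z, Cmod z = 1 -> _) by
    (intros z Hz; exact (M2lim_Clim _ _ _ (Cfrom_out_filter z) (proj1 (proj2 (Hj z Hz))))).
  assert (HJ : forall z, Cmod z = 1 -> Rp z = M2mul (Rm z) (jumpPsi Mdeg X T z)) by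
    (intros z Hz; apply (Hj z Hz)).
  clear Hj Hholo.
  assert (EX : forall f fm : C -> C, (forall z, Cmod z <> 1 -> CD f z) ->
     (forall z, Cmod z = 1 -> Clim (Cfrom_in z) f (fm z)) ->
     exists F : C -> C, disc_fun F /\ forall z, Cmod z = 1 -> F z = fm z).
  { intros f fm Hf Hfm. destruct (disc_extend f fm) as (F & HF & _ & HF2); auto.
    - intros z Hz. apply CD_cont, Hf. lra.
    - exists nil. intros z Hz _. apply Hf. lra.
    - exists F; auto. }
  destruct (EX (fun z => m11 (Rf z)) (fun z => m11 (Rm z))) as (p1 & Dp1 & Ep1); [apply HD | apply Hin|].
  destruct (EX (fun z => m12 (Rf z)) (fun z => m12 (Rm z))) as (p2 & Dp2 & Ep2); [apply HD | apply Hin|].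
  destruct (EX (fun z => m21 (Rf z)) (fun z => m21 (Rm z))) as (q1 & Dq1 & Eq1); [apply HD | apply Hin|].
  destruct (EX (fun z => m22 (Rf z)) (fun z => m22 (Rm z))) as (q2 & Dq2 & Eq2); [apply HD | apply Hin|].
  destruct (disc_reflect (fun z => m11 (Rf z)) (fun z => m11 (Rp z)) 1%C) as (P1 & DP1 & P10 & _ & EP1);
    [intros z Hz; apply HD; lra | auto | apply Hout|].
  destruct (disc_reflect (fun z => m12 (Rf z)) (fun z => m12 (Rp z)) 0%C) as (P2 & DP2 & P20 & VP2 & EP2);
    [intros z Hz; apply HD; lra | auto | apply Hout|].
  destruct (disc_reflect (fun z => m21 (Rf z)) (fun z => m21 (Rp z)) 0%C) as (Q1 & DQ1 & Q10 & _ & EQ1);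
    [intros z Hz; apply HD; lra | auto | apply Hout|].
  destruct (disc_reflect (fun z => m22 (Rf z)) (fun z => m22 (Rp z)) 1%C) as (Q2 & DQ2 & Q20 & _ & EQ2);
    [intros z Hz; apply HD; lra | auto | apply Hout|].
  exists p1, p2, P1, P2, q1, q2, Q1, Q2, w.
  rewrite Cconj_RtoC in P10, P20, Q10, Q20.
  split; [|split; [|repeat split; auto]].
  - repeat split; try apply Dp1; try apply Dp2; try apply DP1; try apply DP2;
    rewrite ?EP1, ?EP2, HJ, jumpPsi_entries by auto; simpl; fold (gPsi Mdeg X T z);
    rewrite Ep1, Ep2 by auto; ring.
  - repeat split; try apply Dq1; try apply Dq2; try apply DQ1; try apply DQ2;
    rewrite ?EQ1, ?EQ2, HJ, jumpPsi_entries by auto; simpl; fold (gPsi Mdeg X T z);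
    rewrite Eq1, Eq2 by auto; ring.
  - apply reflect_limit with (fun z => m12 (Rf z)); auto.
    apply (Clim_of_filterlim Cinfty _ _ Hw).
Qed.

Definition Cprod (f : nat -> C) (l : list nat) : C := fold_right Cmult 1%C (map f l).

Lemma Cprod_neq_0 (f : nat -> C) l : (forall j, In j l -> f j <> 0) -> Cprod f l <> 0.
Proof.
  induction l as [|a l IH]; intros H; unfold Cprod; simpl.
  - apply RtoC_neq_0; lra.
  - apply Cmult_neq_0; [apply H; simpl; auto | apply IH; intros; apply H; simpl; auto].
Qed.

Lemma Cprod_CD (f : nat -> C -> C) l z : (forall j, CD (f j) z) -> CD (fun z => Cprod (fun j => f j z) l) z.
Proof.
  intros H. induction l as [|a l IH]; unfold Cprod; simpl; [apply CD_const|].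
  apply CD_mult; auto.
Qed.

Lemma Cprod_conj f l : Cconj (Cprod f l) = Cprod (fun j => Cconj (f j)) l.
Proof.
  induction l as [|a l IH]; unfold Cprod; simpl; [apply Cconj_RtoC|].
  rewrite Cmult_conj. f_equal. exact IH.
Qed.

Lemma Cprod_ext f g l : (forall j, f j = g j) -> Cprod f l = Cprod g l.
Proof. intros H. unfold Cprod. f_equal. apply map_ext. auto. Qed.

Lemma Cprod_remove f n l : NoDup l -> In n l ->
  Cprod f l = (f n * Cprod f (filter (fun j => negb (Nat.eqb j n)) l))%C.
Proof.
  induction l as [|a l IH]; intros HN Hin; [destruct Hin|].
  inversion_clear HN as [|? ? Ha Hl]. simpl filter.
  destruct (Nat.eqb_spec a n) as [->|n0]; simpl.
  - unfold Cprod at 1. simpl. f_equal. f_equal.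
    clear -Ha. induction l as [|b l IH]; simpl; auto.
    destruct (Nat.eqb_spec b n) as [->|nb]; simpl.
    + exfalso. apply Ha. simpl; auto.
    + unfold Cprod. simpl. f_equal. apply IH. intros H. apply Ha. simpl; auto.
  - destruct Hin as [E|Hin]; [contradiction|]. unfold Cprod in *. simpl. rewrite IH by auto. ring.
Qed.

Lemma Cinv_neq_0 (z : C) : z <> 0 -> (/ z)%C <> 0.
Proof.
  intros Hz H0. assert (H1 : (z * / z)%C = 1%C) by (field; auto).
  rewrite H0, Cmult_0_r in H1. apply RtoC_inj in H1. lra.
Qed.

Lemma Cinv_0 : (/ 0)%C = 0%C.
Proof. apply injective_projections; simpl; unfold Rdiv; ring. Qed.

(** Since 0 has inverse 0, the law holds without side conditions and can be applied at the poles
    too. *)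
Lemma Cinv_mult (x y : C) : (/ (x * y))%C = (/ x * / y)%C.
Proof.
  destruct (Ceq_em x 0%C) as [->|Hx]; [rewrite Cmult_0_l, Cinv_0; ring|].
  destruct (Ceq_em y 0%C) as [->|Hy]; [rewrite Cmult_0_r, Cinv_0; ring|]. field. auto.
Qed.

Lemma Cinv_inv (x : C) : x <> 0 -> (/ / x)%C = x.
Proof. intros H. field. auto. Qed.

Lemma CD_Clim_punct f p : CD f p -> Clim (Cpunct p) f (f p).
Proof. intros H. apply Clim_Cpunct_of_near. apply CD_cont, H. Qed.

Lemma Cpunct_of_near p P : Cnear p P -> Cpunct p P.
Proof. intros (e & He & H). exists e; auto. Qed.

Lemma Clim_scal_0 p (f g : C -> C) (c : C) : (forall z, c * ((z - p) * f z) = (z - p) * g z)%C ->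
  Clim (Cpunct p) (fun z => (z - p) * f z)%C 0%C -> Clim (Cpunct p) (fun z => (z - p) * g z)%C 0%C.
Proof.
  intros H Hf. replace (RtoC 0) with (c * 0)%C by ring.
  refine (Clim_ext _ _ _ _ H _). auto with lim.
Qed.

(* Up to constants, the two functions in the conclusion are the entries of the
   row [(m1, m2)] times the interior factor. *)
Lemma pole_cancellation (p rho c kap : C) (m1 m2 N D Dn : C -> C) :
  (forall z, D z = (z - p) * Dn z)%C -> CD N p -> CD Dn p ->
  N p <> 0 -> Dn p <> 0 -> kap <> 0 -> c = (kap * (N p / Dn p))%C ->
  Clim (Cpunct p) (fun z => (z - p) * m1 z)%C rho -> Clim (Cpunct p) (fun z => c * m2 z)%C rho ->
  Clim (Cpunct p) (fun z => (z - p) * (m1 z - kap * (N z / D z) * m2 z))%C 0%C /\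
  Clim (Cpunct p) (fun z => (z - p) * (m1 z * (D z / N z) + kap * m2 z))%C 0%C.
Proof.
  intros HD CN CDn HN0 HD0 Hk Hc L1 L2.
  assert (Hi : (/ Dn p)%C <> 0) by (apply Cinv_neq_0; auto).
  assert (Hc0 : c <> 0) by (rewrite Hc; repeat apply Cmult_neq_0; auto).
  assert (L3 : Clim (Cpunct p) m2 (/ c * rho)%C).
  { clim_ext (fun z => / c * (c * m2 z))%C; [intros z; field; auto | auto with lim]. }
  assert (LN : Clim (Cpunct p) N (N p)) by (apply CD_Clim_punct; auto).
  assert (LDn : Clim (Cpunct p) Dn (Dn p)) by (apply CD_Clim_punct; auto).
  assert (Lz : Clim (Cpunct p) (fun z => z - p)%C (p - p)%C).
  { apply (CD_Clim_punct (fun z => z - p)%C). auto with lim. }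
  assert (NZ : Cpunct p (fun z => z <> p /\ Dn z <> 0 /\ N z <> 0)).
  { apply filter_and; [exists 1; split; [lra | auto]|].
    apply filter_and; apply Cpunct_of_near, Ccont_neq_0, HD0 || apply Cpunct_of_near, Ccont_neq_0, HN0;
    apply CD_cont; auto. }
  split.
  - clim_ext_near (fun z => (z - p) * m1 z - kap * (N z * / Dn z) * m2 z)%C.
    + revert NZ. apply filter_imp. intros z (Hz & H1 & H2). rewrite HD.
      apply Csub_neq in Hz. field. auto.
    + replace (RtoC 0) with (rho - kap * (N p * / Dn p) * (/ c * rho))%C.
      * auto 10 with lim.
      * rewrite Hc. field. auto.
  - clim_ext_near (fun z => ((z - p) * m1 z) * (((z - p) * Dn z) * / N z) + kap * ((z - p) * m2 z))%C.
    + revert NZ. apply filter_imp. intros z (Hz & H1 & H2). rewrite HD. field. auto.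
    + replace (RtoC 0) with (rho * (((p - p) * Dn p) * / N p) + kap * ((p - p) * (/ c * rho)))%C.
      * auto 10 with lim.
      * field. auto.
Qed.

(** * The soliton problem with its poles removed inside a circle *)

Section Soliton.

Variables (N : nat) (st : nat -> R) (c : nat -> C) (Mf : C -> M2) (k : R) (kappa : C) (E : C -> C) (wt : C).
Hypotheses (Hst : forall n, (n < N)%nat -> 0 < st n < k)
  (Hinj : forall n m, (n < N)%nat -> (m < N)%nat -> st n = st m -> n = m)
  (Hk : 0 < k)
  (Hkap : (kappa * kappa)%C = (-1)%C) (Hkapc : Cconj kappa = (- kappa)%C)
  (HED : forall z, CD E z) (HE0 : forall z, E z <> 0)
  (HEc : forall z, Cconj (E z) = (/ E (Cconj z))%C)
  (Hc : forall n, (n < N)%nat -> c n = (kappa * (E (Ci * RtoC (st n)) *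
     (Cprod (fun j => Ci * RtoC (st n) + Ci * RtoC (st j)) (seq 0 N) /
      Cprod (fun j => Ci * RtoC (st n) - Ci * RtoC (st j))
        (filter (fun j => negb (Nat.eqb j n)) (seq 0 N)))))%C)
  (HM : soliton_RHP N st c Mf)
  (Hwt : filterlim (fun z => (z * m12 (Mf z))%C) Cinfty (locally wt)).

Definition bnum (z : C) : C := Cprod (fun j => z + Ci * RtoC (st j))%C (seq 0 N).
Definition bden (z : C) : C := Cprod (fun j => z - Ci * RtoC (st j))%C (seq 0 N).
Definition gsol (z : C) : C := (E (RtoC k * z) * (bnum (RtoC k * z) / bden (RtoC k * z)))%C.

Let poles : list C := map (fun n => Ci * RtoC (st n))%C (seq 0 N) ++ map (fun n => - (Ci * RtoC (st n)))%C (seq 0 N).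
Let others n := filter (fun j => negb (Nat.eqb j n)) (seq 0 N).

Lemma in_poles z : In z poles <-> is_pole N st z.
Proof.
  unfold poles, is_pole. rewrite in_app_iff, !in_map_iff. split.
  - intros [(n & H1 & H2)|(n & H1 & H2)]; apply in_seq in H2; exists n; split; auto; lia.
  - intros (n & H1 & [H2|H2]); [left | right]; exists n; rewrite in_seq; split; auto; lia.
Qed.

Lemma Ci_st_inj a b : (Ci * RtoC a)%C = (Ci * RtoC b)%C -> a = b.
Proof. intros H. apply (f_equal snd) in H. simpl in H. lra. Qed.

Lemma Ci_st_pos a b : 0 < a -> 0 < b -> (Ci * RtoC a + Ci * RtoC b)%C <> 0.
Proof. intros Ha Hb H. apply (f_equal snd) in H. simpl in H. lra. Qed.

Lemma bden_neq_0 z : ~ is_pole N st z -> bden z <> 0.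
Proof.
  intros Hz. apply Cprod_neq_0. intros j Hj H0. apply Hz. apply in_seq in Hj.
  exists j. split; [lia|]. left.
  replace z with (z - Ci * RtoC (st j) + Ci * RtoC (st j))%C by ring. rewrite H0. ring.
Qed.

Lemma bnum_neq_0 z : ~ is_pole N st z -> bnum z <> 0.
Proof.
  intros Hz. apply Cprod_neq_0. intros j Hj H0. apply Hz. apply in_seq in Hj.
  exists j. split; [lia|]. right.
  replace z with (z + Ci * RtoC (st j) - Ci * RtoC (st j))%C by ring. rewrite H0. ring.
Qed.

Lemma CD_shift_minus (a z : C) : CD (fun z => z - a)%C z.
Proof. auto with lim. Qed.

Lemma CD_shift_plus (a z : C) : CD (fun z => z + a)%C z.
Proof. auto with lim. Qed.

Lemma CD_bnum z : CD bnum z.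
Proof. apply (Cprod_CD (fun j z => z + Ci * RtoC (st j))%C). intros; apply CD_shift_plus. Qed.

Lemma CD_bden z : CD bden z.
Proof. apply (Cprod_CD (fun j z => z - Ci * RtoC (st j))%C). intros; apply CD_shift_minus. Qed.

(** These entries are the exterior row (m11, -kappa m12) times the inverse jump matrix isq2 ((1,
    -1/g), (g, 1)). Conjugation by diag(kappa, 1) divides m12 by kappa, which is multiplication by
    -kappa since kappa^2 = -1. *)
Let inner1 z := (isq2 * (m11 (Mf z) - kappa * (E z * bnum z / bden z) * m12 (Mf z)))%C.
Let inner2 z := (- isq2 * (m11 (Mf z) * (bden z / (E z * bnum z)) + kappa * m12 (Mf z)))%C.

Lemma others_spec n j : In j (others n) -> (j < N)%nat /\ n <> j.
Proof.
  intros H. apply filter_In in H as [H1 H2]. apply in_seq in H1.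
  apply Bool.negb_true_iff, Nat.eqb_neq in H2. split; [lia | congruence].
Qed.

Lemma kappa_neq_0 : kappa <> 0.
Proof. intros H. rewrite H, Cmult_0_r in Hkap. apply RtoC_inj in Hkap. lra. Qed.

(** At an upper pole m11 has residue c m12, and c is kappa times the residue of g, so the singular
    parts cancel in m11 - kappa g m12; in the second entry 1/g vanishes at the pole. *)
Lemma inner_upper n : (n < N)%nat -> let p := (Ci * RtoC (st n))%C in
  Clim (Cpunct p) (fun z => (z - p) * inner1 z)%C 0%C /\
  Clim (Cpunct p) (fun z => (z - p) * inner2 z)%C 0%C.
Proof.
  intros Hn p. destruct HM as (_ & HR & _ & _). destruct (HR n Hn) as (Res & R1 & R2). fold p in R1, R2.
  apply (M2lim_Clim _ _ _ (Cpunct_filter p)) in R1, R2. destruct R1 as (R1 & _). destruct R2 as (R2 & _).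
  simpl in R1, R2.
  set (Dn := fun z => Cprod (fun j => z - Ci * RtoC (st j))%C (others n)).
  destruct (pole_cancellation p (m11 Res) (c n) kappa (fun z => m11 (Mf z)) (fun z => m12 (Mf z))
    (fun z => E z * bnum z)%C bden Dn) as [L1 L2].
  - intros z. apply (Cprod_remove (fun j => z - Ci * RtoC (st j))%C n); [apply seq_NoDup | apply in_seq; lia].
  - apply CD_mult; auto. apply CD_bnum.
  - apply (Cprod_CD (fun j z => z - Ci * RtoC (st j))%C). intros; apply CD_shift_minus.
  - apply Cmult_neq_0; auto. apply Cprod_neq_0. intros j Hj. apply in_seq in Hj.
    apply Ci_st_pos; apply Hst; lia.
  - apply Cprod_neq_0. intros j Hj H0. apply others_spec in Hj as [Hj Hjn]. apply Hjn.
    apply Hinj; auto. apply Ci_st_inj. unfold p in H0.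
    replace (Ci * RtoC (st n))%C with (Ci * RtoC (st n) - Ci * RtoC (st j) + Ci * RtoC (st j))%C by ring.
    rewrite H0. ring.
  - apply kappa_neq_0.
  - rewrite Hc by auto. fold p. unfold Dn, bnum, others, Cdiv. ring.
  - exact R1.
  - refine (Clim_ext _ _ _ _ _ R2). intros z. ring.
  - split.
    + apply Clim_scal_0 with (c := isq2) (2 := L1). intros z. unfold inner1. ring.
    + apply Clim_scal_0 with (c := (- isq2)%C) (2 := L2). intros z. unfold inner2. ring.
Qed.

(** At a lower pole the columns exchange roles and g is replaced by 1/g. By conj kappa = -kappa the
    constant -conj(c n) is again kappa times a residue, now of 1/g, and multiplication by -kappa
    with kappa^2 = -1 turns the two resulting combinations into the entries [inner2] and
    [inner1]. *)
Lemma inner_lower n : (n < N)%nat -> let p := (- (Ci * RtoC (st n)))%C in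
  Clim (Cpunct p) (fun z => (z - p) * inner1 z)%C 0%C /\
  Clim (Cpunct p) (fun z => (z - p) * inner2 z)%C 0%C.
Proof.
  intros Hn p. destruct HM as (_ & _ & HR & _). destruct (HR n Hn) as (Res & R1 & R2). fold p in R1, R2.
  apply (M2lim_Clim _ _ _ (Cpunct_filter p)) in R1, R2. destruct R1 as (_ & R1 & _). destruct R2 as (_ & R2 & _).
  simpl in R1, R2.
  set (Nn := fun z => Cprod (fun j => z + Ci * RtoC (st j))%C (others n)).
  assert (Nn0 : Nn p <> 0).
  { apply Cprod_neq_0. intros j Hj H0. apply others_spec in Hj as [Hj Hjn]. apply Hjn.
    apply Hinj; auto. apply Ci_st_inj. unfold p in H0.
    replace (Ci * RtoC (st n))%C with (Ci * RtoC (st j) - (- (Ci * RtoC (st n)) + Ci * RtoC (st j)))%C by ring.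
    rewrite H0. ring. }
  assert (conj_st : forall x, Cconj (Ci * RtoC x) = (- (Ci * RtoC x))%C).
  { intros x. apply injective_projections; simpl; ring. }
  destruct (pole_cancellation p (m12 Res) (- Cconj (c n))%C kappa (fun z => m12 (Mf z)) (fun z => m11 (Mf z))
    (fun z => bden z / E z)%C bnum Nn) as [L1 L2]; auto.
  - intros z. replace (z - p)%C with (z + Ci * RtoC (st n))%C by (unfold p; ring).
    apply (Cprod_remove (fun j => z + Ci * RtoC (st j))%C); [apply seq_NoDup | apply in_seq; lia].
  - apply CD_mult; [apply CD_bden | apply CD_inv; auto].
  - apply (Cprod_CD (fun j z => z + Ci * RtoC (st j))%C). intros; apply CD_shift_plus.
  - apply Cmult_neq_0; [|apply Cinv_neq_0; auto]. apply Cprod_neq_0. intros j Hj H0. apply in_seq in Hj.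
    apply (Ci_st_pos (st n) (st j)); try (apply Hst; lia).
    replace (Ci * RtoC (st n) + Ci * RtoC (st j))%C with (- (p - Ci * RtoC (st j)))%C by (unfold p; ring).
    rewrite H0. ring.
  - apply kappa_neq_0.
  - rewrite Hc by auto. rewrite !Cmult_conj, Hkapc, HEc, conj_st. fold p. unfold Cdiv. rewrite Cmult_conj.
    match goal with |- context [Cconj (/ ?x)] => set (y := x) end.
    assert (Ey : Cconj y = Nn p).
    { unfold y. rewrite Cprod_conj. apply Cprod_ext. intros j. rewrite Cminus_conj, !conj_st. unfold p. ring. }
    assert (Hy : y <> 0). { intros H0. apply Nn0. rewrite <- Ey, H0. apply Cconj_RtoC. }
    rewrite Cinv_conj, Ey, Cprod_conj by auto.
    replace (bden p) with (Cprod (fun j => Cconj (Ci * RtoC (st n) + Ci * RtoC (st j))) (seq 0 N)).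
    + ring.
    + apply Cprod_ext. intros j. rewrite Cplus_conj, !conj_st. unfold p. ring.
  - refine (Clim_ext _ _ _ _ _ R1). intros z. unfold p. ring.
  - refine (Clim_ext _ _ _ _ _ R2). intros z. ring.
  - split.
    + apply Clim_scal_0 with (c := (- (isq2 * kappa))%C) (2 := L2). intros z. unfold inner1, Cdiv.
      rewrite Cinv_mult, (Cinv_inv (E z)) by auto.
      transitivity ((z - p) * isq2 * (- (kappa * kappa) * m11 (Mf z) - kappa * (E z * bnum z * / bden z) * m12 (Mf z)))%C;
      [ring | rewrite Hkap; ring].
    + apply Clim_scal_0 with (c := (- (isq2 * kappa))%C) (2 := L1). intros z. unfold inner2, Cdiv.
      rewrite Cinv_mult.
      transitivity ((z - p) * isq2 * (kappa * kappa * (m11 (Mf z) * (bden z * (/ E z * / bnum z))) - kappa * m12 (Mf z)))%C;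
      [ring | rewrite Hkap; ring].
Qed.

(** All poles lie within modulus [k], so after scaling by [k] the corrected row extends to the disc
    and the original row is analytic outside. The factor in the last limit comes from the scaling
    and from the conjugation by kappa. *)
Lemma soliton_row : exists a1 a2 b1 b2,
  row_sol gsol a1 a2 b1 b2 /\ b1 0%C = 1%C /\ b2 0%C = 0%C /\
  Clim (Cpunct 0%C) (fun z => b2 z / z)%C (Cconj (- kappa * wt / RtoC k)%C).
Proof.
  assert (Hkn : RtoC k <> 0) by (apply RtoC_neq_0; lra).
  destruct HM as (Hholo & _ & _ & Hinf).
  apply (M2lim_Clim _ _ _ Cinfty_filter) in Hinf. destruct Hinf as (I1 & I2 & _). simpl in I1, I2.
  pose proof (Clim_of_filterlim Cinfty _ _ Hwt) as Hw.
  assert (HD : forall z, ~ is_pole N st z -> CD (fun w => m11 (Mf w)) z /\ CD (fun w => m12 (Mf w)) z).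
  { intros z Hz. destruct (M2holo_CD _ _ (Hholo z Hz)) as (H1 & H2 & _). auto. }
  assert (HG : forall z, ~ is_pole N st z -> CD (fun z => / bden z)%C z /\ CD (fun z => / (E z * bnum z))%C z).
  { intros z Hz. split.
    - apply CD_inv; [apply bden_neq_0; auto | apply CD_bden].
    - apply (CD_inv (fun z => E z * bnum z)%C).
      + apply Cmult_neq_0; auto. apply bnum_neq_0; auto.
      + apply CD_mult; auto. apply CD_bnum. }
  assert (CD1 : forall z, ~ is_pole N st z -> CD inner1 z).
  { intros z Hz. destruct (HD z Hz). destruct (HG z Hz). pose proof (CD_bnum z).
    unfold inner1, Cdiv. auto 10 with lim. }
  assert (CD2 : forall z, ~ is_pole N st z -> CD inner2 z).
  { intros z Hz. destruct (HD z Hz). destruct (HG z Hz). pose proof (CD_bden z).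
    unfold inner2, Cdiv. auto 10 with lim. }
  assert (sc : forall f z, CD f (RtoC k * z)%C -> CD (fun z => f (RtoC k * z)%C) z).
  { intros f z H. apply (CD_comp (fun z => RtoC k * z)%C f); auto.
    auto with lim. }
  assert (pole_small : forall z, is_pole N st z -> Cmod z < k).
  { intros z (n & Hn & [->| ->]); rewrite ?Cmod_opp, Cmod_mult, Cmod_Ci, Cmod_R, Rabs_pos_eq;
    pose proof (Hst n Hn); lra. }
  set (l := map (fun z => z / RtoC k)%C poles).
  assert (Hl : forall z, In z l <-> is_pole N st (RtoC k * z)%C).
  { intros z. unfold l. rewrite in_map_iff, <- in_poles. split.
    - intros (y & <- & Hy). replace (RtoC k * (y / RtoC k))%C with y by (field; auto). auto.
    - intros H. exists (RtoC k * z)%C. split; auto. field; auto. }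
  assert (l_small : forall z, In z l -> Cmod z < 1).
  { intros z Hz. apply Hl, pole_small in Hz. rewrite Cmod_mult, Cmod_R, Rabs_pos_eq in Hz by lra. nra. }
  assert (IN : forall p, is_pole N st p -> Clim (Cpunct p) (fun z => (z - p) * inner1 z)%C 0%C /\
     Clim (Cpunct p) (fun z => (z - p) * inner2 z)%C 0%C).
  { intros p (n & Hn & [->| ->]); [apply inner_upper | apply inner_lower]; auto. }
  assert (EXT : forall f : C -> C, (forall z, ~ is_pole N st z -> CD f z) ->
     (forall p, is_pole N st p -> Clim (Cpunct p) (fun z => (z - p) * f z)%C 0%C) ->
     exists F : C -> C, disc_fun F /\ forall z, Cmod z = 1 -> F z = f (RtoC k * z)%C).
  { intros f Hf Hp. destruct (disc_of_removable (fun z => f (RtoC k * z)%C) l) as (F & HF & HFe).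
    - intros p Hpl. split; [apply l_small; auto|]. apply Hl in Hpl. specialize (Hp _ Hpl).
      apply (Clim_punct_affine _ (RtoC k * p)%C p (RtoC k)) in Hp; auto. cbv beta in Hp.
      replace (RtoC 0) with (/ RtoC k * 0)%C by ring.
      clim_ext (fun z => / RtoC k * ((RtoC k * p + RtoC k * (z - p) - RtoC k * p) * f (RtoC k * p + RtoC k * (z - p))))%C.
      + intros z. replace (RtoC k * p + RtoC k * (z - p))%C with (RtoC k * z)%C by ring. field. auto.
      + auto with lim.
    - intros z Hz Hzl. apply sc, Hf. rewrite <- Hl. auto.
    - exists F; split; auto. intros z Hz. apply HFe. intros H. apply l_small in H. lra. }
  destruct (EXT inner1 CD1) as (a1 & Da1 & Ea1); [intros; apply IN; auto|].
  destruct (EXT inner2 CD2) as (a2 & Da2 & Ea2); [intros; apply IN; auto|].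
  assert (np : forall z, 1 <= Cmod z -> ~ is_pole N st (RtoC k * z)%C).
  { intros z Hz H. apply pole_small in H. rewrite Cmod_mult, Cmod_R, Rabs_pos_eq in H by lra. nra. }
  assert (IS : forall (f : C -> C) L, Clim Cinfty f L -> Clim Cinfty (fun z => f (RtoC k * z)%C) L).
  { intros f L Hf e He. destruct (Hf e He) as (B & HB). exists (B / k). intros z Hz. apply HB.
    rewrite Cmod_mult, Cmod_R, Rabs_pos_eq by lra.
    apply Rmult_lt_compat_l with (r := k) in Hz; auto.
    replace (k * (B / k)) with B in Hz by (field; lra). exact Hz. }
  assert (OUT : forall f : C -> C, (forall z, ~ is_pole N st z -> CD f z) ->
     forall z, Cmod z = 1 -> Clim (Cfrom_out z) (fun z => f (RtoC k * z)%C) (f (RtoC k * z)%C)).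
  { intros f Hf z Hz e He.
    assert (H : Ccont (fun z => f (RtoC k * z)%C) z) by (apply CD_cont, sc, Hf, np; lra).
    destruct (H e He) as (d & Hd & H1). exists d; auto. }
  set (f1 := fun z => m11 (Mf z)). set (f2 := fun z => (- kappa * m12 (Mf z))%C).
  assert (Hf1 : forall z, ~ is_pole N st z -> CD f1 z) by (intros z Hz; apply HD; auto).
  assert (Hf2 : forall z, ~ is_pole N st z -> CD f2 z).
  { intros z Hz. apply CD_mult; [apply CD_const | apply HD; auto]. }
  destruct (disc_reflect (fun z => f1 (RtoC k * z)%C) (fun z => f1 (RtoC k * z)%C) 1%C) as (b1 & Db1 & b10 & _ & Eb1);
    [intros z Hz; apply sc, Hf1, np; lra | apply IS; auto | apply OUT; auto |].
  destruct (disc_reflect (fun z => f2 (RtoC k * z)%C) (fun z => f2 (RtoC k * z)%C) 0%C) as (b2 & Db2 & b20 & Vb2 & Eb2);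
    [intros z Hz; apply sc, Hf2, np; lra | apply IS | apply OUT; auto |].
  { unfold f2. replace (RtoC 0) with (- kappa * 0)%C by ring. auto with lim. }
  rewrite Cconj_RtoC in b10, b20.
  exists a1, a2, b1, b2. split; [|split; [auto | split; [auto|]]].
  - split; [auto|]. split; [auto|]. split; [auto|]. split; [auto|]. intros z Hz.
    rewrite Eb1, Eb2, Ea1, Ea2 by auto. unfold inner1, inner2, f1, f2.
    assert (Hnp : ~ is_pole N st (RtoC k * z)%C) by (apply np; lra).
    pose proof (bden_neq_0 _ Hnp). pose proof (bnum_neq_0 _ Hnp). pose proof (HE0 (RtoC k * z)%C).
    unfold gsol.
    assert (E2 : (2 * (isq2 * isq2))%C = 1%C) by (rewrite isq2_sq; field).
    split.
    + transitivity (2 * (isq2 * isq2) * m11 (Mf (RtoC k * z)))%C; [rewrite E2; ring | field; auto].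
    + transitivity (2 * (isq2 * isq2) * (- kappa * m12 (Mf (RtoC k * z))))%C; [rewrite E2; ring | field; auto].
  - apply reflect_limit with (fun z => f2 (RtoC k * z)%C); auto.
    clim_ext (fun z => - kappa * / RtoC k * ((RtoC k * z) * m12 (Mf (RtoC k * z))))%C;
      [intros z; unfold f2; field; auto |].
    replace (- kappa * wt / RtoC k)%C with (- kappa * / RtoC k * wt)%C by (unfold Cdiv; ring).
    pose proof (IS (fun z => z * m12 (Mf z))%C _ Hw). auto with lim.
Qed.

End Soliton.

(** * Klaus-Shaw potentials *)

Lemma RInt_Chasles_R (f : R -> R) (a b c : R) : ex_RInt f a b -> ex_RInt f b c ->
  RInt f a c = RInt f a b + RInt f b c.
Proof. intros H1 H2. symmetry. apply (RInt_Chasles f a b c); auto. Qed.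

Lemma RInt_const_R (a b c : R) : RInt (fun _ => c) a b = c * (b - a).
Proof. rewrite RInt_const. unfold scal; simpl; unfold mult; simpl. ring. Qed.

(* [F] is nonincreasing with [F (s j) = (j + 1/2) h], so summing its integrals
   between consecutive [s j] is an Abel summation of [h * sum_j s j]. *)
Lemma monotone_quantile_sum (F : R -> R) (T h : R) (s : nat -> R) (N : nat) :
  (1 <= N)%nat -> 0 < h ->
  (forall a b, 0 <= a -> a <= b -> b <= T -> ex_RInt F a b) ->
  (forall x y, 0 < x -> x <= y -> y < T -> F y <= F x) ->
  (forall x, 0 < x < T -> 0 <= F x <= INR N * h) ->
  (forall j, (j < N)%nat -> 0 < s j < T /\ F (s j) = (INR j + / 2) * h) ->
  Rabs (RInt F 0 T - h * sum_n s (pred N)) <= h * T.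
Proof.
  intros HN Hh Hex Hmon Hbd Hs.
  assert (Hdec : forall j, (S j < N)%nat -> s (S j) < s j).
  { intros j Hj. destruct (Hs j) as [[A1 A2] A3]; [lia|]. destruct (Hs (S j) Hj) as [[B1 B2] B3].
    destruct (Rlt_dec (s (S j)) (s j)) as [Hl|Hl]; auto.
    assert (F (s (S j)) <= F (s j)) by (apply Hmon; lra). rewrite A3, B3, S_INR in H. nra. }
  assert (Hint : forall a b m M, 0 <= a -> a <= b -> b <= T ->
     (forall x, a < x < b -> m <= F x <= M) -> m * (b - a) <= RInt F a b <= M * (b - a)).
  { intros a b m M Ha Hab HbT Hm.
    rewrite <- !RInt_const_R. split; apply RInt_le; auto using ex_RInt_const; apply Hm. }
  assert (Hch : forall a b c, 0 <= a -> a <= b -> b <= c -> c <= T -> RInt F a c = RInt F a b + RInt F b c).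
  { intros a b c H1 H2 H3 H4. apply RInt_Chasles_R; apply Hex; lra. }
  (* Abel summation down from [T]: between s_(k+1) and s_k the value of F is within h/2 of (k+1) h,
     and (k+1) h (s_k - s_(k+1)) is exactly the increment of the subtracted term. *)
  assert (D : forall k, (k < N)%nat ->
     Rabs (RInt F (s k) T - h * (sum_n s k - (INR k + 1) * s k)) <= h / 2 * (T - s k)).
  { induction k as [|k IH]; intros Hk.
    - destruct (Hs 0%nat Hk) as [A B]. rewrite sum_O. simpl INR.
      assert (H := Hint (s 0%nat) T 0 (h / 2) ltac:(lra) ltac:(lra) ltac:(lra)).
      assert (0 * (T - s 0%nat) <= RInt F (s 0%nat) T <= h / 2 * (T - s 0%nat)).
      { apply H. intros x Hx. split; [apply Hbd; lra|].
        replace (h / 2) with (F (s 0%nat)) by (rewrite B; simpl; field). apply Hmon; lra. }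
      replace (h * (s 0%nat - (0 + 1) * s 0%nat)) with 0 by ring.
      apply Rabs_le. lra.
    - specialize (IH ltac:(lia)). destruct (Hs k ltac:(lia)) as [A A']. destruct (Hs (S k) Hk) as [B B'].
      pose proof (Hdec k Hk) as Hd. rewrite (Hch (s (S k)) (s k) T) by lra.
      replace (sum_n s (S k)) with (sum_n s k + s (S k)) by (rewrite sum_Sn; reflexivity).
      assert (H := Hint (s (S k)) (s k) ((INR k + / 2) * h) ((INR k + 1 + / 2) * h) ltac:(lra) ltac:(lra) ltac:(lra)).
      assert (H1 : (INR k + / 2) * h * (s k - s (S k)) <= RInt F (s (S k)) (s k) <= (INR k + 1 + / 2) * h * (s k - s (S k))).
      { apply H. intros x Hx. rewrite <- A'. rewrite S_INR in B'. rewrite <- B'. split; apply Hmon; lra. }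
      rewrite S_INR. set (sg := sum_n s k) in *.
      apply Rabs_le_between in IH. apply Rabs_le. nra. }
  destruct (Hs (pred N) ltac:(lia)) as [A A'].
  specialize (D (pred N) ltac:(lia)).
  assert (EN : INR N = INR (pred N) + 1).
  { rewrite <- S_INR. f_equal. lia. }
  rewrite (Hch 0 (s (pred N)) T) by lra.
  assert (H := Hint 0 (s (pred N)) ((INR (pred N) + / 2) * h) (INR N * h) ltac:(lra) ltac:(lra) ltac:(lra)).
  assert (H1 : (INR (pred N) + / 2) * h * (s (pred N) - 0) <= RInt F 0 (s (pred N)) <= INR N * h * (s (pred N) - 0)).
  { apply H. intros x Hx. split; [rewrite <- A'; apply Hmon; lra | apply Hbd; lra]. }
  rewrite EN in H1. set (sg := sum_n s (pred N)) in *.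
  apply Rabs_le_between in D. apply Rabs_le. nra.
Qed.

Section KlausShaw.

Variables (A : R -> R) (Xm Xp x0 : R) (xm xp : R -> R).
Hypothesis hKS : semicircular_KS A Xm Xp x0 xm xp.

Lemma KS_continuous x : continuous A x.
Proof.
  destruct hKS as (HX & _ & Hout & (u & c & Hc & Hu & (U & g & _ & HU & Hg & Hgu)) & _).
  destruct (Rlt_dec x Xm) as [H1|H1]; [|destruct (Rlt_dec Xp x) as [H2|H2]].
  - apply continuous_ext_loc with (fun _ => 0); [|apply continuous_const].
    assert (P : 0 < Xm - x) by lra. exists (mkposreal _ P). intros y Hy. symmetry. apply Hout. left.
    change (Rabs (y - x) < Xm - x) in Hy. apply Rabs_def2 in Hy. lra.
  - apply continuous_ext_loc with (fun _ => 0); [|apply continuous_const].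
    assert (P : 0 < x - Xp) by lra. exists (mkposreal _ P). intros y Hy. symmetry. apply Hout. right.
    change (Rabs (y - x) < x - Xp) in Hy. apply Rabs_def2 in Hy. lra.
  (* Off [Xm, Xp] the radicand is nonpositive and [sqrt] returns 0, so one formula represents [A] on
     the whole line, and continuity at the edges needs no case distinction. *)
  - apply continuous_ext with (fun y => mult (fst (g (RtoC y))) (sqrt ((Xp - y) * (y - Xm)))).
    + intros y. unfold mult; simpl.
      destruct (Rlt_dec y Xm) as [H3|H3]; [|destruct (Rlt_dec Xp y) as [H4|H4]].
      * rewrite Hout, sqrt_neg_0 by (auto; nra). ring.
      * rewrite Hout, sqrt_neg_0 by (auto; nra). ring.
      * destruct (Hu y ltac:(lra)) as [_ ->]. rewrite Hgu by lra. reflexivity.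
    + apply (continuous_mult (fun y => fst (g (RtoC y))) (fun y => sqrt ((Xp - y) * (y - Xm)))).
      * apply (RC_fst (fun y => g (RtoC y))). apply (RC_comp g RtoC).
        -- apply (RC_pair (fun y => y) (fun _ => 0)); [apply continuous_id | apply continuous_const].
        -- apply CD_cont, CD_of_ex_derive, Hg, HU. lra.
      * apply continuous_sqrt_comp.
        apply (continuous_mult (fun y => Xp - y) (fun y => y - Xm)).
        -- apply (continuous_minus (fun _ => Xp) (fun y => y)); [apply continuous_const | apply continuous_id].
        -- apply (continuous_minus (fun y => y) (fun _ => Xm)); [apply continuous_id | apply continuous_const].
Qed.

(** The phase integral over a fixed interval: beyond the turning points the radicand is nonpositive
    and [sqrt] returns 0. With fixed limits, monotonicity in [s] can be read off the integrand. *)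
Definition PhiT (s : R) : R := RInt (fun x => sqrt (A x ^ 2 - s ^ 2)) Xm Xp.

Lemma cont_radicand s x : continuous (fun x => sqrt (A x ^ 2 - s ^ 2)) x.
Proof.
  apply continuous_sqrt_comp.
  apply (continuous_minus (fun x => A x ^ 2) (fun _ => s ^ 2)); [|apply continuous_const].
  apply continuous_ext with (fun x => mult (A x) (A x)); [intros; unfold mult; simpl; ring|].
  apply (continuous_mult A A); apply KS_continuous.
Qed.

Lemma ex_RInt_radicand s a b : ex_RInt (fun x => sqrt (A x ^ 2 - s ^ 2)) a b.
Proof. apply (@ex_RInt_continuous R_CompleteNormedModule). intros; apply cont_radicand. Qed.

Lemma KS_interval : Xm < Xp.
Proof. apply hKS. Qed.

Lemma KS_support x : 0 < A x -> Xm <= x <= Xp.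
Proof.
  destruct hKS as (_ & _ & Hout & _). intros H.
  destruct (Rlt_dec x Xm); [rewrite Hout in H; [lra|auto]|].
  destruct (Rlt_dec Xp x); [rewrite Hout in H; [lra|auto]|]. lra.
Qed.

(** A larger value beyond a turning point would, by the intermediate value theorem from a zero of
    [A] off the support, produce a further solution of A = s. *)
Lemma KS_outside s x : 0 < s < A x0 -> x < xm s \/ xp s < x -> A x <= s.
Proof.
  intros Hs Hx. destruct hKS as (HX & _ & Hout & _ & _ & _ & _ & _ & _ & Hr).
  destruct (Hr s Hs) as (R1 & _ & _ & R4).
  destruct (Rle_lt_dec (A x) s) as [H|H]; auto. exfalso.
  assert (Hxs : Xm <= x <= Xp) by (apply KS_support; lra).
  assert (HA : continuity A) by (intros y; apply continuity_pt_filterlim, KS_continuous).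
  destruct Hx as [Hx|Hx].
  - destruct (IVT_gen A (Xm - 1) x s HA) as (y & Hy & Ey).
    + rewrite (Hout (Xm - 1)) by lra. rewrite Rmin_left, Rmax_right; lra.
    + rewrite Rmin_left, Rmax_right in Hy by lra. destruct (R4 y Ey); lra.
  - destruct (IVT_gen A x (Xp + 1) s HA) as (y & Hy & Ey).
    + rewrite (Hout (Xp + 1)) by lra. rewrite Rmin_right, Rmax_left; lra.
    + rewrite Rmin_left, Rmax_right in Hy by lra. destruct (R4 y Ey); lra.
Qed.

Lemma Phi_is_PhiT s : 0 < s < A x0 -> Phi_is A xm xp s = PhiT s.
Proof.
  intros Hs. assert (hK := hKS). destruct hK as (HX & Hpos & Hout & _ & _ & _ & _ & _ & _ & Hr).
  destruct (Hr s Hs) as (R1 & R2 & R3 & _).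
  pose proof (KS_support (xm s) ltac:(lra)) as B1. pose proof (KS_support (xp s) ltac:(lra)) as B2.
  unfold Phi_is, PhiT.
  assert (Z : forall a b, a <= b -> (forall x, a < x < b -> x < xm s \/ xp s < x) ->
     RInt (fun x => sqrt (A x ^ 2 - s ^ 2)) a b = 0).
  { intros a b Hab H. rewrite (RInt_ext _ (fun _ => 0)).
    - rewrite RInt_const_R. apply Rmult_0_l.
    - rewrite Rmin_left, Rmax_right by auto. intros x Hx. apply sqrt_neg_0.
      pose proof (KS_outside s x Hs (H x Hx)). specialize (Hpos x). nra. }
  rewrite (RInt_Chasles_R _ Xm (xm s) Xp) by apply ex_RInt_radicand.
  rewrite (RInt_Chasles_R _ (xm s) (xp s) Xp) by apply ex_RInt_radicand.
  rewrite (Z Xm (xm s)), (Z (xp s) Xp) by (intros; lra).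
  rewrite Rplus_0_l, Rplus_0_r. reflexivity.
Qed.

Lemma PhiT_antitone s s' : 0 <= s -> s <= s' -> PhiT s' <= PhiT s.
Proof.
  intros Hs Hss. unfold PhiT. pose proof KS_interval.
  apply RInt_le; try apply ex_RInt_radicand; [lra|].
  intros x _. apply sqrt_le_1_alt. nra.
Qed.

Lemma PhiT_ge_0 s : 0 <= PhiT s.
Proof.
  pose proof KS_interval. apply RInt_ge_0; try apply ex_RInt_radicand; [lra|]. intros; apply sqrt_pos.
Qed.

Lemma PhiT_0 : PhiT 0 = RInt A Xm Xp.
Proof.
  destruct hKS as (_ & Hpos & _). apply RInt_ext. intros x _.
  replace (A x ^ 2 - 0 ^ 2) with (A x ^ 2) by ring. apply sqrt_pow2. auto.
Qed.

Lemma ex_RInt_A a b : ex_RInt A a b.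
Proof. apply (@ex_RInt_continuous R_CompleteNormedModule). intros; apply KS_continuous. Qed.

(** The square root dominates A - s pointwise. With monotonicity this squeezes the phase integral to
    its value at s = 0. *)
Lemma PhiT_lower s : 0 <= s -> RInt A Xm Xp - s * (Xp - Xm) <= PhiT s.
Proof.
  intros Hs. destruct hKS as (HX & Hpos & _).
  assert (E : RInt (fun x => A x - s) Xm Xp = RInt A Xm Xp - s * (Xp - Xm)).
  { etransitivity; [apply (RInt_minus A (fun _ => s)); [apply ex_RInt_A | apply ex_RInt_const]|].
    rewrite RInt_const_R. reflexivity. }
  rewrite <- E. apply RInt_le; [lra| | apply ex_RInt_radicand |].
  - apply (ex_RInt_minus A (fun _ => s)); [apply ex_RInt_A | apply ex_RInt_const].
  - intros x _. destruct (Rle_dec (A x) s) as [H|H].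
    + pose proof (sqrt_pos (A x ^ 2 - s ^ 2)). lra.
    + rewrite <- (sqrt_pow2 (A x - s)) by lra. apply sqrt_le_1_alt. nra.
Qed.

Lemma RInt_gen_A : RInt_gen A (Rbar_locally m_infty) (Rbar_locally p_infty) = RInt A Xm Xp.
Proof.
  destruct hKS as (HX & _ & Hout & _).
  apply is_RInt_gen_unique. intros P HP.
  assert (H : forall a b, a < Xm -> Xp < b -> is_RInt A a b (RInt A Xm Xp)).
  { intros a b Ha Hb. replace (RInt A Xm Xp) with (RInt A a b).
    - apply (RInt_correct (V := R_CompleteNormedModule)), ex_RInt_A.
    - rewrite (RInt_Chasles_R A a Xm b), (RInt_Chasles_R A Xm Xp b) by apply ex_RInt_A.
      rewrite (RInt_ext A (fun _ => 0) a Xm), (RInt_ext A (fun _ => 0) Xp b).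
      + rewrite !RInt_const_R. rewrite !Rmult_0_l, Rplus_0_l, Rplus_0_r. reflexivity.
      + rewrite Rmin_left, Rmax_right by lra. intros x Hx. apply Hout. lra.
      + rewrite Rmin_left, Rmax_right by lra. intros x Hx. apply Hout. lra. }
  exists (fun a => a < Xm) (fun b => Xp < b).
  - exists Xm. auto.
  - exists Xp. auto.
  - intros a b Ha Hb. exists (RInt A Xm Xp). split; [apply H; auto|].
    apply (locally_singleton _ _ HP).
Qed.

Lemma RInt_A_pos : 0 < RInt A Xm Xp.
Proof.
  destruct hKS as (HX & _ & Hout & (u & c & Hc & Hu & _) & _).
  apply RInt_gt_0; auto.
  - intros x Hx. destruct (Hu x ltac:(lra)) as [H1 ->].
    apply Rmult_lt_0_compat; [lra|]. apply sqrt_lt_R0. nra.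
  - intros; apply KS_continuous.
Qed.

Lemma epsN_eq N : (1 <= N)%nat -> INR N * (epsN A N * PI) = RInt A Xm Xp.
Proof.
  intros HN. unfold epsN. rewrite RInt_gen_A. pose proof PI_RGT_0.
  apply le_INR in HN. simpl in HN. field. lra.
Qed.

Lemma epsN_pos N : (1 <= N)%nat -> 0 < epsN A N.
Proof.
  intros HN. pose proof (epsN_eq N HN). pose proof PI_RGT_0. pose proof RInt_A_pos.
  apply le_INR in HN. simpl in HN.
  destruct (Rle_lt_dec (epsN A N) 0) as [H3|H3]; auto. exfalso. 
  assert (epsN A N * PI <= 0) by nra. nra.
Qed.

Lemma epsN_small e : 0 < e -> exists N0, forall N, (N0 <= N)%nat -> (1 <= N)%nat /\ epsN A N <= e.
Proof.
  intros He. set (L := RInt A Xm Xp). pose proof PI_RGT_0 as HPI.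
  pose proof RInt_A_pos as HL. fold L in HL.
  destruct (INR_unbounded (L / (PI * e))) as [N0 HN0].
  exists (S N0). intros N HN. split; [lia|].
  assert (HN1 : (1 <= N)%nat) by lia. pose proof (epsN_eq N HN1) as E. fold L in E.
  pose proof (epsN_pos N HN1) as Pe.
  assert (H : INR N0 <= INR N) by (apply le_INR; lia).
  assert (H1 : L <= INR N * (e * PI)).
  { replace L with (L / (PI * e) * (e * PI)) by (field; lra). apply Rmult_le_compat_r; nra. }
  rewrite <- E in H1. apply le_INR in HN1. simpl in HN1.
  apply Rmult_le_reg_l in H1; [|lra]. apply Rmult_le_reg_r in H1; auto.
Qed.

End KlausShaw.

(** * Comparison of the jump functions *)

Lemma Cmod_Cexp_le (z : C) : Cmod (Cexp z) <= exp (Cmod z).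
Proof.
  rewrite Cmod_Cexp. pose proof (abs_fst_le z) as H. pose proof (Rle_abs (fst z)).
  destruct (Rle_lt_or_eq_dec (fst z) (Cmod z)) as [H1|H1]; [lra | | rewrite <- H1; lra].
  left. apply exp_increasing. auto.
Qed.

Lemma exp_le_mono (x y : R) : x <= y -> exp x <= exp y.
Proof. intros [H| ->]; [left; apply exp_increasing; auto | lra]. Qed.

Lemma Cexp_lipschitz (a b : C) : Cmod (a - b) <= / 2 ->
  Cmod (Cexp a - Cexp b) <= 3 * Cmod (a - b) * exp (Cmod b).
Proof.
  intros H. replace (Cexp a - Cexp b)%C with ((Cexp (a - b) - 1) * Cexp b)%C.
  - apply Cmod_mult_le; [|apply Cmod_Cexp_le].
    replace (Cexp (a - b) - 1)%C with ((Cexp (a - b) - 1 - (a - b)) + (a - b))%C by ring.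
    eapply Rle_trans; [apply Cmod_triangle|]. pose proof (Cexp_taylor _ H).
    pose proof (Cmod_ge_0 (a - b)). nra.
  - replace a with ((a - b) + b)%C at 2 by ring. rewrite Cexp_plus. ring.
Qed.

Lemma one_minus_neq_0 (b : C) : Cmod b < 1 -> (1 - b)%C <> 0.
Proof.
  intros H. apply Cneq_of_Cmod. pose proof (Cmod_sub_ge (1 - b) 1) as H1.
  replace (1 - b - 1)%C with (- b)%C in H1 by ring. rewrite Cmod_opp, Cmod_1 in H1. lra.
Qed.

(** Both functions begin with 1 + 2b: the quotient has remainder 2 b^2 / (1 - b), at most 4 |b|^2 in
    size, and the exponential one at most 16 |b|^2. The common bound exp(4 |b|) controls long
    products. *)
Lemma moebius_vs_exp (b : C) : Cmod b <= / 4 ->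
  Cmod ((1 + b) / (1 - b) - Cexp (2 * b)) <= 20 * Cmod b ^ 2 /\
  Cmod ((1 + b) / (1 - b)) <= exp (4 * Cmod b) /\ Cmod (Cexp (2 * b)) <= exp (4 * Cmod b).
Proof.
  intros H. pose proof (Cmod_ge_0 b) as H0.
  assert (H2 : Cmod (2 * b) = 2 * Cmod b) by (rewrite Cmod_mult, Cmod_R, Rabs_pos_eq; lra).
  assert (Hn : (1 - b)%C <> 0) by (apply one_minus_neq_0; lra).
  assert (Hm : 3 / 4 <= Cmod (1 - b)).
  { pose proof (Cmod_sub_ge (1 - b) 1) as H1.
    replace (1 - b - 1)%C with (- b)%C in H1 by ring. rewrite Cmod_opp, Cmod_1 in H1. lra. }
  split; [|split].
  - replace ((1 + b) / (1 - b) - Cexp (2 * b))%C with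
      (2 * (b * b) / (1 - b) - (Cexp (2 * b) - 1 - 2 * b))%C by (field; auto).
    assert (T : Cmod (Cexp (2 * b) - 1 - 2 * b) <= 16 * Cmod b ^ 2).
    { eapply Rle_trans; [apply Cexp_taylor; lra|]. rewrite H2. nra. }
    assert (T2 : Cmod (2 * (b * b) / (1 - b)) <= 4 * Cmod b ^ 2).
    { rewrite Cmod_div, !Cmod_mult, Cmod_R, Rabs_pos_eq by (auto; lra).
      apply Rmult_le_reg_r with (Cmod (1 - b)); [lra|].
      unfold Rdiv. rewrite Rmult_assoc, Rinv_l, Rmult_1_r by lra. nra. }
    eapply Rle_trans; [apply Cmod_minus_le; eassumption|]. lra.
  - apply Rle_trans with (1 + 4 * Cmod b); [|apply exp_ineq1_le].
    rewrite Cmod_div by auto. apply Rmult_le_reg_r with (Cmod (1 - b)); [lra|].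
    unfold Rdiv. rewrite Rmult_assoc, Rinv_l, Rmult_1_r by lra.
    pose proof (Cmod_triangle 1 b) as T1. rewrite Cmod_1 in T1.
    pose proof (Cmod_sub_ge (1 - b) 1) as H1.
    replace (1 - b - 1)%C with (- b)%C in H1 by ring. rewrite Cmod_opp, Cmod_1 in H1. nra.
  - eapply Rle_trans; [apply Cmod_Cexp_le|]. rewrite H2. apply exp_le_mono. lra.
Qed.

(** Telescoping: exchanging one factor at a time costs [D] times a power of [rho]. *)
Lemma Cprod_diff (f h : nat -> C) l rho D : 1 <= rho -> 0 <= D ->
  (forall j, In j l -> Cmod (f j) <= rho /\ Cmod (h j) <= rho /\ Cmod (f j - h j) <= D) ->
  Cmod (Cprod f l) <= rho ^ length l /\
  Cmod (Cprod f l - Cprod h l) <= INR (length l) * D * rho ^ length l.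
Proof.
  intros Hr HD. induction l as [|a l IH]; intros H.
  - unfold Cprod. simpl. replace (1 - 1)%C with (RtoC 0) by ring. rewrite Cmod_1, Cmod_0. lra.
  - destruct IH as [I1 I2]; [intros; apply H; simpl; auto|].
    destruct (H a) as (A1 & A2 & A3); [simpl; auto|].
    unfold Cprod in *. simpl fold_right. set (F := fold_right Cmult 1%C (map f l)) in *.
    set (G := fold_right Cmult 1%C (map h l)) in *.
    change (length (a :: l)) with (S (length l)). rewrite S_INR. simpl pow.
    assert (P : 1 <= rho ^ length l) by (apply pow_R1_Rle; auto).
    pose proof (pos_INR (length l)) as PN. split.
    + apply Cmod_mult_le; auto.
    + replace (f a * F - h a * G)%C with ((f a - h a) * F + h a * (F - G))%C by ring.
      eapply Rle_trans; [apply Cmod_plus_le; apply Cmod_mult_le; eassumption|].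
      set (p := rho ^ length l) in *. set (n := INR (length l)) in *.
      assert (D * p <= D * (rho * p)) by (apply Rmult_le_compat_l; nra). nra.
Qed.

Lemma Cprod_app f l l' : Cprod f (l ++ l') = (Cprod f l * Cprod f l')%C.
Proof.
  induction l as [|a l IH]; unfold Cprod in *; simpl; [ring|]. rewrite IH. ring.
Qed.

Lemma Cprod_Cexp (c : C) (s : nat -> R) n :
  Cprod (fun j => Cexp (2 * (c * RtoC (s j))))%C (seq 0 (S n)) = Cexp (2 * (c * RtoC (sum_n s n)))%C.
Proof.
  induction n as [|n IH].
  - rewrite sum_O. unfold Cprod. simpl. ring.
  - rewrite seq_S, Cprod_app, IH. replace (sum_n s (S n)) with (sum_n s n + s (S n)) by (rewrite sum_Sn; reflexivity).
    unfold Cprod. simpl fold_right. rewrite Cmult_1_r, <- Cexp_plus, RtoC_plus. f_equal. ring.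
Qed.

Lemma exp_pow x n : exp x ^ n = exp (INR n * x).
Proof.
  induction n as [|n IH]; [simpl; rewrite Rmult_0_l, exp_0; auto|].
  rewrite S_INR. simpl. rewrite IH, <- exp_plus. f_equal. ring.
Qed.

(** Replacing every factor by its exponential turns the product into one exponential of the sum of
    the [s j], and only exponents remain to be compared. With [be] of order eps and of order 1/eps
    factors, the accumulated error is of order eps. *)
Lemma blaschke_vs_exp (v w c : C) (s : nat -> R) n (be V W ka : R) :
  0 <= be <= / 4 -> (forall j, (j < S n)%nat -> Cmod (c * RtoC (s j)) <= be) ->
  Cmod v <= V -> Cmod w <= W -> Cmod (v + 2 * (c * RtoC (sum_n s n)) - w) <= ka -> ka <= / 2 ->
  Cmod (Cexp v * Cprod (fun j => (1 + c * RtoC (s j)) / (1 - c * RtoC (s j))) (seq 0 (S n)) - Cexp w)%C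
  <= exp V * (INR (S n) * (20 * be ^ 2) * exp (INR (S n) * (4 * be))) + 3 * ka * exp W.
Proof.
  intros Hbe Hs Hv Hw Hka Hka2.
  set (F := Cprod (fun j => (1 + c * RtoC (s j)) / (1 - c * RtoC (s j)))%C (seq 0 (S n))).
  set (G := Cprod (fun j => Cexp (2 * (c * RtoC (s j))))%C (seq 0 (S n))).
  assert (FG : Cmod (F - G) <= INR (S n) * (20 * be ^ 2) * exp (INR (S n) * (4 * be))).
  { rewrite <- exp_pow.
    destruct (Cprod_diff (fun j => (1 + c * RtoC (s j)) / (1 - c * RtoC (s j)))%C
      (fun j => Cexp (2 * (c * RtoC (s j))))%C (seq 0 (S n)) (exp (4 * be)) (20 * be ^ 2)) as [_ H];
      [| | | rewrite length_seq in H; exact H].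
    - rewrite <- exp_0. apply exp_le_mono. lra.
    - nra.
    - intros j Hj. apply in_seq in Hj. specialize (Hs j ltac:(lia)). pose proof (Cmod_ge_0 (c * RtoC (s j))).
      destruct (moebius_vs_exp (c * RtoC (s j))) as (M1 & M2 & M3); [lra|].
      assert (exp (4 * Cmod (c * RtoC (s j))) <= exp (4 * be)) by (apply exp_le_mono; lra).
      repeat split; try lra. eapply Rle_trans; [exact M1|]. nra. }
  replace (Cexp v * F - Cexp w)%C with (Cexp v * (F - G) + (Cexp v * G - Cexp w))%C by ring.
  apply Cmod_plus_le.
  - apply Cmod_mult_le; auto. eapply Rle_trans; [apply Cmod_Cexp_le|]. apply exp_le_mono; auto.
  - unfold G. rewrite Cprod_Cexp, <- Cexp_plus.
    eapply Rle_trans; [apply Cexp_lipschitz; lra|].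
    apply Rmult_le_compat; [|left; apply exp_pos | | apply exp_le_mono; auto].
    + pose proof (Cmod_ge_0 (v + 2 * (c * RtoC (sum_n s n)) - w)). lra.
    + lra.
Qed.

Lemma sum_n_m_Sm_C (f : nat -> C) a b : (a <= S b)%nat ->
  sum_n_m f a (S b) = (sum_n_m f a b + f (S b))%C.
Proof. intros H. rewrite sum_n_Sm by auto. reflexivity. Qed.

Lemma sum_n_m_Sm_R (f : nat -> R) a b : (a <= S b)%nat ->
  sum_n_m f a (S b) = sum_n_m f a b + f (S b).
Proof. intros H. rewrite sum_n_Sm by auto. reflexivity. Qed.

Lemma sum_n_m_bound (f : nat -> C) (u : nat -> R) a b :
  (forall m, (a <= m <= b)%nat -> Cmod (f m) <= u m) ->
  Cmod (sum_n_m f a b) <= sum_n_m u a b.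
Proof.
  induction b as [|b IH]; intros H.
  - destruct a as [|a].
    + rewrite !sum_n_n. apply H. lia.
    + rewrite !sum_n_m_zero by lia. change (Cmod 0 <= 0). rewrite Cmod_0. lra.
  - destruct (Nat.le_gt_cases a (S b)) as [Hab|Hab].
    + rewrite sum_n_m_Sm_C, sum_n_m_Sm_R by auto. apply Cmod_plus_le; [apply IH; intros; apply H; lia | apply H; lia].
    + rewrite !sum_n_m_zero by lia. change (Cmod 0 <= 0). rewrite Cmod_0. lra.
Qed.

Lemma sum_n_m_scal_C (c : C) (f : nat -> C) a b :
  sum_n_m (fun m => c * f m)%C a b = (c * sum_n_m f a b)%C.
Proof. apply (sum_n_m_mult_l (K := C_Ring) c f). Qed.

Lemma sum_n_m_scal_R (c : R) (f : nat -> R) a b :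
  sum_n_m (fun m => c * f m) a b = c * sum_n_m f a b.
Proof. apply (sum_n_m_mult_l (K := R_Ring) c f). Qed.

Lemma CD_sum (f : nat -> C -> C) a b z : (forall m, CD (f m) z) ->
  CD (fun z => sum_n_m (fun m => f m z) a b) z.
Proof.
  intros H. induction b as [|b IH].
  - destruct a as [|a].
    + apply CD_ext_global with (f 0%nat); auto. intros w. rewrite sum_n_n. reflexivity.
    + apply CD_ext_global with (fun _ => RtoC 0); [|apply CD_const]. intros w. rewrite sum_n_m_zero by lia. reflexivity.
  - destruct (Nat.le_gt_cases a (S b)) as [Hab|Hab].
    + apply CD_ext_global with (fun z => sum_n_m (fun m => f m z) a b + f (S b) z)%C; [|apply CD_plus; auto].
      intros w. rewrite sum_n_m_Sm_C; auto.
    + apply CD_ext_global with (fun _ => RtoC 0); [|apply CD_const]. intros w. rewrite sum_n_m_zero by lia. reflexivity.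
Qed.

Lemma CD_pow (f : C -> C) n z : CD f z -> CD (fun z => Cpow (f z) n) z.
Proof.
  intros H. induction n as [|n IH]; simpl; [apply CD_const|]. apply CD_mult; auto.
Qed.

Lemma CD_Qphase Mdeg a t x z : CD (Qphase Mdeg a t x) z.
Proof.
  apply CD_plus; [apply CD_mult; [apply CD_id | apply CD_const]|].
  apply (CD_sum (fun m lam => Cpow lam m * RtoC (a m * t))%C). intros m.
  apply CD_mult; [apply (CD_pow (fun z => z)), CD_id | apply CD_const].
Qed.

Lemma Cconj_sum (f : nat -> C) a b : Cconj (sum_n_m f a b) = sum_n_m (fun m => Cconj (f m)) a b.
Proof.
  induction b as [|b IH].
  - destruct a as [|a]; [rewrite !sum_n_n; reflexivity|].
    rewrite !sum_n_m_zero by lia. apply Cconj_RtoC.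
  - destruct (Nat.le_gt_cases a (S b)) as [Hab|Hab].
    + rewrite !sum_n_m_Sm_C by auto. rewrite Cplus_conj, IH. reflexivity.
    + rewrite !sum_n_m_zero by lia. apply Cconj_RtoC.
Qed.

Lemma Qphase_conj Mdeg a t x z : Cconj (Qphase Mdeg a t x z) = Qphase Mdeg a t x (Cconj z).
Proof.
  unfold Qphase. rewrite Cplus_conj, Cmult_conj, Cconj_RtoC, Cconj_sum. f_equal.
  apply sum_n_m_ext. intros m. rewrite Cmult_conj, Cconj_RtoC, Cpow_conj. reflexivity.
Qed.

Lemma Qphase_plus Mdeg a t x t' x' z :
  Qphase Mdeg a (t + t') (x + x') z = (Qphase Mdeg a t x z + Qphase Mdeg a t' x' z)%C.
Proof.
  unfold Qphase.
  rewrite (sum_n_m_ext (fun m => Cpow z m * RtoC (a m * (t + t')))%C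
     (fun m => plus (Cpow z m * RtoC (a m * t)) (Cpow z m * RtoC (a m * t')))%C).
  - rewrite sum_n_m_plus. unfold plus; simpl. rewrite RtoC_plus. ring.
  - intros m. unfold plus; simpl. rewrite !RtoC_mult, RtoC_plus. ring.
Qed.

Definition soliton_exponent (Mdeg : nat) (a : nat -> R) (nu eps X T : R) (lam : C) : C :=
  (2 * Ci * Qphase Mdeg a (eps ^ (Mdeg + 1) / (a Mdeg * nu ^ Mdeg) * T) (eps ^ 2 / nu * X) lam / RtoC eps)%C.

(* The lower flow times contribute one more power of [eps / nu] each. *)
Lemma soliton_exponent_expansion Mdeg a nu eps X T B z :
  (2 <= Mdeg)%nat -> a Mdeg <> 0 -> 0 < eps -> eps <= nu -> Rabs T <= B -> Cmod z = 1 ->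
  Cmod (soliton_exponent Mdeg a nu eps X T (RtoC (nu / eps) * z)
        - 2 * Ci * (z * RtoC X + Cpow z Mdeg * RtoC T))
  <= eps * (2 * B / nu * sum_n_m (fun m => Rabs (a m / a Mdeg)) 2 (Mdeg - 1)).
Proof.
  intros HM Ha He Hen HT Hz.
  destruct Mdeg as [|M]; [lia|]. replace (S M - 1)%nat with M by lia.
  set (q := eps / nu). assert (Hnu : 0 < nu) by lra.
  assert (Hq : 0 < q) by (apply Rdiv_lt_0_compat; auto).
  assert (Hq1 : q <= 1). { unfold q. apply Rmult_le_reg_r with nu; auto. unfold Rdiv. rewrite Rmult_assoc, Rinv_l; lra. }
  assert (Ek : nu / eps = / q) by (unfold q; field; lra).
  set (dt := eps ^ (S M + 1) / (a (S M) * nu ^ S M) * T).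
  assert (Edt : dt = eps * (q ^ S M * T / a (S M))).
  { unfold dt, q. rewrite Nat.add_1_r. unfold Rdiv at 3. rewrite Rpow_mult_distr, pow_inv.
    change (eps ^ S (S M)) with (eps * eps ^ S M). field. split; [apply pow_nonzero; lra | auto]. }
  unfold soliton_exponent, Qphase. fold dt. rewrite sum_n_m_Sm_C by lia. rewrite Ek.
  set (lam := (RtoC (/ q) * z)%C).
  set (Sm := sum_n_m (fun m => Cpow lam m * RtoC (a m * dt))%C 2 M).
  assert (He0 : RtoC eps <> 0) by (apply RtoC_neq_0; lra).
  assert (Hqn : RtoC q <> 0) by (apply RtoC_neq_0; lra).
  assert (E1 : (lam * RtoC (eps ^ 2 / nu * X))%C = (RtoC eps * (z * RtoC X))%C).
  { unfold lam. replace (eps ^ 2 / nu * X) with (eps * (q * X)) by (unfold q; field; lra).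
    rewrite !RtoC_mult, RtoC_inv by lra. field. auto. }
  assert (Epow : forall m, Cpow lam m = (RtoC ((/ q) ^ m) * Cpow z m)%C).
  { intros m. unfold lam. rewrite Cpow_mult_l, RtoC_pow. reflexivity. }
  assert (E2 : (Cpow lam (S M) * RtoC (a (S M) * dt))%C = (RtoC eps * (Cpow z (S M) * RtoC T))%C).
  { rewrite Epow. replace (a (S M) * dt) with (eps * (q ^ S M * T)) by (rewrite Edt; field; auto).
    rewrite pow_inv.
    transitivity (RtoC (/ q ^ S M * (eps * (q ^ S M * T))) * Cpow z (S M))%C; [rewrite !RtoC_mult; ring|].
    replace (/ q ^ S M * (eps * (q ^ S M * T))) with (eps * T) by (field; apply pow_nonzero; lra).
    rewrite RtoC_mult. ring. }
  rewrite E1, E2.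
  replace (2 * Ci * (RtoC eps * (z * RtoC X) + (Sm + RtoC eps * (Cpow z (S M) * RtoC T))) / RtoC eps
     - 2 * Ci * (z * RtoC X + Cpow z (S M) * RtoC T))%C with (2 * Ci * / RtoC eps * Sm)%C by (field; auto).
  assert (Hmod : Cmod (2 * Ci * / RtoC eps) = 2 / eps).
  { rewrite !Cmod_mult, Cmod_Ci, Cmod_inv, !Cmod_R, !Rabs_pos_eq by (auto; lra). field; lra. }
  rewrite Cmod_mult, Hmod.
  assert (HS : Cmod Sm <= sum_n_m (fun m => eps * q * B * Rabs (a m / a (S M))) 2 M).
  { apply sum_n_m_bound. intros m Hm. rewrite Epow, !Cmod_mult, !Cmod_R, Cmod_pow, Hz, pow1, Rmult_1_r.
    rewrite (Rabs_pos_eq ((/ q) ^ m)) by (apply pow_le; left; apply Rinv_0_lt_compat; auto).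
    destruct (Nat.le_exists_sub m M) as (d & Ed & _); [lia|].
    (* The displacement in t carries q^(M+1), where M+1 is the full degree, while lambda^m has size
       q^(-m); for lower m at least one factor q survives. *)
    assert (EM : q ^ S M = q ^ m * (q * q ^ d)).
    { replace (S M) with (m + S d)%nat by lia. rewrite pow_add. reflexivity. }
    rewrite Edt, EM.
    replace (a m * (eps * (q ^ m * (q * q ^ d) * T / a (S M)))) with
      (q ^ m * (eps * q * (q ^ d * T) * (a m / a (S M)))) by (field; auto).
    rewrite Rabs_mult, (Rabs_pos_eq (q ^ m)) by (apply pow_le; lra).
    rewrite <- Rmult_assoc, <- Rpow_mult_distr, Rinv_l, pow1, Rmult_1_l by lra.
    rewrite Rabs_mult. apply Rmult_le_compat_r; [apply Rabs_pos|].
    rewrite Rabs_mult, (Rabs_pos_eq (eps * q)) by nra.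
    apply Rmult_le_compat_l; [nra|]. rewrite Rabs_mult, (Rabs_pos_eq (q ^ d)) by (apply pow_le; lra).
    assert (q ^ d <= 1) by (rewrite <- (pow1 d); apply pow_incr; lra).
    assert (0 <= q ^ d) by (apply pow_le; lra). pose proof (Rabs_pos T). nra. }
  rewrite sum_n_m_scal_R in HS.
  set (SA := sum_n_m (fun m => Rabs (a m / a (S M))) 2 M) in *.
  apply Rle_trans with (2 / eps * (eps * q * B * SA)).
  - apply Rmult_le_compat_l; auto. left. apply Rdiv_lt_0_compat; lra.
  - right. unfold q. field. lra.
Qed.

Lemma Cprod_div (f g : nat -> C) l : (forall j, In j l -> g j <> 0) ->
  (Cprod f l / Cprod g l)%C = Cprod (fun j => f j / g j)%C l.
Proof.
  induction l as [|a l IH]; intros H; unfold Cprod in *; simpl.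
  - field. 
  - rewrite <- IH by (intros; apply H; simpl; auto). field. split.
    + apply (Cprod_neq_0 g l). intros; apply H; simpl; auto.
    + apply H; simpl; auto.
Qed.

Lemma theta_bound Mdeg X T B z : Rabs X <= B -> Rabs T <= B -> Cmod z = 1 ->
  Cmod (2 * Ci * theta Mdeg X T z) <= 4 * B + 4.
Proof.
  intros HX HT Hz. rewrite !Cmod_mult, Cmod_Ci, Cmod_R, Rabs_pos_eq by lra.
  assert (Cmod (theta Mdeg X T z) <= B + B + 2); [|lra].
  assert (Hz0 : z <> 0) by (apply Cneq_of_Cmod; lra).
  unfold theta. apply Cmod_plus_le; [apply Cmod_plus_le|].
  - rewrite Cmod_mult, Cmod_R, Hz. lra.
  - rewrite Cmod_mult, Cmod_R, Cmod_pow, Hz, pow1. lra.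
  - rewrite Cmod_div, Cmod_R, Hz, Rabs_pos_eq by (auto; lra). lra.
Qed.

(* The reciprocal of the soliton jump function is obtained from it by the sign
   change [v -> -v, c -> -c], which is why both closeness bounds coincide. *)
Lemma soliton_jump_close Mdeg a nu L Smax B : (2 <= Mdeg)%nat -> a Mdeg <> 0 -> 0 < nu -> 0 < L -> 0 < Smax -> 0 < B ->
  exists Cst e0, 0 < Cst /\ 0 < e0 /\
  forall eps N s X T, 0 < eps <= e0 -> (1 <= N)%nat -> INR N * (eps * PI) = L ->
    (forall j, (j < N)%nat -> 0 < s j < Smax) ->
    Rabs (2 * PI * nu - eps * PI * sum_n s (pred N)) <= eps * PI * Smax ->
    Rabs X <= B -> Rabs T <= B ->
    close_jump (Cst * eps)
      (gsol N s (nu / eps) (fun lam => Cexp (soliton_exponent Mdeg a nu eps X T lam)))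
      (gPsi Mdeg X T).
Proof.
  intros HM Ha Hnu HL HS HB. pose proof PI_RGT_0 as HPI.
  set (SA := sum_n_m (fun m => Rabs (a m / a Mdeg)) 2 (Mdeg - 1)).
  assert (HSA : 0 <= SA).
  { unfold SA. assert (H := sum_n_m_bound (fun _ => RtoC 0) (fun m => Rabs (a m / a Mdeg)) 2 (Mdeg - 1)).
    eapply Rle_trans; [apply Cmod_ge_0 | apply H]. intros; rewrite Cmod_0. apply Rabs_pos. }
  set (c1 := 2 * B / nu * SA). assert (Hc1 : 0 <= c1).
  { unfold c1. apply Rmult_le_pos; auto. left; apply Rdiv_lt_0_compat; lra. }
  (* The exponents differ by [eps * kk]: [c1] comes from the lower flow times, the rest from the
     error of the Riemann sum. *)
  set (kk := c1 + 2 * (Smax / nu)). assert (HSn : 0 < Smax / nu) by (apply Rdiv_lt_0_compat; auto).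
  assert (Hkk : 0 < kk) by (unfold kk; lra).
  set (V := 4 * B + 1). set (W := 4 * B + 4).
  (* This is the product error of [blaschke_vs_exp], divided by eps, with N = L / (PI eps) factors
     and [be] = eps Smax / nu. *)
  set (d0 := 20 * (L / PI) * (Smax / nu) ^ 2 * exp (4 * (L / PI) * (Smax / nu))).
  assert (Hd0 : 0 < d0).
  { unfold d0. assert (0 < L / PI) by (apply Rdiv_lt_0_compat; auto).
    apply Rmult_lt_0_compat; [|apply exp_pos]. apply Rmult_lt_0_compat; [lra|]. apply pow_lt; auto. }
  set (Cst := exp V * d0 + 3 * kk * exp W).
  (* In order: [eps <= nu] for the expansion of the exponent, [be <= / 4] for the Moebius factors,
     and [eps * kk <= / 2] for the Lipschitz bound of the exponential. *)
  set (e0 := Rmin nu (Rmin (/ (4 * (Smax / nu))) (/ (2 * kk)))).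
  assert (HC : 0 < Cst).
  { unfold Cst. apply Rplus_lt_0_compat; apply Rmult_lt_0_compat; try apply exp_pos; auto. lra. }
  assert (He0 : 0 < e0). { unfold e0. repeat apply Rmin_pos; auto; apply Rinv_0_lt_compat; lra. }
  exists Cst, e0. split; [auto|]. split; [auto|].
  intros eps N s X T [He Hee] HN HNL Hs Hsum HX HT z Hz.
  assert (B1 : eps <= nu) by (eapply Rle_trans; [exact Hee | apply Rmin_l]).
  assert (B2 : eps <= / (4 * (Smax / nu))).
  { eapply Rle_trans; [exact Hee|]. eapply Rle_trans; [apply Rmin_r | apply Rmin_l]. }
  assert (B3 : eps <= / (2 * kk)).
  { eapply Rle_trans; [exact Hee|]. eapply Rle_trans; [apply Rmin_r | apply Rmin_r]. }
  assert (B2' : eps * (Smax / nu) <= / 4).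
  { apply Rmult_le_compat_r with (r := Smax / nu) in B2; [|lra].
    replace (/ (4 * (Smax / nu)) * (Smax / nu)) with (/ 4) in B2 by (field; lra). exact B2. }
  assert (B3' : eps * kk <= / 2).
  { apply Rmult_le_compat_r with (r := kk) in B3; [|lra].
    replace (/ (2 * kk) * kk) with (/ 2) in B3 by (field; lra). exact B3. }
  destruct N as [|n]; [lia|]. simpl pred in Hsum.
  set (k := nu / eps). assert (Hk : 0 < k) by (apply Rdiv_lt_0_compat; lra).
  set (kz := (RtoC k * z)%C).
  assert (Hkz : Cmod kz = k) by (unfold kz; rewrite Cmod_mult, Cmod_R, Hz, Rabs_pos_eq; lra).
  assert (Hkz0 : kz <> 0) by (apply Cneq_of_Cmod; lra).
  set (c := (Ci / kz)%C).
  assert (Hc : Cmod c = eps / nu).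
  { unfold c. rewrite Cmod_div, Cmod_Ci, Hkz by auto. unfold k. field. lra. }
  set (be := eps * (Smax / nu)). assert (Hbe : 0 <= be) by (unfold be; nra).
  assert (Hcs : forall j, (j < S n)%nat -> Cmod (c * RtoC (s j)) <= be).
  { intros j Hj. destruct (Hs j Hj) as [S1 S2]. rewrite Cmod_mult, Cmod_R, Hc, Rabs_pos_eq by lra.
    replace be with (eps / nu * Smax) by (unfold be; field; lra).
    apply Rmult_le_compat_l; [left; apply Rdiv_lt_0_compat; auto | lra]. }
  set (v := soliton_exponent Mdeg a nu eps X T kz).
  set (w := (2 * Ci * theta Mdeg X T z)%C).
  assert (Hv1 := soliton_exponent_expansion Mdeg a nu eps X T B z HM Ha He B1 HT Hz).
  fold SA c1 k kz v in Hv1.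
  set (v0 := (2 * Ci * (z * RtoC X + Cpow z Mdeg * RtoC T))%C) in *.
  assert (Hv0 : Cmod v0 <= 4 * B).
  { unfold v0. rewrite !Cmod_mult, Cmod_Ci, Cmod_R, Rabs_pos_eq by lra.
    assert (Cmod (z * RtoC X + Cpow z Mdeg * RtoC T) <= B + B); [|lra].
    apply Cmod_plus_le; rewrite Cmod_mult, Cmod_R, ?Cmod_pow, Hz, ?pow1; lra. }
  assert (Hv : Cmod v <= V).
  { replace v with ((v - v0) + v0)%C by ring. unfold V. rewrite Rplus_comm. apply Cmod_plus_le; auto.
    unfold kk in B3'. nra. }
  assert (Hw : Cmod w <= W) by (apply theta_bound; auto).
  assert (Hsm : Rabs (sum_n s n - 2 * k) <= Smax).
  { apply Rmult_le_reg_l with (eps * PI); [nra|].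
    rewrite <- (Rabs_pos_eq (eps * PI)) at 1 by nra. rewrite <- Rabs_mult, <- Rabs_Ropp.
    replace (- (eps * PI * (sum_n s n - 2 * k))) with (2 * PI * nu - eps * PI * sum_n s n)
      by (unfold k; field; lra). exact Hsum. }
  assert (Hz0 : z <> 0) by (apply Cneq_of_Cmod; lra).
  assert (Hkn : RtoC k <> 0) by (apply RtoC_neq_0; lra).
  (* With the main value 2k of the sum of the [s j], the term 2 c (2k) is 4 i / z, the contribution
     of the pole of [theta] at 0. *)
  assert (Hka : Cmod (v + 2 * (c * RtoC (sum_n s n)) - w) <= eps * kk).
  { replace (v + 2 * (c * RtoC (sum_n s n)) - w)%C with
      ((v - v0) + 2 * (c * RtoC (sum_n s n - 2 * k)))%C.
    - replace (eps * kk) with (eps * c1 + 2 * (eps / nu * Smax)) by (unfold kk; field; lra).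
      apply Cmod_plus_le; auto. rewrite !Cmod_mult, !Cmod_R, Hc, (Rabs_pos_eq 2) by lra.
      apply Rmult_le_compat_l; [lra|]. apply Rmult_le_compat_l; auto. left; apply Rdiv_lt_0_compat; auto.
    - unfold w, theta, v0, c, kz. rewrite RtoC_minus, RtoC_mult. field. auto. }
  assert (FIN : forall be' N', be' = be -> N' = INR (S n) ->
     exp V * (N' * (20 * be' ^ 2) * exp (N' * (4 * be'))) + 3 * (eps * kk) * exp W = Cst * eps).
  { intros be' N' -> ->. assert (EN : INR (S n) = L / PI / eps) by (rewrite <- HNL; field; lra).
    rewrite EN. unfold Cst, d0, be.
    replace (L / PI / eps * (4 * (eps * (Smax / nu)))) with (4 * (L / PI) * (Smax / nu)) by (field; lra).
    field. lra. }
  assert (Hkzs : forall j, In j (seq 0 (S n)) -> (kz - Ci * RtoC (s j))%C <> 0 /\ (kz + Ci * RtoC (s j))%C <> 0).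
  { intros j Hj. apply in_seq in Hj. specialize (Hcs j ltac:(lia)).
    replace (kz - Ci * RtoC (s j))%C with (kz * (1 - c * RtoC (s j)))%C by (unfold c; field; auto).
    replace (kz + Ci * RtoC (s j))%C with (kz * (1 - - (c * RtoC (s j))))%C by (unfold c; field; auto).
    fold be in B2'. split; apply Cmult_neq_0; auto; apply one_minus_neq_0; rewrite ?Cmod_opp; lra. }
  assert (G1 : gsol (S n) s k (fun lam => Cexp (soliton_exponent Mdeg a nu eps X T lam)) z
     = (Cexp v * Cprod (fun j => (1 + c * RtoC (s j)) / (1 - c * RtoC (s j))) (seq 0 (S n)))%C).
  { unfold gsol. fold kz. fold v. f_equal. unfold bnum, bden. rewrite Cprod_div by (intros; apply Hkzs; auto).
    unfold Cprod. f_equal. apply map_ext_in. intros j Hj. destruct (Hkzs j Hj) as [H1 H2].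
    assert (H3 : (1 - c * RtoC (s j))%C <> 0).
    { intros H0. apply H1. replace (kz - Ci * RtoC (s j))%C with (kz * (1 - c * RtoC (s j)))%C by (unfold c; field; auto).
      rewrite H0. ring. }
    unfold c in *. field. repeat split; auto. }
  assert (G2 : (/ gsol (S n) s k (fun lam => Cexp (soliton_exponent Mdeg a nu eps X T lam)) z
     = Cexp (- v) * Cprod (fun j => (1 + - c * RtoC (s j)) / (1 - - c * RtoC (s j))) (seq 0 (S n)))%C).
  { unfold gsol. fold kz. fold v. rewrite Cexp_opp.
    assert (N1 : bnum (S n) s kz <> 0) by (apply Cprod_neq_0; intros; apply Hkzs; auto).
    assert (N2 : bden (S n) s kz <> 0) by (apply Cprod_neq_0; intros; apply Hkzs; auto).
    transitivity (/ Cexp v * (bden (S n) s kz / bnum (S n) s kz))%C.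
    { field. repeat split; auto. apply Cexp_neq_0. }
    f_equal. unfold bnum, bden. rewrite Cprod_div by (intros; apply Hkzs; auto).
    unfold Cprod. f_equal. apply map_ext_in. intros j Hj. destruct (Hkzs j Hj) as [H1 H2].
    assert (H3 : (1 - - c * RtoC (s j))%C <> 0).
    { intros H0. apply H2. replace (kz + Ci * RtoC (s j))%C with (kz * (1 - - c * RtoC (s j)))%C by (unfold c; field; auto).
      rewrite H0. ring. }
    unfold c in *. field. repeat split; auto.
    intros H0. apply H2. rewrite <- H0. ring. }
  split.
  - rewrite G1. unfold gPsi. fold w. rewrite <- (FIN be (INR (S n))) by auto.
    apply blaschke_vs_exp; auto.
  - rewrite G2. unfold gPsi. fold w. rewrite <- Cexp_opp, <- (FIN be (INR (S n))) by auto.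
    apply blaschke_vs_exp; auto; rewrite ?Cmod_opp; auto.
    + intros j Hj. replace (- c * RtoC (s j))%C with (- (c * RtoC (s j)))%C by ring. rewrite Cmod_opp; auto.
    + replace (- v + 2 * (- c * RtoC (sum_n s n)) - - w)%C with (- (v + 2 * (c * RtoC (sum_n s n)) - w))%C by ring.
      rewrite Cmod_opp; auto.
Qed.

Lemma gPsi_close Mdeg X0 T0 dl : 0 < dl -> exists d, 0 < d /\
  forall X T, Rabs (X - X0) < d -> Rabs (T - T0) < d -> close_jump dl (gPsi Mdeg X T) (gPsi Mdeg X0 T0).
Proof.
  intros Hdl. set (B := Rabs X0 + Rabs T0). set (W := 4 * B + 4).
  pose proof (exp_pos W) as PW.
  (* The exponents differ by at most 4 d: [/ 8] keeps this below 1/2 as [Cexp_lipschitz] requires,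
     and the second bound makes its estimate 3 (4 d) exp W at most [dl]. *)
  set (d := Rmin (/ 8) (dl / (12 * exp W))).
  exists d. assert (Hd : 0 < d). { apply Rmin_pos; [lra | apply Rdiv_lt_0_compat; lra]. }
  split; auto. intros X T HX HT z Hz.
  pose proof (Rmin_l (/ 8) (dl / (12 * exp W))) as M1. pose proof (Rmin_r (/ 8) (dl / (12 * exp W))) as M2.
  fold d in M1, M2. pose proof (Rabs_pos X0). pose proof (Rabs_pos T0).
  set (w := (2 * Ci * theta Mdeg X T z)%C). set (w0 := (2 * Ci * theta Mdeg X0 T0 z)%C).
  assert (Hw0 : Cmod w0 <= W) by (apply theta_bound; auto; unfold B; lra).
  assert (Hww : Cmod (w - w0) <= 4 * d).
  { replace (w - w0)%C with (2 * Ci * (z * RtoC (X - X0) + Cpow z Mdeg * RtoC (T - T0)))%C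
      by (unfold w, w0, theta; rewrite !RtoC_minus; ring).
    rewrite !Cmod_mult, Cmod_Ci, Cmod_R, Rabs_pos_eq by lra.
    assert (Cmod (z * RtoC (X - X0) + Cpow z Mdeg * RtoC (T - T0)) <= d + d); [|lra].
    apply Cmod_plus_le; rewrite Cmod_mult, Cmod_R, ?Cmod_pow, Hz, ?pow1; lra. }
  assert (F : forall a b : C, Cmod (a - b) <= 4 * d -> Cmod b <= W -> Cmod (Cexp a - Cexp b) <= dl).
  { intros a b Hab Hb. eapply Rle_trans; [apply Cexp_lipschitz; lra|].
    apply Rle_trans with (3 * (4 * d) * exp W).
    - pose proof (Cmod_ge_0 (a - b)). apply Rmult_le_compat; try lra; [left; apply exp_pos|].
      apply exp_le_mono; auto.
    - apply Rmult_le_compat_r with (r := 12 * exp W) in M2; [|lra].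
      replace (dl / (12 * exp W) * (12 * exp W)) with dl in M2 by (field; lra). lra. }
  unfold gPsi. fold w w0. rewrite <- !Cexp_opp. split; apply F; auto.
  - replace (- w - - w0)%C with (- (w - w0))%C by ring. rewrite Cmod_opp; auto.
  - rewrite Cmod_opp; auto.
Qed.

(** * The soliton ensemble at the focusing times *)

(** Restores the carrier [C] in equations typed by a structure of the hierarchy, so that [ring]
    recognises them. *)
Ltac as_C := match goal with |- ?x = ?y => change (@eq C x y) end.

Lemma sum_n_m_extend (f : nat -> C) a b b' : (a <= S b)%nat -> (b <= b')%nat ->
  (forall m, (b < m <= b')%nat -> f m = 0%C) -> sum_n_m f a b' = sum_n_m f a b.
Proof.
  intros Ha Hb. induction Hb as [|b' Hb IH]; intros H; auto.
  rewrite sum_n_m_Sm_C by lia. rewrite IH by (intros; apply H; lia). rewrite (H (S b')) by lia. apply Cplus_0_r.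
Qed.

Lemma sum_even_odd (f : nat -> C) R :
  sum_n_m f 0 (2 * R + 1) =
  (sum_n_m (fun p => f (2 * p)%nat) 0 R + sum_n_m (fun q => f (2 * q - 1)%nat) 1 (R + 1))%C.
Proof.
  induction R as [|R IH].
  - change (2 * 0 + 1)%nat with 1%nat. change (0 + 1)%nat with 1%nat.
    rewrite sum_n_m_Sm_C by lia. rewrite !sum_n_n. reflexivity.
  - replace (2 * S R + 1)%nat with (S (S (2 * R + 1)))%nat by lia.
    replace (S R + 1)%nat with (S (R + 1))%nat by lia.
    rewrite !sum_n_m_Sm_C, IH by lia.
    replace (2 * S R)%nat with (S (2 * R + 1)) by lia.
    replace (2 * S (R + 1) - 1)%nat with (S (S (2 * R + 1))) by lia.
    as_C. ring.
Qed.

Lemma Cpow_0_pos n : (0 < n)%nat -> Cpow 0%C n = 0%C.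
Proof. destruct n; [lia|]. intros _. simpl. ring. Qed.

Lemma even_double p : Nat.even (2 * p) = true.
Proof. apply Nat.even_spec. exists p. lia. Qed.

Lemma even_double_pred q : (1 <= q)%nat -> Nat.even (2 * q - 1) = false.
Proof.
  intros H. replace (2 * q - 1)%nat with (S (2 * (q - 1))) by lia.
  rewrite Nat.even_succ, <- Nat.negb_even, even_double. reflexivity.
Qed.

Lemma parity_form m : exists p, m = (2 * p)%nat \/ m = (2 * S p - 1)%nat.
Proof.
  destruct (Nat.Even_or_Odd m) as [[p H]|[p H]]; exists p; [left | right]; lia.
Qed.

(* The flow times [a m * t] at which [2 i Q] cancels the tail [Xi] and leaves
   an odd multiple of the phase integral. *)
Definition focus_coeff (K : Z) (PhiC XiC : nat -> R) (m : nat) : R :=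
  if Nat.even m then - / 2 * (2 * IZR K + 1) * PhiC (Nat.div2 m)
  else - / 2 * XiC (Nat.div2 (m + 1)).

Lemma focus_coeff_even K PhiC XiC p :
  focus_coeff K PhiC XiC (2 * p) = - / 2 * (2 * IZR K + 1) * PhiC p.
Proof. unfold focus_coeff. rewrite even_double, Nat.div2_double. reflexivity. Qed.

Lemma focus_coeff_odd K PhiC XiC q : (1 <= q)%nat ->
  focus_coeff K PhiC XiC (2 * q - 1) = - / 2 * XiC q.
Proof.
  intros H. unfold focus_coeff. rewrite even_double_pred by auto.
  replace (2 * q - 1 + 1)%nat with (2 * q)%nat by lia. rewrite Nat.div2_double. reflexivity.
Qed.

(** The position -Xi_1/2 supplies the linear coefficient of the same pattern that the flow times
    supply from degree 2 on. Only the constant term is missing from Q, which is why Phi_0 is left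
    over and can later produce the sign. *)
Lemma Qphase_at_focus (P Q : nat) (PhiC XiC : nat -> R) (a : nat -> R) (t0 : R) (K : Z) (lam : C) :
  let Mdeg := Nat.max (2 * P) (2 * Q - 1) in
  (2 <= Mdeg)%nat -> (1 <= Q)%nat ->
  (forall p, (P < p)%nat -> PhiC p = 0) -> (forall q, (Q < q)%nat -> XiC q = 0) ->
  (forall m, (2 <= m <= Mdeg)%nat -> a m * t0 = focus_coeff K PhiC XiC m) ->
  (2 * Ci * Qphase Mdeg a t0 (- / 2 * XiC 1%nat) lam =
   - (Ci * sum_n_m (fun q => RtoC (XiC q) * Cpow lam (2 * q - 1)) 1 Q)
   - Ci * RtoC (2 * IZR K + 1) * (sum_n_m (fun p => RtoC (PhiC p) * Cpow lam (2 * p)) 0 P - RtoC (PhiC 0%nat)))%C.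
Proof.
  intros Mdeg HM HQ HPhi HXi Ha.
  set (b := focus_coeff K PhiC XiC). set (f := fun m => (Cpow lam m * RtoC (b m))%C).
  assert (E1 : Qphase Mdeg a t0 (- / 2 * XiC 1%nat) lam = (sum_n_m f 0 Mdeg - RtoC (b 0%nat))%C).
  { rewrite sum_Sn_m by lia. rewrite sum_Sn_m by lia. unfold Qphase.
    rewrite (sum_n_m_ext_loc _ f 2 Mdeg).
    - change (plus (f 0%nat) (plus (f 1%nat) (sum_n_m f 2 Mdeg))) with (f 0%nat + (f 1%nat + sum_n_m f 2 Mdeg))%C.
      unfold f at 2 3. simpl Cpow.
      replace (b 1%nat) with (- / 2 * XiC 1%nat) by (unfold b; rewrite <- focus_coeff_odd with (K := K) (PhiC := PhiC); auto).
      ring.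
    - intros m Hm. unfold f, b. rewrite Ha by lia. reflexivity. }
  (* The coefficients vanish beyond [Mdeg]; extending the range to [2 * Mdeg + 1] lets
     [sum_even_odd] separate the parities. *)
  assert (E2 : sum_n_m f 0 Mdeg = sum_n_m f 0 (2 * Mdeg + 1)).
  { symmetry. apply sum_n_m_extend; try lia. intros m Hm. unfold f.
    replace (b m) with 0; [ring|]. symmetry. unfold b. destruct (parity_form m) as [p [-> | ->]].
    - rewrite focus_coeff_even, HPhi by lia. ring.
    - rewrite focus_coeff_odd, HXi by lia. ring. }
  rewrite E1, E2, sum_even_odd.
  rewrite (sum_n_m_ext (fun p => f (2 * p)%nat)
     (fun p => RtoC (- / 2 * (2 * IZR K + 1)) * (RtoC (PhiC p) * Cpow lam (2 * p)))%C).
  2:{ intros p. unfold f, b. rewrite focus_coeff_even, RtoC_mult. as_C. ring. }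
  rewrite (sum_n_m_ext_loc (fun q => f (2 * q - 1)%nat)
     (fun q => RtoC (- / 2) * (RtoC (XiC q) * Cpow lam (2 * q - 1)))%C).
  2:{ intros q Hq. unfold f, b. rewrite focus_coeff_odd, RtoC_mult by lia. as_C. ring. }
  rewrite !sum_n_m_scal_C.
  rewrite (sum_n_m_extend _ 0 P Mdeg); [|lia|lia|intros m Hm; rewrite HPhi by lia; as_C; ring].
  rewrite (sum_n_m_extend _ 1 Q (Mdeg + 1)); [|lia|lia|intros m Hm; rewrite HXi by lia; as_C; ring].
  replace (b 0%nat) with (- / 2 * (2 * IZR K + 1) * PhiC 0%nat) by (symmetry; apply (focus_coeff_even K PhiC XiC 0)).
  rewrite !RtoC_mult, !RtoC_opp, !RtoC_inv by lra. field.
Qed.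

Lemma powerRZ_m1_succ k : powerRZ (-1) (Z.succ k) = - powerRZ (-1) k.
Proof. unfold Z.succ. rewrite powerRZ_add by lra. simpl. ring. Qed.

Lemma Cexp_i_pi : Cexp (Ci * RtoC PI)%C = RtoC (-1).
Proof.
  unfold Cexp. replace (fst (Ci * RtoC PI)%C) with 0 by (simpl; ring).
  replace (snd (Ci * RtoC PI)%C) with PI by (simpl; ring).
  rewrite exp_0, cos_PI, sin_PI. apply injective_projections; simpl; ring.
Qed.

Lemma Cexp_i_half_pi : Cexp (- (Ci * RtoC (PI / 2)))%C = (- Ci)%C.
Proof.
  unfold Cexp. replace (fst (- (Ci * RtoC (PI / 2)))%C) with 0 by (simpl; ring).
  replace (snd (- (Ci * RtoC (PI / 2)))%C) with (- (PI / 2)) by (simpl; ring).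
  rewrite exp_0, cos_neg, sin_neg, cos_PI2, sin_PI2. apply injective_projections; simpl; ring.
Qed.

Lemma Cexp_i_pi_Z k : Cexp (Ci * RtoC (IZR k * PI))%C = RtoC (powerRZ (-1) k).
Proof.
  assert (S : forall k, Cexp (Ci * RtoC (IZR (Z.succ k) * PI))%C = (- Cexp (Ci * RtoC (IZR k * PI)))%C).
  { intros j. replace (Ci * RtoC (IZR (Z.succ j) * PI))%C with (Ci * RtoC (IZR j * PI) + Ci * RtoC PI)%C.
    - rewrite Cexp_plus, Cexp_i_pi. ring.
    - rewrite succ_IZR, Rmult_plus_distr_r, RtoC_plus, Rmult_1_l. ring. }
  revert k. apply Z.bi_induction.
  - intros x y ->. reflexivity.
  - replace (Ci * RtoC (IZR 0 * PI))%C with (RtoC 0) by (rewrite Rmult_0_l; ring).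
    rewrite Cexp_0. reflexivity.
  - intros j. rewrite S, powerRZ_m1_succ, RtoC_opp. split; intros H.
    + rewrite H. reflexivity.
    + replace (Cexp (Ci * RtoC (IZR j * PI)))%C with (- - Cexp (Ci * RtoC (IZR j * PI)))%C by ring.
      rewrite H. ring.
Qed.

Lemma powerRZ_m1_sq k : powerRZ (-1) k * powerRZ (-1) k = 1.
Proof.
  revert k. apply Z.bi_induction.
  - intros x y ->. reflexivity.
  - simpl. ring.
  - intros j. rewrite powerRZ_m1_succ. split; intros H; lra.
Qed.

(** The half-integer part contributes exp(-i pi/2) = -i, and the integer part has the parity of K +
    N - n, so the dependence on n cancels against (-1)^(n+1). *)
Lemma focus_sign (K : Z) (N n : nat) :
  (RtoC ((-1) ^ (n + 1)) * Cexp (Ci * RtoC ((2 * IZR K + 1) * (INR N - (INR n + / 2)) * PI)))%C =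
  (Ci * RtoC (powerRZ (-1) (K + Z.of_nat N)))%C.
Proof.
  (* The exponent is k pi - pi/2; in [k] the summand [j + j] is even and drops out of the sign. *)
  set (j := (K * (Z.of_nat N - Z.of_nat n) - K)%Z).
  set (k := (j + j + (K + Z.of_nat N) - Z.of_nat n)%Z).
  replace (Ci * RtoC ((2 * IZR K + 1) * (INR N - (INR n + / 2)) * PI))%C
    with (Ci * RtoC (IZR k * PI) + - (Ci * RtoC (PI / 2)))%C.
  2:{ unfold k, j. rewrite !INR_IZR_INZ.
      repeat (rewrite ?plus_IZR, ?minus_IZR, ?mult_IZR).
      apply injective_projections; simpl; field. }
  rewrite Cexp_plus, Cexp_i_pi_Z, Cexp_i_half_pi.
  assert (E : (-1) ^ (n + 1) * powerRZ (-1) k = - powerRZ (-1) (K + Z.of_nat N)).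
  { rewrite pow_add, pow_1, pow_powerRZ.
    replace (powerRZ (-1) (Z.of_nat n) * -1 * powerRZ (-1) k) with
      (- (powerRZ (-1) (Z.of_nat n) * powerRZ (-1) k)) by ring.
    rewrite <- powerRZ_add by lra.
    replace (Z.of_nat n + k)%Z with (j + j + (K + Z.of_nat N))%Z by (unfold k; lia).
    rewrite (powerRZ_add (-1) (j + j)), (powerRZ_add (-1) j j), powerRZ_m1_sq by lra. ring. }
  rewrite Cmult_assoc, <- RtoC_mult, E, RtoC_opp. ring.
Qed.

Lemma Cexp_RtoC (x : R) : Cexp (RtoC x) = RtoC (exp x).
Proof. unfold Cexp. simpl. rewrite cos_0, sin_0. apply injective_projections; simpl; ring. Qed.

Lemma soliton_exponent_conj Mdeg a nu eps X T z : eps <> 0 ->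
  Cconj (soliton_exponent Mdeg a nu eps X T z) = (- soliton_exponent Mdeg a nu eps X T (Cconj z))%C.
Proof.
  intros He. unfold soliton_exponent. rewrite Cdiv_conj by (apply RtoC_neq_0; auto).
  rewrite !Cmult_conj, Qphase_conj, !Cconj_RtoC.
  replace (Cconj Ci) with (- Ci)%C by (apply injective_projections; simpl; ring).
  field. apply RtoC_neq_0; auto.
Qed.

Lemma CD_soliton_exponent Mdeg a nu eps X T z : CD (soliton_exponent Mdeg a nu eps X T) z.
Proof.
  apply CD_mult; [|apply CD_const]. apply CD_mult; [apply CD_const|]. apply CD_Qphase.
Qed.

(* [d] plays three roles at once: radius of validity, admissible size of the
   jump perturbation, and inverse Lipschitz constant; this is the shape needed
   by [compactness_value_2d]. *)
Lemma Psi_locally_stable Mdeg Psi0 X0 T0 : is_Psi Mdeg X0 T0 Psi0 ->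
  exists d : posreal, forall X T eta g a1 a2 b1 b2 w a1' a2' b1' b2' w',
  Rabs (X - X0) < d -> Rabs (T - T0) < d -> 0 < eta <= d ->
  close_jump eta g (gPsi Mdeg X T) ->
  row_sol g a1 a2 b1 b2 -> row_sol (gPsi Mdeg X T) a1' a2' b1' b2' ->
  b1 0%C = 1%C -> b2 0%C = 0%C -> b1' 0%C = 1%C -> b2' 0%C = 0%C ->
  Clim (Cpunct 0%C) (fun z => b2 z / z)%C w -> Clim (Cpunct 0%C) (fun z => b2' z / z)%C w' ->
  Cmod (w - w') <= eta / d.
Proof.
  intros H. destruct (Psi_rows _ _ _ _ H) as (p1 & p2 & P1 & P2 & q1 & q2 & Q1 & Q2 & w0 & Hp & Hq & E1 & E2 & E3 & E4 & Hw & _).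
  destruct (perturbation _ _ _ _ _ _ _ _ _ _ Hp Hq E1 E2 E3 E4 (fun z _ => Cexp_neq_0 _) Hw)
    as (dl & Kc & Hdl & HK & HP).
  assert (Hdl2 : 0 < dl / 2) by lra.
  destruct (gPsi_close Mdeg X0 T0 (dl / 2) Hdl2) as (d & Hd & Hcl).
  assert (HKi : 0 < / Kc) by (apply Rinv_0_lt_compat; auto).
  set (m := Rmin d (Rmin (dl / 2) (/ Kc))). assert (Hm : 0 < m) by (repeat apply Rmin_pos; auto).
  pose proof (Rmin_l d (Rmin (dl / 2) (/ Kc))) as M1. pose proof (Rmin_r d (Rmin (dl / 2) (/ Kc))) as M2.
  pose proof (Rmin_l (dl / 2) (/ Kc)) as M3. pose proof (Rmin_r (dl / 2) (/ Kc)) as M4. fold m in M1, M2.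
  exists (mkposreal m Hm). simpl.
  intros X T eta g a1 a2 b1 b2 w a1' a2' b1' b2' w' HX HT [He1 He2] Hc R1 R2 F1 F2 F3 F4 L1 L2.
  assert (C1 : close_jump (dl / 2) (gPsi Mdeg X T) (gPsi Mdeg X0 T0)) by (apply Hcl; lra).
  apply Rle_trans with (Kc * eta).
  - apply (HP g (gPsi Mdeg X T) eta a1 a2 b1 b2 a1' a2' b1' b2'); auto.
    + intros z Hz. destruct (Hc z Hz) as [A1 A2]. destruct (C1 z Hz) as [A3 A4]. split.
      * replace (g z - gPsi Mdeg X0 T0 z)%C with ((g z - gPsi Mdeg X T z) + (gPsi Mdeg X T z - gPsi Mdeg X0 T0 z))%C by ring.
        eapply Rle_trans; [apply Cmod_plus_le; eassumption | lra].
      * replace (/ g z - / gPsi Mdeg X0 T0 z)%C with ((/ g z - / gPsi Mdeg X T z) + (/ gPsi Mdeg X T z - / gPsi Mdeg X0 T0 z))%C by ring.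
        eapply Rle_trans; [apply Cmod_plus_le; eassumption | lra].
    + intros z Hz. destruct (C1 z Hz). split; lra.
  - unfold Rdiv. rewrite (Rmult_comm eta). apply Rmult_le_compat_r; [lra|].
    rewrite <- (Rinv_inv Kc). apply Rinv_le_contravar; lra.
Qed.

(** * Quantisation, norming constants and the final estimate *)

Section Core.

Variables (A : R -> R) (Xm Xp x0 : R) (xm xp : R -> R).
Hypothesis hKS : semicircular_KS A Xm Xp x0 xm xp.
Variables (P Q : nat) (PhiC XiC : nat -> R).
Hypothesis hPhi : forall s, 0 < s < A x0 ->
     RtoC (Phi_is A xm xp s)
     = sum_n_m (fun p => (RtoC (PhiC p) * Cpow (Ci * RtoC s) (2 * p))%C) 0 P.
Hypothesis hPhi0 : forall p, (P < p)%nat -> PhiC p = 0.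
Hypothesis hQ : (1 <= Q)%nat.
Hypothesis hXi : forall s, 0 < s < A x0 ->
     RtoC (Xi_is A xm xp s)
     = (Ci * sum_n_m (fun q => (RtoC (XiC q) * Cpow (Ci * RtoC s) (2 * q - 1))%C) 1 Q)%C.
Hypothesis hXi0 : forall q, (Q < q)%nat -> XiC q = 0.
Variable st : nat -> nat -> R.
Hypothesis hst : forall N n, (1 <= N)%nat -> (n < N)%nat ->
     0 < st N n < A x0 /\
     Phi_is A xm xp (st N n) = (INR n + / 2) * epsN A N * PI.

Let L := RInt A Xm Xp.
Let PhiPoly (lam : C) : C := sum_n_m (fun p => (RtoC (PhiC p) * Cpow lam (2 * p))%C) 0 P.

Lemma Amax_pos : 0 < A x0.
Proof. destruct (hst 1 0) as [H _]; auto. lra. Qed.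

Lemma CD_PhiPoly z : CD PhiPoly z.
Proof.
  apply (CD_sum (fun p lam => RtoC (PhiC p) * Cpow lam (2 * p))%C). intros p.
  apply CD_mult; [apply CD_const | apply (CD_pow (fun z => z)), CD_id].
Qed.

(** The polynomial identity holds for s > 0 only, so the constant term is obtained as s tends to 0:
    the phase integral lies between L - s (Xp - Xm) and L. *)
Lemma PhiC_0 : PhiC 0%nat = L.
Proof.
  apply RtoC_inj, Ceq_of_small. intros e He.
  assert (E0 : PhiPoly 0%C = RtoC (PhiC 0%nat)).
  { unfold PhiPoly. rewrite (sum_n_m_extend _ 0 0 P); try lia.
    - rewrite sum_n_n. simpl. ring.
    - intros m Hm. rewrite Cpow_0_pos by lia. ring. }
  pose proof Amax_pos as HA. pose proof (KS_interval _ _ _ _ _ _ hKS) as HX.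
  assert (He2 : 0 < e / 2) by lra.
  destruct (CD_cont _ _ (CD_PhiPoly 0%C) _ He2) as (d & Hd & Hc).
  set (s := Rmin (A x0 / 2) (Rmin (d / 2) (e / 2 / (Xp - Xm)))).
  assert (Hs : 0 < s). { repeat apply Rmin_pos; try lra. apply Rdiv_lt_0_compat; lra. }
  pose proof (Rmin_l (A x0 / 2) (Rmin (d / 2) (e / 2 / (Xp - Xm)))) as M1.
  pose proof (Rmin_r (A x0 / 2) (Rmin (d / 2) (e / 2 / (Xp - Xm)))) as M2.
  pose proof (Rmin_l (d / 2) (e / 2 / (Xp - Xm))) as M3. pose proof (Rmin_r (d / 2) (e / 2 / (Xp - Xm))) as M4.
  fold s in M1, M2.
  assert (Hsd : Cmod (Ci * RtoC s - 0) < d).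
  { replace (Ci * RtoC s - 0)%C with (Ci * RtoC s)%C by ring.
    rewrite Cmod_mult, Cmod_Ci, Cmod_R, Rabs_pos_eq; lra. }
  specialize (Hc _ Hsd). unfold PhiPoly at 1 in Hc. rewrite <- hPhi, E0 in Hc by lra.
  rewrite (Phi_is_PhiT _ _ _ _ _ _ hKS) in Hc by lra.
  pose proof (PhiT_lower _ _ _ _ _ _ hKS s ltac:(lra)) as T1. fold L in T1.
  pose proof (PhiT_antitone _ _ _ _ _ _ hKS 0 s ltac:(lra) ltac:(lra)) as T2.
  rewrite (PhiT_0 _ _ _ _ _ _ hKS) in T2. fold L in T2.
  assert (T3 : s * (Xp - Xm) <= e / 2).
  { apply Rle_trans with (e / 2 / (Xp - Xm) * (Xp - Xm)); [apply Rmult_le_compat_r; lra|].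
    right. field. lra. }
  rewrite <- RtoC_minus, Cmod_R in *. apply Rabs_def2 in Hc. apply Rabs_le. lra.
Qed.

(** On the open interval the phase integral is a polynomial in s; its values at the endpoints do not
    affect integrability. *)
Lemma ex_RInt_Phi_is a b : 0 <= a -> a <= b -> b <= A x0 -> ex_RInt (Phi_is A xm xp) a b.
Proof.
  intros Ha Hab Hb. apply ex_RInt_ext with (fun s => fst (PhiPoly (Ci * RtoC s)%C)).
  - rewrite Rmin_left, Rmax_right by auto. intros s Hs. unfold PhiPoly. rewrite <- hPhi by lra. reflexivity.
  - apply (ex_RInt_fst (fun s => PhiPoly (Ci * RtoC s)%C)); auto. intros s _.
    apply (RC_comp PhiPoly (fun s => Ci * RtoC s)%C).
    + apply RC_mult; [apply RC_const|]. apply (RC_pair (fun s => s) (fun _ => 0)); [apply continuous_id | apply continuous_const].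
    + apply CD_cont, CD_PhiPoly.
Qed.

Lemma Phi_is_antitone x y : 0 < x -> x <= y -> y < A x0 -> Phi_is A xm xp y <= Phi_is A xm xp x.
Proof.
  intros Hx Hxy Hy. rewrite !(Phi_is_PhiT _ _ _ _ _ _ hKS) by lra.
  apply (PhiT_antitone _ _ _ _ _ _ hKS); lra.
Qed.

Lemma Phi_is_range x : 0 < x < A x0 -> 0 <= Phi_is A xm xp x <= L.
Proof.
  intros Hx. rewrite (Phi_is_PhiT _ _ _ _ _ _ hKS) by lra.
  split; [apply (PhiT_ge_0 _ _ _ _ _ _ hKS)|].
  unfold L. rewrite <- (PhiT_0 _ _ _ _ _ _ hKS). apply (PhiT_antitone _ _ _ _ _ _ hKS); lra.
Qed.

Lemma L_pos : 0 < L.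
Proof. apply (RInt_A_pos _ _ _ _ _ _ hKS). Qed.

Lemma eps_N N : (1 <= N)%nat -> INR N * (epsN A N * PI) = L.
Proof. apply (epsN_eq _ _ _ _ _ _ hKS). Qed.

(** A constant phase integral would have to equal L/2 by the quantisation for N = 1 and L/4 by that
    for N = 2. *)
Lemma P_pos : (1 <= P)%nat.
Proof.
  destruct (Nat.eq_dec P 0) as [E|]; [exfalso|lia].
  assert (HC : forall s, 0 < s < A x0 -> Phi_is A xm xp s = PhiC 0%nat).
  { intros s Hs. apply RtoC_inj. rewrite hPhi, E, sum_n_n by auto. simpl. ring. }
  destruct (hst 1 0) as [H1 H2]; auto. destruct (hst 2 0) as [H3 H4]; auto.
  rewrite HC in H2, H4 by auto. pose proof (eps_N 1 ltac:(lia)) as E1. pose proof (eps_N 2 ltac:(lia)) as E2.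
  simpl in *. pose proof L_pos. nra.
Qed.

Let nu := / (2 * PI) * RInt (Phi_is A xm xp) 0 (A x0).

Lemma two_pi_nu : 2 * PI * nu = RInt (Phi_is A xm xp) 0 (A x0).
Proof. unfold nu. pose proof PI_RGT_0. field. lra. Qed.

(** The quantised point for N = 1 has phase integral L/2, so by monotonicity the integral up to that
    point is at least L/2 times its abscissa. *)
Lemma nu_pos : 0 < nu.
Proof.
  pose proof PI_RGT_0 as HPI. destruct (hst 1 0) as [H1 H2]; auto. set (s := st 1%nat 0%nat) in *.
  pose proof (eps_N 1 ltac:(lia)) as E1. simpl in E1, H2. pose proof L_pos as HL.
  assert (Hs : Phi_is A xm xp s = L / 2) by (rewrite H2, <- E1; field).
  assert (I : RInt (Phi_is A xm xp) 0 (A x0) = RInt (Phi_is A xm xp) 0 s + RInt (Phi_is A xm xp) s (A x0)).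
  { apply RInt_Chasles_R; apply ex_RInt_Phi_is; lra. }
  assert (I1 : L / 2 * (s - 0) <= RInt (Phi_is A xm xp) 0 s).
  { rewrite <- RInt_const_R. apply RInt_le; [lra | apply ex_RInt_const | apply ex_RInt_Phi_is; lra |].
    intros x Hx. rewrite <- Hs. apply Phi_is_antitone; lra. }
  assert (I2 : 0 <= RInt (Phi_is A xm xp) s (A x0)).
  { apply RInt_ge_0; [lra | apply ex_RInt_Phi_is; lra |]. intros x Hx. apply Phi_is_range. lra. }
  unfold nu. apply Rmult_lt_0_compat; [apply Rinv_0_lt_compat; lra|]. rewrite I. nra.
Qed.

Lemma st_inj N n m : (1 <= N)%nat -> (n < N)%nat -> (m < N)%nat -> st N n = st N m -> n = m.
Proof.
  intros HN Hn Hm E. destruct (hst N n HN Hn) as [_ H1]. destruct (hst N m HN Hm) as [_ H2].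
  rewrite E, H2 in H1. pose proof (epsN_pos _ _ _ _ _ _ hKS N HN). pose proof PI_RGT_0.
  apply Rmult_eq_reg_r in H1; [|lra]. apply Rmult_eq_reg_r in H1; [|lra].
  apply INR_eq. lra.
Qed.

Let Mdeg := Nat.max (2 * P) (2 * Q - 1).

Variables (a : nat -> R) (t0 : R) (K : Z).
Hypothesis ha : forall m, (2 <= m <= Mdeg)%nat -> a m * t0 = focus_coeff K PhiC XiC m.

(** At the focus the phase contributes exp(-Xi/eps), which cancels the exponential in the norming
    constant, and exp(i (2K+1) (N - n - 1/2) pi), since Phi_0 = L = N eps pi. [focus_sign] turns the
    rest into a constant, and the displacement enters only through [soliton_exponent]. *)
Lemma cn_at_focus N n X T : (1 <= N)%nat -> (n < N)%nat ->
  cn A xm xp N (st N) Mdeg a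
    (- / 2 * XiC 1%nat + epsN A N ^ 2 / nu * X)
    (t0 + epsN A N ^ (Mdeg + 1) / (a Mdeg * nu ^ Mdeg) * T) n
  = ((Ci * RtoC (powerRZ (-1) (K + Z.of_nat N))) *
     (Cexp (soliton_exponent Mdeg a nu (epsN A N) X T (Ci * RtoC (st N n))) *
       (Cprod (fun j => Ci * RtoC (st N n) + Ci * RtoC (st N j)) (seq 0 N) /
        Cprod (fun j => Ci * RtoC (st N n) - Ci * RtoC (st N j))
        (filter (fun j => negb (Nat.eqb j n)) (seq 0 N)))))%C.
Proof.
  intros HN Hn. destruct (hst N n HN Hn) as [Hs HPhi].
  set (eps := epsN A N) in *. assert (He : 0 < eps) by apply (epsN_pos _ _ _ _ _ _ hKS N HN).
  assert (Hec : RtoC eps <> 0) by (apply RtoC_neq_0; lra).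
  set (s := st N n) in *. set (lam := (Ci * RtoC s)%C).
  unfold cn. fold eps s lam.
  rewrite Qphase_plus.
  replace (2 * Ci * (Qphase Mdeg a t0 (- / 2 * XiC 1%nat) lam
      + Qphase Mdeg a (eps ^ (Mdeg + 1) / (a Mdeg * nu ^ Mdeg) * T) (eps ^ 2 / nu * X) lam) / RtoC eps)%C
   with (2 * Ci * Qphase Mdeg a t0 (- / 2 * XiC 1%nat) lam / RtoC eps + soliton_exponent Mdeg a nu eps X T lam)%C
   by (unfold soliton_exponent; field; auto).
  rewrite Cexp_plus.
  assert (EQ := Qphase_at_focus P Q PhiC XiC a t0 K lam ltac:(pose proof P_pos; lia) hQ hPhi0 hXi0 ha).
  fold Mdeg in EQ. rewrite EQ. unfold lam. rewrite <- hXi, <- hPhi by auto. fold lam.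
  rewrite PhiC_0, HPhi, <- (eps_N N HN). fold eps.
  set (Xi := Xi_is A xm xp s).
  replace ((- RtoC Xi - Ci * RtoC (2 * IZR K + 1) * (RtoC ((INR n + / 2) * eps * PI) - RtoC (INR N * (eps * PI)))) / RtoC eps)%C
   with (RtoC (- (Xi / eps)) + Ci * RtoC ((2 * IZR K + 1) * (INR N - (INR n + / 2)) * PI))%C.
  2:{ replace (- (Xi / eps)) with (- Xi * / eps) by (field; lra).
      replace ((INR n + / 2) * eps * PI) with (eps * ((INR n + / 2) * PI)) by ring.
      replace (INR N * (eps * PI)) with (eps * (INR N * PI)) by ring.
      replace ((2 * IZR K + 1) * (INR N - (INR n + / 2)) * PI) with ((2 * IZR K + 1) * (INR N * PI - (INR n + / 2) * PI)) by ring.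
      rewrite !(RtoC_mult eps), !(RtoC_mult (2 * IZR K + 1)), RtoC_minus, (RtoC_mult (- Xi)), RtoC_inv, RtoC_opp by lra.
      field. auto. }
  rewrite Cexp_plus, Cexp_RtoC, exp_Ropp.
  rewrite <- (focus_sign K N n). rewrite RtoC_mult, RtoC_inv by (apply Rgt_not_eq, exp_pos).
  assert (Hx : RtoC (exp (Xi / eps)) <> 0) by (apply RtoC_neq_0, Rgt_not_eq, exp_pos).
  unfold Cprod. set (D := fold_right Cmult 1%C _). set (D2 := fold_right Cmult 1%C _).
  unfold Cdiv. set (ID := (/ D2)%C). set (x := RtoC (exp (Xi / eps))) in *.
  replace (RtoC ((-1) ^ (n + 1))) with (RtoC ((-1) ^ (n + 1)) * 1)%C at 2 by ring.
  replace (RtoC 1) with (x * / x)%C by (field; auto). ring.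
Qed.

Variables (psiT : nat -> R -> R -> C) (Psi : R -> R -> C).
Hypothesis hpsiT : forall N x t, (1 <= N)%nat ->
     is_psi_tilde A xm xp N (st N) Mdeg a x t (psiT N x t).
Hypothesis hPsi : forall X T, is_Psi Mdeg X T (Psi X T).
Hypothesis haM : a Mdeg <> 0.

(** The scaled coefficients differ by at most Cst eps / d uniformly in (X, T); the scale 2 nu / eps
    turns this into the constant 2 nu Cst / d. *)
Lemma focusing_at_coeffs :
  focusing_asymptotics psiT Psi (epsN A) (- / 2 * XiC 1%nat) t0 nu (a Mdeg) Mdeg K.
Proof.
  intros B HB. pose proof PI_RGT_0 as HPI. pose proof nu_pos as Hnu. pose proof Amax_pos as HA.
  pose proof L_pos as HL.
  assert (HM : (2 <= Mdeg)%nat) by (unfold Mdeg; pose proof P_pos; lia).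
  destruct (soliton_jump_close Mdeg a nu L (A x0) B HM haM Hnu HL HA HB) as (Cst & e0 & HC & He0 & Hjump).
  set (dl := fun u v => proj1_sig (constructive_indefinite_description _ (Psi_locally_stable Mdeg _ u v (hPsi u v)))).
  destruct (compactness_value_2d (- B) B (- B) B dl) as [d Hd].
  pose proof (cond_pos d) as Pd.
  (* The bound [nu / A x0] places all poles within the circle of radius nu / eps, and [d / Cst]
     makes the jump perturbation admissible for every local estimate of the covering that is
     used. *)
  set (e1 := Rmin e0 (Rmin (nu / A x0) (d / Cst))).
  assert (He1 : 0 < e1) by (repeat apply Rmin_pos; auto; apply Rdiv_lt_0_compat; auto).
  pose proof (Rmin_l e0 (Rmin (nu / A x0) (d / Cst))) as M1. pose proof (Rmin_r e0 (Rmin (nu / A x0) (d / Cst))) as M2.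
  pose proof (Rmin_l (nu / A x0) (d / Cst)) as M3. pose proof (Rmin_r (nu / A x0) (d / Cst)) as M4. fold e1 in M1, M2.
  destruct (epsN_small _ _ _ _ _ _ hKS e1 He1) as (N0 & HN0).
  exists (2 * nu * (Cst / d)), N0. intros N HN X T HX HT.
  destruct (HN0 N HN) as [HN1 He]. pose proof (epsN_pos _ _ _ _ _ _ hKS N HN1) as Pe.
  pose proof (cn_at_focus N) as Hcn.
  pose proof (eps_N N HN1) as EN.
  set (eps := epsN A N) in *.
  set (k := nu / eps). assert (Hk : 0 < k) by (apply Rdiv_lt_0_compat; auto).
  set (sg := powerRZ (-1) (K + Z.of_nat N)).
  set (kappa := (Ci * RtoC sg)%C).
  set (E := fun lam => Cexp (soliton_exponent Mdeg a nu eps X T lam)).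
  destruct (hpsiT N (- / 2 * XiC 1%nat + eps ^ 2 / nu * X)
     (t0 + eps ^ (Mdeg + 1) / (a Mdeg * nu ^ Mdeg) * T) HN1) as (Mf & HRHP & wt & Hwt & Epsi).
  assert (Hsk : forall n, (n < N)%nat -> 0 < st N n < k).
  { intros n Hn. destruct (hst N n HN1 Hn) as [[S1 S2] _]. split; auto.
    apply Rlt_le_trans with (A x0); auto. unfold k.
    apply Rmult_le_reg_r with eps; auto. replace (nu / eps * eps) with nu by (field; lra).
    apply Rle_trans with (A x0 * (nu / A x0)); [apply Rmult_le_compat_l; lra | right; field; lra]. }
  assert (Hsg : sg * sg = 1) by apply powerRZ_m1_sq.
  assert (Ckap : Cconj kappa = (- kappa)%C).
  { unfold kappa. rewrite Cmult_conj, Cconj_RtoC. apply injective_projections; simpl; ring. }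
  assert (Hkap : (kappa * kappa)%C = (-1)%C).
  { unfold kappa. replace (Ci * RtoC sg * (Ci * RtoC sg))%C with (Ci * Ci * RtoC (sg * sg))%C
      by (rewrite RtoC_mult; ring). rewrite Hsg. apply injective_projections; simpl; ring. }
  assert (ED : forall z, CD E z).
  { intros z. apply (CD_comp (soliton_exponent Mdeg a nu eps X T) Cexp); [apply CD_soliton_exponent | apply CD_Cexp]. }
  assert (Ec : forall z, Cconj (E z) = (/ E (Cconj z))%C).
  { intros z. unfold E. rewrite Cexp_conj, soliton_exponent_conj, Cexp_opp by lra. reflexivity. }
  destruct (soliton_row N (st N) _ Mf k kappa E wt Hsk (fun n m Hn Hm => st_inj N n m HN1 Hn Hm) Hk Hkap Ckap
    ED (fun z => Cexp_neq_0 _) Ec (fun n Hn => Hcn n X T HN1 Hn) HRHP Hwt)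
    as (a1 & a2 & b1 & b2 & Hrow & F1 & F2 & Lw).
  destruct (Psi_rows _ _ _ _ (hPsi X T)) as (p1 & p2 & P1 & P2 & _ & _ & _ & _ & w' & Hp & _ & G1 & G2 & _ & _ & Lp & EPsi).
  apply Rabs_le_between in HX as HX'. apply Rabs_le_between in HT as HT'.
  destruct (NNPP _ (Hd X T ltac:(lra) ltac:(lra))) as (u & v & _ & _ & Hu & Hv & Hduv).
  unfold dl in Hu, Hv, Hduv.
  destruct (constructive_indefinite_description _ (Psi_locally_stable Mdeg _ u v (hPsi u v))) as [d' Hd']. simpl in Hu, Hv, Hduv.
  assert (Hclose : close_jump (Cst * eps) (gsol N (st N) k E) (gPsi Mdeg X T)).
  { apply Hjump; auto; [lra | intros j Hj; apply (hst N j HN1 Hj) |].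
    rewrite two_pi_nu. apply monotone_quantile_sum; auto.
    - apply Rmult_lt_0_compat; auto.
    - apply ex_RInt_Phi_is.
    - apply Phi_is_antitone.
    - rewrite EN. apply Phi_is_range.
    - intros j Hj. destruct (hst N j HN1 Hj) as [S1 S2]. split; auto. rewrite S2. fold eps. ring. }
  assert (Heta : Cst * eps <= d).
  { apply Rle_trans with (Cst * (d / Cst)); [apply Rmult_le_compat_l; lra | right; field; lra]. }
  assert (Fin := Hd' X T (Cst * eps) _ _ _ _ _ _ _ _ _ _ _ Hu Hv (conj (Rmult_lt_0_compat _ _ HC Pe) (Rle_trans _ _ _ Heta Hduv))
     Hclose Hrow Hp F1 F2 G1 G2 Lw Lp).
  rewrite <- Cminus_conj, Cmod_conj in Fin.
  assert (Hkn : RtoC k <> 0) by (apply RtoC_neq_0; lra).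
  rewrite Epsi, EPsi. fold eps. fold k. fold sg.
  (* Since kappa^2 = -1, 2 i wt equals 2 i k kappa (-kappa wt / k), which exposes the scaled
     coefficient estimated by [Fin]. *)
  replace (2 * Ci * wt - Ci * RtoC (sg * k) * (2 * Ci * w'))%C
    with (2 * Ci * RtoC k * kappa * (- kappa * wt / RtoC k - w'))%C.
  2:{ replace (2 * Ci * RtoC k * kappa * (- kappa * wt / RtoC k - w'))%C
        with (2 * Ci * (- (kappa * kappa) * wt) - 2 * Ci * RtoC k * kappa * w')%C by (field; auto).
      rewrite Hkap. unfold kappa. rewrite RtoC_mult. ring. }
  assert (Ckm : Cmod kappa = 1).
  { unfold kappa. rewrite Cmod_mult, Cmod_Ci, Cmod_R, Rmult_1_l.
    assert (Rabs sg * Rabs sg = 1) by (rewrite <- Rabs_mult, Hsg; apply Rabs_R1).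
    pose proof (Rabs_pos sg). nra. }
  rewrite !Cmod_mult, Cmod_Ci, Ckm, !Cmod_R, (Rabs_pos_eq 2), (Rabs_pos_eq k) by lra.
  pose proof (cond_pos d') as Pd'.
  apply Rle_trans with (2 * k * (Cst * eps / d)).
  + replace (2 * 1 * k * 1) with (2 * k) by ring. apply Rmult_le_compat_l; [lra|].
    eapply Rle_trans; [exact Fin|]. apply Rmult_le_compat_l; [apply Rmult_le_pos; lra|].
    apply Rinv_le_contravar; auto.
  + right. unfold k. field. lra.
Qed.

End Core.

Theorem theorem3
  (A : R -> R) (Xm Xp x0 : R) (xm xp : R -> R)
  (hKS : semicircular_KS A Xm Xp x0 xm xp)
  (P Q : nat) (PhiC XiC : nat -> R)
  (hPhi : forall s, 0 < s < A x0 ->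
     RtoC (Phi_is A xm xp s)
     = sum_n_m (fun p => (RtoC (PhiC p) * Cpow (Ci * RtoC s) (2 * p))%C) 0 P)
  (hPhiP : PhiC P <> 0)
  (hPhi0 : forall p, (P < p)%nat -> PhiC p = 0)
  (hQ : (1 <= Q)%nat)
  (hXi : forall s, 0 < s < A x0 ->
     RtoC (Xi_is A xm xp s)
     = (Ci * sum_n_m (fun q => (RtoC (XiC q) * Cpow (Ci * RtoC s) (2 * q - 1))%C) 1 Q)%C)
  (hXiQ : XiC Q <> 0)
  (hXi0 : forall q, (Q < q)%nat -> XiC q = 0)
  (st : nat -> nat -> R)
  (hst : forall N n, (1 <= N)%nat -> (n < N)%nat ->
     0 < st N n < A x0 /\
     Phi_is A xm xp (st N n) = (INR n + / 2) * epsN A N * PI)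
  (psiT : (nat -> R) -> nat -> R -> R -> C)
  (hpsiT : forall a N x t, (1 <= N)%nat ->
     is_psi_tilde A xm xp N (st N) (Nat.max (2 * P) (2 * Q - 1)) a x t (psiT a N x t))
  (Psi : R -> R -> C)
  (hPsi : forall X T, is_Psi (Nat.max (2 * P) (2 * Q - 1)) X T (Psi X T)) :
  let Mdeg := Nat.max (2 * P) (2 * Q - 1) in
  let xcirc := - / 2 * XiC 1%nat in
  let nu := / (2 * PI) * RInt (Phi_is A xm xp) 0 (A x0) in
  (* (1) Xi is a linear monomial *)
  ((Q = 1%nat) ->
     forall alpha : R, alpha <> 0 ->
     let a := fun m : nat =>
       if Nat.even m then - / 2 * alpha * PhiC (Nat.div2 m) else 0 in
     forall K : Z,
       focusing_asymptotics (psiT a) Psi (epsN A) xcirc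
         ((2 * IZR K + 1) / alpha) nu (a Mdeg) Mdeg K) /\
  (* (2) otherwise *)
  ((Q <> 1%nat) ->
     forall (K : Z) (alpha : R), alpha <> 0 ->
     let a := fun m : nat =>
       if Nat.even m then - / 2 * alpha * (2 * IZR K + 1) * PhiC (Nat.div2 m)
       else - / 2 * alpha * XiC (Nat.div2 (m + 1)) in
       focusing_asymptotics (psiT a) Psi (epsN A) xcirc
         (/ alpha) nu (a Mdeg) Mdeg K).
Proof.
  intros Mdeg xcirc nu.
  assert (HP : (1 <= P)%nat) by (eapply P_pos; eauto).
  split.
  - intros HQ1 alpha Hal a K.
    apply (focusing_at_coeffs A Xm Xp x0 xm xp hKS P Q PhiC XiC hPhi hPhi0 hQ hXi hXi0 st hst); auto.
    + intros m Hm. unfold a, focus_coeff. destruct (Nat.even m) eqn:Em.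
      * field. auto.
      (* An odd index m >= 2 is at least 3, so its tail coefficient has index above Q = 1 and
         vanishes, in agreement with the zero flow time. *)
      * destruct (parity_form m) as [p [-> | ->]]; [rewrite even_double in Em; discriminate|].
        replace (2 * S p - 1 + 1)%nat with (2 * S p)%nat by lia.
        rewrite Nat.div2_double, hXi0 by lia. ring.
    + unfold a. replace (Nat.max (2 * P) (2 * Q - 1)) with (2 * P)%nat by lia.
      rewrite even_double, Nat.div2_double. repeat apply Rmult_integral_contrapositive_currified; auto. lra.
  - intros HQ1 K alpha Hal a.
    (* Oddness makes the factor nonzero, which is needed for the top coefficient when the degree is
       even. *)
    assert (HK : 2 * IZR K + 1 <> 0).
    { rewrite <- mult_IZR, <- plus_IZR. apply not_0_IZR. lia. }
    apply (focusing_at_coeffs A Xm Xp x0 xm xp hKS P Q PhiC XiC hPhi hPhi0 hQ hXi hXi0 st hst); auto.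
    + intros m Hm. unfold a, focus_coeff. destruct (Nat.even m); field; auto.
    (* The top flow time comes from Xi_Q or from Phi_P according to which degree is larger; the
       exactness of the degrees makes it nonzero. *)
    + unfold a. destruct (Nat.max_spec (2 * P) (2 * Q - 1)) as [[_ ->]|[_ ->]].
      * rewrite even_double_pred by auto. replace (2 * Q - 1 + 1)%nat with (2 * Q)%nat by lia.
        rewrite Nat.div2_double. repeat apply Rmult_integral_contrapositive_currified; auto. lra.
      * rewrite even_double, Nat.div2_double. repeat apply Rmult_integral_contrapositive_currified; auto. lra.
Qed.
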